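(* The Heawood graph is intrinsically chiral.
   Context: The Heawood graph is the graph with vertices $v_0,\dots,v_{13}$ (indices mod $14$), with edges joining $v_i$ to $v_{i+1}$ for all $i$, and edges joining $v_i$ to $v_{i+5}$ for all even $i$. Embeddings of graphs in $S^3$ are tame. A graph embedded in $S^3$ is achiral if there is an orientation reversing homeomorphism of $S^3$ that takes the embedded graph to itself setwise (edge labels and edge orientations are disregarded); otherwise it is chiral. An abstract graph is intrinsically chiral if every embedding of the graph in $S^3$ is chiral. *)

(* Defs.v *)
From HB Require Import structures.
From mathcomp Require Import freeg.
From mathcomp Require Import all_boot all_order all_algebra.
From mathcomp Require Import all_classical all_reals all_analysis.

Set Implicit Arguments.
Unset Strict Implicit.
Unset Printing Implicit Defensive.

Import Order.TTheory GRing.Theory Num.Theory.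
Import numFieldNormedType.Exports.

Local Open Scope classical_set_scope.
Local Open Scope ring_scope.

(* Throughout, a set [A : set T] in a topological space is used as a space via
   the coercion [set_type], which carries the subspace topology. *)

Definition homeomorphism (X Y : topologicalType) (h : X -> Y) : Prop :=
  continuous h /\
  exists g : Y -> X, [/\ continuous g, cancel h g & cancel g h].

(* The last clause says that X carries the topology induced by f, that is, f is
   a homeomorphism onto its image. *)
Definition topological_embedding (X Y : topologicalType) (f : X -> Y) : Prop :=
  [/\ continuous f, injective f &
      forall U : set X, open U -> exists2 V : set Y, open V & f @^-1` V = U].

Definition std_simplex (R : realType) (n : nat) : set 'rV[R]_n.+1 :=
  [set t | (forall i, 0 <= t 0 i) /\ \sum_i t 0 i = 1].
Arguments std_simplex : clear implicits.

Definition face_row (R : realType) (n : nat) (i : 'I_n.+2)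
    (t : 'rV[R]_n.+1) : 'rV[R]_n.+2 :=
  \row_j (if unlift i j is Some k then t 0 k else 0).

Lemma face_row_simplex (R : realType) (n : nat) (i : 'I_n.+2)
    (t : std_simplex R n) :
  face_row i (set_val t) \in std_simplex R n.+1.
Proof.
apply/mem_set; have [t0 t1] := set_valP t; split.
  by move=> j; rewrite mxE; case: unliftP.
rewrite (bigD1_ord i)//= mxE unlift_none add0r -[RHS]t1.
by apply: eq_bigr => j _; rewrite mxE liftK.
Qed.

Definition face_fun (R : realType) (n : nat) (i : 'I_n.+2)
    (t : std_simplex R n) : std_simplex R n.+1 :=
  exist _ (face_row i (set_val t)) (face_row_simplex i t).

Lemma face_row_continuous (R : realType) (n : nat) (i : 'I_n.+2) :
  continuous (@face_row R n i).
Proof.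
move=> t A [P nP PA].
pose Q k := [set u : 'rV[R]_n.+1 | P 0 (lift i k) (u 0 k)].
have nQ : \forall u \near t, forall k, Q k u.
  apply: (@filter_forall _ 'I_n.+1 Q (nbhs t) (nbhs_filter t)) => k.
  have := nP 0 (lift i k); rewrite mxE liftK => /coord_continuous.
  exact.
apply: filterS nQ => u Qu; apply: PA => a j.
rewrite (ord1 a) mxE; case: unliftP => [k ->|->]; first exact: Qu.
by have := nP 0 i; rewrite mxE unlift_none => /nbhs_singleton.
Qed.

Lemma face_continuous (R : realType) (n : nat) (i : 'I_n.+2) :
  continuous (@face_fun R n i).
Proof.
apply: continuous_comp_initial => t.
have -> : set_val \o @face_fun R n i = face_row i \o set_val by [].
apply: continuous_comp; first exact: initial_continuous.
exact: face_row_continuous.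
Qed.

Definition face (R : realType) (n : nat) (i : 'I_n.+2) :
    continuousType (std_simplex R n) (std_simplex R n.+1) :=
  mkcts (@face_continuous R n i).

Notation singular_simplex R n X := (continuousType (std_simplex R n) X).

Notation chain R n X := {freeg (singular_simplex R n X) / int}.

Definition boundary (R : realType) (n : nat) (X : topologicalType)
    (c : chain R n.+1 X) : chain R n X :=
  fglift (fun s : singular_simplex R n.+1 X =>
    \sum_(i < n.+2)
      << (-1) ^+ i *g (s \o face R i : singular_simplex R n X) >>) c.

Definition push_chain (R : realType) (n : nat) (X Y : topologicalType)
    (f : continuousType X Y) (c : chain R n X) : chain R n Y :=
  fglift (fun s : singular_simplex R n X =>
    << (f \o s : singular_simplex R n Y) >>) c.

(* [f] acts on H_(n+1)(X; Z) as multiplication by [d]. *)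
Definition acts_on_homology_by (R : realType) (n : nat) (X : topologicalType)
    (f : continuousType X X) (d : int) : Prop :=
  forall z : chain R n.+1 X, boundary z = 0 ->
  exists w : chain R n.+2 X, push_chain f z - z *~ d = boundary w.

Definition S3 (R : realType) : set 'rV[R]_4 :=
  [set x | \sum_i x 0 i ^+ 2 = 1].
Arguments S3 : clear implicits.

(* H_3(S^3; Z) is infinite cyclic; reversing orientation means degree -1. *)
Definition orientation_reversing (R : realType)
    (h : continuousType (S3 R) (S3 R)) : Prop :=
  acts_on_homology_by R 2 h (-1).

(* The shorter great-circle arc from [p] to [q], when [q] is not antipodal to
   [p]; just the two points when it is. *)
Definition geodesic_arc (R : realType) (p q : S3 R) : set (S3 R) :=
  [set x | exists a b : R,
     [/\ 0 <= a, 0 <= b & set_val x = a *: set_val p + b *: set_val q]].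

(* Radial projection of S^3 to the boundary of a 4-simplex around the origin
   takes geodesic arcs to broken lines, so polygonality below is piecewise
   linearity for the standard PL structure of S^3. *)
Definition polygonal (R : realType) (A : set (S3 R)) : Prop :=
  exists s : seq (S3 R * S3 R),
    A = \bigcup_(pq in [set` s]) geodesic_arc pq.1 pq.2.

(* Geometric realization of the simple graph with adjacency relation [e]: the
   vertex [i] is the [i]-th standard basis vector, and the edge [ij] is the
   segment joining the two basis vectors. *)
Definition realization (R : realType) (n : nat) (e : rel 'I_n) :
    set 'rV[R]_n :=
  [set t | [/\ forall i, 0 <= t 0 i, \sum_i t 0 i = 1 &
     exists i j, (i == j) || e i j /\
       forall k, t 0 k != 0 -> (k == i) || (k == j)]].
Arguments realization : clear implicits.

Definition tame_embedding (R : realType) (n : nat) (e : rel 'I_n)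
    (f : realization R n e -> S3 R) : Prop :=
  topological_embedding f /\
  exists2 h : S3 R -> S3 R, homeomorphism h & polygonal (h @` range f).

Definition achiral (R : realType) (G : set (S3 R)) : Prop :=
  exists h : continuousType (S3 R) (S3 R),
    [/\ homeomorphism h, orientation_reversing h & h @` G = G].

Definition chiral (R : realType) (G : set (S3 R)) : Prop := ~ achiral G.

Definition intrinsically_chiral (R : realType) (n : nat) (e : rel 'I_n) :
    Prop :=
  forall f : realization R n e -> S3 R, tame_embedding f -> chiral (range f).

Definition heawood_arc (i j : 'I_14) : bool :=
  (j == i + 1 %[mod 14])%N || ~~ odd i && (j == i + 5 %[mod 14])%N.

Definition heawood : rel 'I_14 :=
  [rel i j | heawood_arc i j || heawood_arc j i].

Lemma heawood_sym : symmetric heawood.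
Proof. by move=> i j; rewrite /heawood /= orbC. Qed.

Lemma heawood_irrefl : irreflexive heawood.
Proof.
move=> i; apply: negbTE; move: i.
by case; do 14?[case=> //].
Qed.

(* Main.v *)
Require Import Defs.
From mathcomp Require Import all_reals.
From HB Require Import structures.
From mathcomp Require Import freeg.
From mathcomp Require Import all_boot all_order all_algebra.
From mathcomp Require Import all_classical all_analysis.
From mathcomp Require Import ring lra.

Set Implicit Arguments.
Unset Strict Implicit.
Unset Printing Implicit Defensive.

Import Order.TTheory GRing.Theory Num.Theory.
Import numFieldNormedType.Exports.

Local Open Scope classical_set_scope.
Local Open Scope ring_scope.

(* Suppose that a homeomorphism h of S^3 of degree -1 preserves the image of an
   embedding f of the Heawood graph G.  The induced homeomorphism q of G maps
   vertices to vertices, since they have degree 3, hence edges to edges, so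
   that it is homotopic to a graph automorphism v.  In the deleted product, the
   pairs of points of G on disjoint edges, consider the sum Z of the products
   of disjoint edges, oriented from even to odd vertices, counted twice if the
   two edges are joined by a third one.  Modulo 4 it is a cycle, invariant under
   v up to homotopy, and with t the swap of coordinates it has a tower
   Z = c - t c, bd c = b + t b, bd b = a - t a, where a consists of an odd
   number of points; moreover both projections kill it.
   In the 2-connected space of pairs of distinct points of S^3, the image of Z
   bounds some w.  The difference n of the two projections of w is a cycle of
   S^3, and its class in H_3(S^3; Z/4) does not depend on w, because the two
   projections agree on H_3 of that space, up to homotopy equal to S^3 embedded
   as the antidiagonal.  As h x h carries Z to a homologous cycle, in the image
   of the deleted product, the classes of n and h n = - n agree: 2 n = 0.  But
   comparing the tower of Z with the tower of hemispheres of the antidiagonal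
   gives 2 n = 2 [S^3], which does not vanish modulo 4. *)

(** * Free modules *)

(** The weights and the modulus come from the Fano plane, whose incidence graph is G: two vertices
    of equal parity have exactly one common neighbour. Let a vertex x lie off an edge e. If x is
    adjacent to an end of e, then two edges at x are disjoint from e and both are joined to it: the
    weights are 2 + 2. Otherwise all three are disjoint from e and exactly one is joined to it: 2 +
    1 + 1. Parity orients these edges all into x or all out of x, so nothing cancels, and every such
    pair occurs in the boundary of the integral sum with coefficient 4 up to sign. The weights
    depend on adjacency only, and reversing all edges preserves each product of two, so that
    automorphisms exchanging the parities fix Z as well. Modulo 2 the relation 2 n = 0 would be
    empty; modulo 4 it excludes an odd n. That n is odd is a fact of Borsuk-Ulam type: it depends on
    the tower for the swap and not on the embedding. *)

Section FreeModule.
Variable K : comNzRingType.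

HB.instance Definition _ (M : lmodType K) (T : choiceType) (f : T -> M) :=
  GRing.isZmodMorphism.Build {freeg T / K} M (fglift f) (lift_is_additive f).

(** Both sides are expanded over the support of [x], since that of [a *: x] may be smaller when [K]
    has zero divisors, as Z/4 does. *)
Lemma fglift_scalable (M : lmodType K) (T : choiceType) (f : T -> M) :
  scalable (@fglift K M T f).
Proof.
move=> a x.
have xE : fglift f x = \sum_(z <- dom x) fglift f << coeff z x *g z >>.
  by rewrite -raddf_sum freeg_sumE.
rewrite xE scaler_sumr.
transitivity (\sum_(z <- dom x) fglift f << coeff z (a *: x) *g z >>).
  rewrite -raddf_sum /=; congr (fglift f _); apply/eqP/freeg_eqP => y.
  rewrite coeffZ raddf_sum /=.
  under eq_bigr do rewrite coeffU coeffZ -mulrA -coeffU.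
  by rewrite -mulr_sumr -raddf_sum freeg_sumE.
by apply: eq_bigr => z _; rewrite /= !liftU coeffZ scalerA.
Qed.

HB.instance Definition _ (M : lmodType K) (T : choiceType) (f : T -> M) :=
  GRing.isScalable.Build K {freeg T / K} M *:%R (fglift f) (fglift_scalable f).

Lemma fgliftU1 (M : lmodType K) (T : choiceType) (f : T -> M) x :
  fglift f << x >> = f x.
Proof. by rewrite liftU scale1r. Qed.

Lemma freegUZ (T : choiceType) k (x : T) :
  << k *g x >> = k *: << x >> :> {freeg T / K}.
Proof. by apply/eqP/freeg_eqP => y; rewrite coeffZ !coeffU mul1r. Qed.

Lemma linear_eq_dom (T : choiceType) (M : lmodType K)
    (f g : {linear {freeg T / K} -> M}) c :
  (forall x, x \in dom c -> f << x >> = g << x >>) -> f c = g c.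
Proof.
move=> fg; rewrite -(freeg_sumE c) !linear_sum big_seq [RHS]big_seq.
by apply: eq_bigr => x xc; rewrite /= freegUZ !linearZ /= fg.
Qed.

Lemma linear_eq (T : choiceType) (M : lmodType K)
    (f g : {linear {freeg T / K} -> M}) :
  (forall x, f << x >> = g << x >>) -> f =1 g.
Proof. by move=> fg c; apply: linear_eq_dom => x _. Qed.

(** One predicate serves for chains in a subset, for linear simplices with vertices in a convex set,
    and for bounds on the mesh. *)
Definition supported (T : choiceType) (P : T -> Prop) (c : {freeg T / K}) :=
  forall x, x \in dom c -> P x.

Section Supported.
Variables (T : choiceType) (P : T -> Prop).

Lemma supported0 : supported P 0.
Proof. by move=> x; rewrite dom0. Qed.

Lemma supportedD c d : supported P c -> supported P d -> supported P (c + d).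
Proof.
by move=> Pc Pd x /domD_subset; rewrite mem_cat => /orP[/Pc|/Pd].
Qed.

Lemma supportedZ k c : supported P c -> supported P (k *: c).
Proof. by move=> Pc x /domZ_subset /Pc. Qed.

Lemma supportedN c : supported P c -> supported P (- c).
Proof. by move=> Pc x; rewrite domN => /Pc. Qed.

Lemma supportedB c d : supported P c -> supported P d -> supported P (c - d).
Proof. by move=> Pc Pd; apply: supportedD => //; exact: supportedN. Qed.

Lemma supported_sum (I : Type) (r : seq I) (Q : pred I) F :
  (forall i, Q i -> supported P (F i)) ->
  supported P (\sum_(i <- r | Q i) F i).
Proof.
move=> PF; elim: r => [|i r IH]; first by rewrite big_nil; exact: supported0.
by rewrite big_cons; case: ifP => // /PF; move=> /supportedD; apply.
Qed.

Lemma supportedU1 x : P x -> supported P << x >>.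
Proof. by move=> Px y; rewrite domU1 mem_seq1 => /eqP ->. Qed.

End Supported.

Lemma supported_lift (T T' : choiceType) (P : T -> Prop) (Q : T' -> Prop)
    (f : T -> {freeg T' / K}) c :
  (forall x, P x -> supported Q (f x)) ->
  supported P c -> supported Q (fglift f c).
Proof.
move=> PQ Pc; rewrite -(freeg_sumE c) linear_sum big_seq.
apply: supported_sum => x /Pc Px; rewrite /= liftU.
by apply: supportedZ; exact: PQ.
Qed.

Lemma supportedW (T : choiceType) (P Q : T -> Prop) (c : {freeg T / K}) :
  (forall x, P x -> Q x) -> supported P c -> supported Q c.
Proof. by move=> PQ Pc x /Pc /PQ. Qed.

Section Boundary.
Variables (T : nat -> choiceType) (d : forall n, 'I_n.+1 -> T n.+1 -> T n).

(** Stated for any family of simplices with face maps, so that linear and singular chains share the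
    proof that the boundary squares to 0. *)
Definition bd n (c : {freeg (T n.+1) / K}) : {freeg (T n) / K} :=
  fglift (fun x => \sum_(i < n.+1) (-1) ^+ i *: << d i x >>) c.

HB.instance Definition _ n := GRing.Linear.copy (@bd n)
  (fglift (fun x => \sum_(i < n.+1) (-1) ^+ i *: << d i x >> : {freeg (T n) / K})).

Lemma bdU n x : @bd n << x >> = \sum_(i < n.+1) (-1) ^+ i *: << d i x >>.
Proof. exact: fgliftU1. Qed.

Hypothesis dd : forall n (i : 'I_n.+1) (j : 'I_n.+2) (x : T n.+2), (j <= i)%N ->
  d i (d j x) = d (inord j) (d (lift ord0 i) x).

Lemma bd_bd n c : @bd n (@bd n.+1 c) = 0.
Proof.
apply: (@linear_eq _ _ (@bd n \o @bd n.+1) \0) => x /=.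
rewrite bdU linear_sum /=.
under eq_bigr => j _.
  rewrite linearZ /= bdU scaler_sumr.
  under eq_bigr do rewrite scalerA -exprD.
  over.
rewrite pair_big /= (bigID (fun p : 'I_n.+2 * 'I_n.+1 => (p.1 <= p.2)%N)) /=.
apply/eqP; rewrite addr_eq0; apply/eqP.
(* The pairs with [j <= i] are matched with the others by (j, i) -> (i + 1, j), which changes the
   sign. *)
rewrite (reindex_onto
  (fun p : 'I_n.+2 * 'I_n.+1 => (inord p.2, inord p.1.-1) : 'I_n.+2 * 'I_n.+1)
  (fun p => (lift ord0 p.2, inord p.1))) /=; last first.
  move=> [j i] /= ji; have jn : (j < n.+1)%N by rewrite (leq_ltn_trans ji).
  by congr pair; apply/val_inj; rewrite /= ?lift0 ?inordK // (ltn_ord i).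
have jpE (j : 'I_n.+2) : (inord j.-1 : 'I_n.+1) = j.-1 :> nat.
  by rewrite inordK //; case: j => -[|j].
have iE (i : 'I_n.+1) : (inord i : 'I_n.+2) = i :> nat.
  by rewrite inordK // ltnS ltnW.
rewrite -sumrN; apply: eq_big => [[j i]|[j i]] /=.
  rewrite jpE iE -ltnNge; apply/andP/idP => [[ij /eqP[ej _]]|ij].
    by have := congr1 val ej; rewrite /= /bump /= jpE add1n => <-.
  split; first by move: ij; case: (j : nat).
  apply/eqP; congr pair; apply/val_inj; rewrite /= /bump /= ?jpE.
    by rewrite add1n prednK //; apply: leq_trans ij.
  by rewrite inordK.
rewrite jpE iE => /andP[ij /eqP[ej ei]].
rewrite -scaleNr dd ?iE ?jpE // inord_val ej; congr (_ *: _).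
rewrite -[X in (- (-1) ^+ (nat_of_ord X + _))]ej /= /bump /= jpE.
by rewrite add1n addSn exprS mulN1r opprK addnC.
Qed.
End Boundary.
End FreeModule.

(** * Linear chains, subdivision and prisms *)

Section Faces.
Variable R : realType.

(* [Delta n] has [n] vertices: chains indexed by [n] have dimension [n - 1], the
   boundary to index 0 is the augmentation, and homology is reduced. *)
Definition Delta n : set 'rV[R]_n :=
  [set t | (forall i, 0 <= t 0 i) /\ \sum_i t 0 i = 1].

Definition comb (E : lmodType R) n (v : 'I_n -> E) (t : 'rV[R]_n) : E :=
  \sum_i t 0 i *: v i.

Definition vtx n (i : 'I_n) : 'rV[R]_n := delta_mx 0 i.

Lemma comb_vtx n : comb (@vtx n) =1 id.
Proof. by move=> t; rewrite [RHS]row_sum_delta. Qed.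

Lemma comb_linear (E E' : lmodType R) (L : {linear E -> E'}) n (v : 'I_n -> E) t :
  L (comb v t) = comb (L \o v) t.
Proof. by rewrite linear_sum; apply: eq_bigr => i _; rewrite linearZ. Qed.

Lemma comb_is_linear (E : lmodType R) n (v : 'I_n -> E) : linear (comb v).
Proof.
move=> a s t; rewrite /comb scaler_sumr -big_split; apply: eq_bigr => i _ /=.
by rewrite !mxE scalerDl scalerA.
Qed.

HB.instance Definition _ (E : lmodType R) n (v : 'I_n -> E) :=
  GRing.isLinear.Build R 'rV[R]_n E _ (comb v) (comb_is_linear v).

Lemma comb_at_vtx (E : lmodType R) n (v : 'I_n -> E) i : comb v (vtx i) = v i.
Proof.
rewrite /comb (bigD1 i) //= big1 ?addr0 => [|j ji]; rewrite mxE eqxx.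
  by rewrite eqxx scale1r.
by rewrite (negbTE ji) scale0r.
Qed.

Lemma comb_comb (E : lmodType R) m n (v : 'I_n -> E) (u : 'I_m -> 'rV[R]_n) t :
  comb v (comb u t) = comb (comb v \o u) t.
Proof. exact: comb_linear. Qed.

Definition fc n (i : 'I_n.+1) : 'rV[R]_n -> 'rV[R]_n.+1 :=
  comb (fun k => vtx (lift i k)).

HB.instance Definition _ n (i : 'I_n.+1) := GRing.Linear.copy (@fc n i)
  (comb (fun k => vtx (lift i k))).

Lemma comb_fc (E : lmodType R) n (i : 'I_n.+1) (v : 'I_n.+1 -> E) t :
  comb v (fc i t) = comb (v \o lift i) t.
Proof.
by rewrite comb_comb; congr (comb _ t); apply/funext => k /=; rewrite comb_at_vtx.
Qed.

Lemma fc_vtx n (i : 'I_n.+1) k : fc i (vtx k) = vtx (lift i k).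
Proof. exact: comb_at_vtx. Qed.

Lemma lift_lift n (i : 'I_n.+1) (j : 'I_n.+2) (k : 'I_n) : (j <= i)%N ->
  lift j (lift i k) = lift (lift ord0 i) (lift (inord j) k).
Proof.
move=> ji; apply/val_inj; rewrite /= /bump /= inordK; last exact: leq_ltn_trans (ltn_ord i).
case: (leqP i k) => ik; case: (leqP j k) => jk /=; rewrite ?add1n ?add0n.
- by rewrite (leq_trans jk) // !ltnS ik.
- by have := leq_trans ji ik; rewrite leqNgt jk.
- by rewrite ltnS leqNgt ik.
- by rewrite ltnNge (ltnW ik).
Qed.

Lemma fc_fc n (i : 'I_n.+1) (j : 'I_n.+2) t : (j <= i)%N ->
  fc j (fc i t) = fc (lift ord0 i) (fc (inord j) t).
Proof.
move=> ji; rewrite /fc !comb_comb; congr (comb _ t); apply/funext => k /=.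
by rewrite !comb_at_vtx lift_lift.
Qed.

Lemma vtx_Delta n (i : 'I_n) : Delta (vtx i).
Proof.
split=> [j|]; first by rewrite mxE ler0n.
rewrite (bigD1 i) //= big1 ?addr0 => [|j ji]; rewrite mxE eqxx ?eqxx //.
by rewrite (negbTE ji).
Qed.

Definition cvx (E : lmodType R) (C : set E) :=
  forall n (v : 'I_n -> E) t, Delta t -> (forall i, C (v i)) -> C (comb v t).

Lemma cvx_Delta n : cvx (@Delta n).
Proof.
move=> m v t [t0 t1] Cv; split=> [i|].
  by rewrite summxE sumr_ge0 // => j _; rewrite mxE mulr_ge0 //; case: (Cv j).
under eq_bigr do rewrite summxE.
rewrite exchange_big /= -[RHS]t1; apply: eq_bigr => j _.
under eq_bigr do rewrite mxE.
by rewrite -mulr_sumr; case: (Cv j) => _ ->; rewrite mulr1.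
Qed.

Lemma fc_Delta n (i : 'I_n.+1) t : Delta t -> Delta (fc i t).
Proof. by move=> Dt; apply: cvx_Delta => // k; exact: vtx_Delta. Qed.

End Faces.

Arguments Delta R n : clear implicits.
Arguments vtx R {n}.

Section Chains.
Variables (R : realType) (K : comNzRingType).

Definition LC (E : lmodType R) n := {freeg ('I_n -> E) / K}.

Definition facev (E : lmodType R) n (i : 'I_n.+1) (v : 'I_n.+1 -> E) : 'I_n -> E :=
  v \o lift i.

Definition bdL (E : lmodType R) n : LC E n.+1 -> LC E n :=
  @bd K (fun n => 'I_n -> E) (@facev E) n.

HB.instance Definition _ (E : lmodType R) n := GRing.Linear.copy (@bdL E n)
  (@bd K (fun n => 'I_n -> E) (@facev E) n).

Lemma bdLL (E : lmodType R) n (c : LC E n.+2) : bdL (bdL c) = 0.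
Proof.
apply: bd_bd => {c}n i j v ji; apply/funext => k /=.
by rewrite /facev /= lift_lift.
Qed.

Section LinearChains.
Variable E : lmodType R.

Definition ccons n (p : E) (v : 'I_n -> E) : 'I_n.+1 -> E :=
  fun i => oapp v p (unlift ord0 i).

Definition cone n (p : E) (c : LC E n) : LC E n.+1 :=
  fglift (fun v => << ccons p v >>) c.

HB.instance Definition _ n p := GRing.Linear.copy (@cone n p)
  (fglift (fun v => << ccons p v >> : LC E n.+1)).

Lemma coneU n p (v : 'I_n -> E) : cone p << v >> = << ccons p v >>.
Proof. exact: fgliftU1. Qed.

Lemma ccons0 n p (v : 'I_n -> E) : facev ord0 (ccons p v) = v.
Proof. by apply/funext => k; rewrite /facev /ccons /= liftK. Qed.

Lemma cconsS n p (v : 'I_n.+1 -> E) i :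
  facev (lift ord0 i) (ccons p v) = ccons p (facev i v).
Proof.
apply/funext => k; rewrite /facev /ccons /=.
case: (unliftP ord0 k) => [k' ->|->] /=.
  have -> : lift (lift ord0 i) (lift ord0 k') = lift ord0 (lift i k') :> 'I_n.+2.
    by apply/val_inj; rewrite /= /bump /= !add1n ltnS addnS.
  by rewrite liftK.
have -> : lift (lift ord0 i) ord0 = ord0 :> 'I_n.+2 by apply/val_inj.
by rewrite unlift_none.
Qed.

Lemma bd_cone0 p (c : LC E 0) : bdL (cone p c) = c.
Proof.
apply: (@linear_eq _ _ _ (@bdL E 0 \o cone p) idfun) => v /=.
by rewrite coneU /bdL bdU big_ord_recl big_ord0 addr0 expr0 scale1r ccons0.
Qed.

Lemma bd_cone n p (c : LC E n.+1) : bdL (cone p c) = c - cone p (bdL c).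
Proof.
apply: (@linear_eq _ _ _ (@bdL E n.+1 \o cone p) (idfun \- (cone p \o @bdL E n))).
move=> v /=; rewrite coneU /bdL !bdU big_ord_recl ccons0 expr0 scale1r.
congr (_ + _); rewrite linear_sum -sumrN; apply: eq_bigr => i _ /=.
by rewrite linearZ /= coneU cconsS /bump /= exprS mulN1r scaleNr.
Qed.

Definition bary n (v : 'I_n -> E) : E := n%:R^-1 *: \sum_i v i.

(** Barycentric subdivision. *)
Fixpoint sdv n : ('I_n -> E) -> LC E n :=
  match n with
  | 0 => fun v => << v >>
  | m.+1 => fun v => cone (bary v) (fglift (@sdv m) (bdL << v >>))
  end.

Definition sdL n (c : LC E n) : LC E n := fglift (@sdv n) c.

HB.instance Definition _ n := GRing.Linear.copy (@sdL n) (fglift (@sdv n)).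

Lemma sdLU n v : @sdL n << v >> = sdv v.
Proof. exact: fgliftU1. Qed.

Lemma bd_sdL n (c : LC E n.+1) : bdL (sdL c) = sdL (bdL c).
Proof.
apply: (@linear_eq _ _ _ (@bdL E n \o @sdL n.+1) (@sdL n \o @bdL E n)) => v /=.
rewrite sdLU; elim: n v {c} => [|n IH] v /=; first by rewrite bd_cone0.
rewrite bd_cone; set X := fglift _ _.
(* [X] subdivides a boundary, hence is closed by the induction hypothesis, and coning it adds no
   further term. *)
suff -> : bdL X = 0 by rewrite linear0 subr0.
have -> : X = sdL (bdL << v >>) by [].
transitivity (sdL (bdL (bdL << v >>))); last by rewrite bdLL linear0.
apply: (@linear_eq _ _ _ (@bdL E n \o @sdL n.+1) (@sdL n \o @bdL E n)) => u /=.
by rewrite sdLU IH.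
Qed.

End LinearChains.

Section Functor.
Variables E E' : lmodType R.

Definition pushL n (L : E -> E') (c : LC E n) : LC E' n :=
  fglift (fun v => << L \o v >>) c.

HB.instance Definition _ n L := GRing.Linear.copy (@pushL n L)
  (fglift (fun v => << L \o v >> : LC E' n)).

Lemma pushLU n L (v : 'I_n -> E) : pushL L << v >> = << L \o v >>.
Proof. exact: fgliftU1. Qed.

Lemma bd_pushL n L (c : LC E n.+1) : bdL (pushL L c) = pushL L (bdL c).
Proof.
apply: (@linear_eq _ _ _ (@bdL E' n \o pushL L) (pushL L \o @bdL E n)) => v /=.
rewrite pushLU /bdL !bdU linear_sum; apply: eq_bigr => i _ /=.
by rewrite linearZ /= pushLU.
Qed.

Lemma push_cone n L p (c : LC E n) : pushL L (cone p c) = cone (L p) (pushL L c).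
Proof.
apply: (@linear_eq _ _ _ (pushL L \o cone p) (cone (L p) \o pushL L)) => v /=.
rewrite coneU !pushLU coneU; congr << _ >>; apply/funext => i /=.
by rewrite /ccons /=; case: (unlift ord0 i).
Qed.

Lemma push_sdL (L : {linear E -> E'}) n (c : LC E n) :
  pushL L (sdL c) = sdL (pushL L c).
Proof.
apply: (@linear_eq _ _ _ (pushL L \o @sdL E n) (@sdL E' n \o pushL L)) => v /=.
rewrite pushLU !sdLU; elim: n v {c} => [|n IH] v; first exact: pushLU.
rewrite /= push_cone; congr cone.
  by rewrite /bary linearZ linear_sum.
rewrite -pushLU bd_pushL.
apply: (@linear_eq _ _ _ (pushL L \o fglift (@sdv E n))
  (fglift (@sdv E' n) \o pushL L)) => u /=.
by rewrite pushLU !fgliftU1 IH.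
Qed.

End Functor.

Lemma pushL_comp (E E' E'' : lmodType R) n (L : E -> E') (L' : E' -> E'')
  (c : LC E n) : pushL L' (pushL L c) = pushL (L' \o L) c.
Proof.
apply: (@linear_eq _ _ _ (pushL L' \o pushL L) (pushL (L' \o L))) => v /=.
by rewrite !pushLU.
Qed.

Section Prism.
Variable E : lmodType R.

Definition at_time (s : R) (x : E) : E * R^o := (x, s).

(* A chain homotopy from subdivision at time 0 to the identity at time 1. *)
Fixpoint prv n : ('I_n -> E) -> LC (E * R^o)%type n.+1 :=
  match n with
  | 0 => fun _ => 0
  | m.+1 => fun v => cone (at_time 0 (v ord0))
      (pushL (at_time 1) << v >> - pushL (at_time 0) (sdL << v >>) -
       fglift (@prv m) (bdL << v >>))
  end.

Definition prL n (c : LC E n) : LC (E * R^o)%type n.+1 := fglift (@prv n) c.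

HB.instance Definition _ n := GRing.Linear.copy (@prL n) (fglift (@prv n)).

Lemma prLU n v : @prL n << v >> = prv v.
Proof. exact: fgliftU1. Qed.

(** The chain that [prv] cones off is closed, by induction on the dimension, so it is the whole
    boundary of its cone. *)
Lemma bd_prv n (v : 'I_n.+1 -> E) : bdL (prv v) =
  pushL (at_time 1) << v >> - pushL (at_time 0) (sdL << v >>) - prL (bdL << v >>).
Proof.
(* The empty simplex has no time coordinate: both ends of the prism agree in index 0. *)
have z0 (c : LC E 0) : pushL (at_time 1) c = pushL (at_time 0) (sdL c).
  apply: (@linear_eq _ _ _ (pushL (at_time 1)) (pushL (at_time 0) \o @sdL E 0)).
  by move=> u /=; rewrite sdLU !pushLU; congr << _ >>; apply/funext => -[].
have p0 (c : LC E 0) : prL c = 0.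
  by apply: (@linear_eq _ _ _ (@prL 0) \0) => u /=; rewrite prLU.
elim: n v => [|n IH] v; rewrite [prv v]/= bd_cone -/(prL _).
  rewrite [X in cone _ X](_ : _ = 0) ?linear0 ?subr0 ?addr0 //.
  by rewrite p0 subr0 linearB /= !bd_pushL bd_sdL z0 subrr.
rewrite [X in cone _ X](_ : _ = 0) ?linear0 ?subr0 ?addr0 //.
rewrite !linearB /= !bd_pushL bd_sdL.
have -> : bdL (prL (bdL << v >>)) = pushL (at_time 1) (bdL << v >>)
    - pushL (at_time 0) (sdL (bdL << v >>)) - prL (bdL (bdL << v >>)).
  apply: (@linear_eq _ _ _ (@bdL _ n.+1 \o @prL n.+1)
    ((pushL (at_time 1) \- (pushL (at_time 0) \o @sdL E n.+1))
       \- (@prL n \o @bdL E n))) => u /=.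
  by rewrite prLU IH.
by rewrite bdLL linear0 subr0 subrr.
Qed.

End Prism.

(** Naturality, needed for the face inclusions: it makes the prism on singular chains compatible
    with the boundary. *)
Lemma push_prL (E E' : lmodType R) (L : {linear E -> E'}) n (c : LC E n) :
  pushL (fun p : E * R^o => (L p.1, p.2) : E' * R^o) (prL c) = prL (pushL L c).
Proof.
set LL := fun p => _.
apply: (@linear_eq _ _ _ (pushL LL \o @prL E n) (@prL E' n \o pushL L)) => v /=.
rewrite pushLU !prLU; elim: n v {c} => [|n IH] v; first by rewrite /= linear0.
have LLE m s (d : LC E m) :
    pushL LL (pushL (at_time s) d) = pushL (at_time s) (pushL L d).
  by rewrite !pushL_comp.
rewrite /= push_cone; congr cone.
rewrite !linearB /= !LLE push_sdL pushLU; congr (_ - _).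
rewrite -pushLU bd_pushL.
apply: (@linear_eq _ _ _ (pushL LL \o @prL E n) (@prL E' n \o pushL L)) => u /=.
by rewrite pushLU !prLU IH.
Qed.

End Chains.

(** * Singular chains *)

Section Singular.
Variables (R : realType) (K : comNzRingType).

Lemma comb_continuous (X : normedModType R) n (v : 'I_n -> X) :
  continuous (comb v).
Proof.
suff H (r : seq 'I_n) : continuous (fun t : 'rV[R]_n => \sum_(i <- r) t 0 i *: v i).
  exact: H.
elim: r => [|i r IH] t.
  rewrite (_ : (fun _ => _) = (fun=> 0)); last by apply/funext => u; rewrite big_nil.
  exact: cst_continuous.
rewrite (_ : (fun _ => _) = (fun u : 'rV[R]_n => u 0 i *: v i + \sum_(j <- r) u 0 j *: v j)).
  apply: (@continuousD _ _ _ (fun u : 'rV[R]_n => u 0 i *: v i)); last exact: IH.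
  have cc : {for t, continuous (fun u : 'rV[R]_n => u 0 i)}.
    exact: coord_continuous.
  exact: (@cvgZr_tmp R X _ _ _ (fun u : 'rV[R]_n => u 0 i) _ (v i) cc).
by apply/funext => u; rewrite big_cons.
Qed.

Section Space.
Variable X : normedModType R.

(* Simplices are total functions, normalised to 0 off [Delta n], so that equality
   of simplices is Leibniz equality. *)
Definition restr n (g : 'rV[R]_n -> X) : 'rV[R]_n -> X :=
  fun t => if t \in Delta R n then g t else 0.

Lemma restr_in n (g : 'rV[R]_n -> X) t : Delta R n t -> restr g t = g t.
Proof. by move=> Dt; rewrite /restr mem_set. Qed.

Lemma eq_restr n (g h : 'rV[R]_n -> X) :
  (forall t, Delta R n t -> g t = h t) -> restr g = restr h.
Proof.
move=> gh; apply/funext => t; rewrite /restr; case: ifPn => // /set_mem.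
exact: gh.
Qed.

Lemma restrK n (g : 'rV[R]_n -> X) : restr (restr g) = restr g.
Proof. by apply: eq_restr => t /restr_in. Qed.

Definition SC n := {freeg ('rV[R]_n -> X) / K}.

Definition faceS n (i : 'I_n.+1) (g : 'rV[R]_n.+1 -> X) : 'rV[R]_n -> X :=
  restr (g \o fc i).

Lemma faceSE n (i : 'I_n.+1) (g : 'rV[R]_n.+1 -> X) t :
  Delta R n t -> faceS i g t = g (fc i t).
Proof. exact: restr_in. Qed.

Definition bdS n : SC n.+1 -> SC n :=
  @bd K (fun n => 'rV[R]_n -> X) faceS n.

HB.instance Definition _ n := GRing.Linear.copy (@bdS n)
  (@bd K (fun n => 'rV[R]_n -> X) faceS n).

Lemma bdSU n g : @bdS n << g >> = \sum_(i < n.+1) (-1) ^+ i *: << faceS i g >>.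
Proof. exact: bdU. Qed.

Lemma bdSS n (c : SC n.+2) : bdS (bdS c) = 0.
Proof.
apply: bd_bd => {c}n i j g ji; apply: eq_restr => t Dt /=.
by rewrite !faceSE; [rewrite (fc_fc _ ji)|exact: fc_Delta..].
Qed.

Definition aff n (v : 'I_n -> X) : 'rV[R]_n -> X := restr (comb v).

Definition real n (c : LC K X n) : SC n := fglift (fun v => << aff v >>) c.

HB.instance Definition _ n := GRing.Linear.copy (@real n)
  (fglift (fun v => << aff v >> : SC n)).

Lemma realU n (v : 'I_n -> X) : real << v >> = << aff v >>.
Proof. exact: fgliftU1. Qed.

Lemma bd_real n (c : LC K X n.+1) : bdS (real c) = real (bdL c).
Proof.
apply: (@linear_eq _ _ _ (@bdS n \o @real n.+1) (@real n \o @bdL R K X n)) => v /=.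
rewrite realU bdSU [bdL _]bdU linear_sum; apply: eq_bigr => i _ /=.
rewrite linearZ /= realU; congr (_ *: << _ >>); apply: eq_restr => t Dt /=.
by rewrite /aff restr_in ?comb_fc //; exact: fc_Delta.
Qed.

End Space.

Definition push (X Y : normedModType R) n (F : X -> Y) (c : SC X n) : SC Y n :=
  fglift (fun g => << restr (F \o g) >>) c.

HB.instance Definition _ (X Y : normedModType R) n F :=
  GRing.Linear.copy (@push X Y n F) (fglift (fun g => << restr (F \o g) >> : SC Y n)).

Lemma pushU (X Y : normedModType R) n (F : X -> Y) (g : 'rV[R]_n -> X) :
  push F << g >> = << restr (F \o g) >>.
Proof. exact: fgliftU1. Qed.

Lemma bd_push (X Y : normedModType R) n (F : X -> Y) (c : SC X n.+1) :
  bdS (push F c) = push F (bdS c).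
Proof.
apply: (@linear_eq _ _ _ (@bdS Y n \o push F) (push F \o @bdS X n)) => g /=.
rewrite pushU !bdSU linear_sum; apply: eq_bigr => i _ /=.
rewrite linearZ /= pushU; congr (_ *: << _ >>); apply: eq_restr => t Dt /=.
by rewrite faceSE // !restr_in //; exact: fc_Delta.
Qed.

Lemma push_comp (X Y Z : normedModType R) n (F : X -> Y) (G : Y -> Z)
  (c : SC X n) : push G (push F c) = push (G \o F) c.
Proof.
apply: (@linear_eq _ _ _ (push G \o push F) (push (G \o F))) => g /=.
by rewrite !pushU; congr << _ >>; apply: eq_restr => t Dt /=; rewrite restr_in.
Qed.

(** Continuity of the restriction to [A], phrased for total functions, so that maps between subsets
    of normed modules compose without subtypes. *)
Definition cont_on (X Y : normedModType R) (A : set X) (F : X -> Y) :=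
  forall x, A x -> forall U : set Y, nbhs (F x) U ->
    nbhs x [set y | A y -> U (F y)].

Lemma continuous_cont_on (X Y : normedModType R) (A : set X) (F : X -> Y) :
  (forall x, A x -> {for x, continuous F}) -> cont_on A F.
Proof.
move=> cF x /cF Fx U /Fx UF; apply: (@filterS _ (nbhs x) _ _ _ _ UF).
by move=> y Uy _; exact: Uy.
Qed.

Lemma cont_on_comp (X Y Z : normedModType R) (A : set X) (B : set Y)
    (F : X -> Y) (G : Y -> Z) :
  cont_on A F -> cont_on B G -> (forall x, A x -> B (F x)) ->
  cont_on A (G \o F).
Proof.
move=> cF cG AB x Ax U /(cG _ (AB _ Ax)) /(cF _ Ax).
by apply: filterS => y /= UA Ay; apply: UA => //; exact: AB.
Qed.

Lemma eq_cont_on (X Y : normedModType R) (A : set X) (F G : X -> Y) :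
  (forall x, A x -> F x = G x) -> cont_on A F -> cont_on A G.
Proof.
move=> FG cF x Ax U; rewrite -FG // => /(cF _ Ax).
by apply: filterS => y /= Uy Ay; rewrite -FG //; exact: Uy.
Qed.

Definition simplex_in (X : normedModType R) (A : set X) n (g : 'rV[R]_n -> X) :=
  [/\ restr g = g, cont_on (Delta R n) g & forall t, Delta R n t -> A (g t)].

Definition cin (X : normedModType R) (A : set X) n (c : SC X n) :=
  supported (simplex_in A (n := n)) c.

Lemma cinS (X : normedModType R) (A B : set X) n (c : SC X n) :
  A `<=` B -> cin A c -> cin B c.
Proof.
by move=> AB; apply: supportedW => g [rg cg Ag]; split=> // t /Ag /AB.
Qed.

Lemma cin_bd (X : normedModType R) (A : set X) n (c : SC X n.+1) :
  cin A c -> cin A (bdS c).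
Proof.
apply: supported_lift => g [rg cg Ag].
apply: supported_sum => i _; apply: supportedZ; apply: supportedU1.
split; first exact: restrK.
- apply: (@eq_cont_on _ _ _ (g \o fc i)) => [t Dt|]; first by rewrite /faceS restr_in.
  apply: (cont_on_comp _ cg) => [|t]; last exact: fc_Delta.
  by apply: continuous_cont_on => t _; exact: comb_continuous.
- by move=> t Dt; rewrite /faceS restr_in //; apply/Ag/fc_Delta.
Qed.

Lemma cin_push (X Y : normedModType R) (A : set X) (B : set Y) (F : X -> Y) n
    (c : SC X n) :
  cont_on A F -> (forall x, A x -> B (F x)) -> cin A c -> cin B (push F c).
Proof.
move=> cF AB; apply: supported_lift => g [rg cg Ag]; apply: supportedU1.
split; first exact: restrK.
- apply: (@eq_cont_on _ _ _ (F \o g)) => [t Dt|]; first by rewrite restr_in.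
  exact: (cont_on_comp cg cF).
- by move=> t Dt; rewrite restr_in //; apply/AB/Ag.
Qed.

Lemma eq_push (X Y : normedModType R) (A : set X) (F G : X -> Y) n (c : SC X n) :
  (forall x, A x -> F x = G x) -> cin A c -> push F c = push G c.
Proof.
move=> FG Ac; apply: linear_eq_dom => g /Ac[_ _ Ag] /=.
by rewrite !pushU; congr << _ >>; apply: eq_restr => t Dt /=; rewrite FG //; exact: Ag.
Qed.

Lemma push_id (X : normedModType R) (A : set X) (F : X -> X) n (c : SC X n) :
  (forall x, A x -> F x = x) -> cin A c -> push F c = c.
Proof.
move=> FG Ac; apply: (@linear_eq_dom _ _ _ (push F) idfun) => g /Ac[rg _ Ag] /=.
rewrite pushU -[in RHS]rg; congr << _ >>; apply: eq_restr => t Dt /=.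
by rewrite FG //; exact: Ag.
Qed.

End Singular.

(** * Linear chains in convex sets *)

Section Supports.
Variables (R : realType) (K : comNzRingType).

Definition lin (E : lmodType R) (C : set E) n (c : LC K E n) :=
  supported (fun v : 'I_n -> E => forall i, C (v i)) c.

Section Lin.
Variables (E : lmodType R) (C : set E).

Lemma lin_bd n (c : LC K E n.+1) : lin C c -> lin C (bdL c).
Proof.
apply: supported_lift => v Cv; apply: supported_sum => i _.
by apply: supportedZ; apply: supportedU1 => j; exact: Cv.
Qed.

Lemma lin_cone n p (c : LC K E n) : C p -> lin C c -> lin C (cone p c).
Proof.
move=> Cp; apply: supported_lift => v Cv; apply: supportedU1 => i.
by rewrite /ccons; case: unlift.
Qed.

Lemma lin_push (E' : lmodType R) (C' : set E') (L : E -> E') n (c : LC K E n) :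
  (forall x, C x -> C' (L x)) -> lin C c -> lin C' (pushL L c).
Proof.
by move=> CC; apply: supported_lift => v Cv; apply: supportedU1 => i; exact/CC.
Qed.

Hypothesis cvxC : cvx C.

Lemma bary_in n (v : 'I_n.+1 -> E) : (forall i, C (v i)) -> C (bary v).
Proof.
move=> Cv; have -> : bary v = comb v (\row__ n.+1%:R^-1).
  by rewrite /bary scaler_sumr; apply: eq_bigr => i _; rewrite mxE.
apply: cvxC => //; split=> [i|]; first by rewrite mxE invr_ge0 ler0n.
under eq_bigr do rewrite mxE.
by rewrite sumr_const card_ord -[LHS]mulr_natl divff // pnatr_eq0.
Qed.

Lemma lin_sdL n (c : LC K E n) : lin C c -> lin C (sdL c).
Proof.
apply: supported_lift; elim: n {c} => [|n IH] v Cv; first exact: supportedU1.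
apply: lin_cone; first exact: bary_in.
by apply: supported_lift IH _; apply: lin_bd; exact: supportedU1.
Qed.

End Lin.

Definition cylinder (E : lmodType R) (A : set E) : set (E * R^o)%type :=
  [set p | A p.1 /\ 0 <= p.2 <= 1].

Lemma lin_prL (E : lmodType R) (C : set E) n (c : LC K E n) : cvx C -> lin C c -> lin (cylinder C) (prL c).
Proof.
move=> cvxC.
have at0 x : C x -> cylinder C (at_time 0 x) by split; rewrite //= lexx ler01.
have at1 x : C x -> cylinder C (at_time 1 x) by split; rewrite //= lexx ler01.
apply: supported_lift; elim: n {c} => [|n IH] v Cv; first exact: supported0.
have vC : lin C (<< v >> : LC K E n.+1) by exact: supportedU1.
apply: lin_cone; first exact: at0.
apply: supportedB; last by apply: supported_lift IH _; exact: lin_bd.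
by apply: supportedB; apply: lin_push (vC) || apply: lin_push (lin_sdL cvxC vC).
Qed.

Lemma comb_pair (E E' : lmodType R) n (v : 'I_n -> (E * E')%type) t :
  comb v t = (comb (fst \o v) t, comb (snd \o v) t).
Proof.
by rewrite [LHS]surjective_pairing (comb_linear fst) (comb_linear snd).
Qed.

Lemma cvx_cylinder (E : lmodType R) (C : set E) : cvx C -> cvx (cylinder C).
Proof.
move=> cvxC n v t Dt Cv.
rewrite comb_pair.
split; first by apply: cvxC => // i; case: (Cv i).
have [t0 t1] := Dt; apply/andP; split.
  by apply: sumr_ge0 => i _; rewrite mulr_ge0 //; case: (Cv i) => _ /andP[].
rewrite -t1; apply: ler_sum => i _; rewrite ler_piMr //.
by case: (Cv i) => _ /andP[].
Qed.

Lemma cin_real (X : normedModType R) (C : set X) n (c : LC K X n) :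
  cvx C -> lin C c -> cin C (real c).
Proof.
move=> cvxC; apply: supported_lift => v Cv; apply: supportedU1; split.
- exact: restrK.
- apply: (@eq_cont_on _ _ _ _ (comb v)) => [t Dt|]; first by rewrite /aff restr_in.
  by apply: continuous_cont_on => t _; exact: comb_continuous.
- by move=> t Dt; rewrite /aff restr_in //; exact: cvxC.
Qed.

(** The hypothesis asks for affinity on simplices rather than linearity because [at_time s] is
    affine only. *)
Lemma push_real (X Y : normedModType R) (L : X -> Y) n (c : LC K X n) :
  (forall (v : 'I_n -> X) t, Delta R n t -> L (comb v t) = comb (L \o v) t) ->
  push L (real c) = real (pushL L c).
Proof.
move=> LE; apply: (@linear_eq _ _ _ (push L \o @real R K X n)
  (@real R K Y n \o pushL L)) => v /=.
rewrite realU pushU pushLU realU; congr << _ >>; apply: eq_restr => t Dt /=.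
by rewrite /aff restr_in // LE.
Qed.

End Supports.

(** * Subdivision and prisms of singular chains *)

Section Operators.
Variables (R : realType) (K : comNzRingType).

Section Subdivision.
Variable X : normedModType R.

(** Subdivision is computed once, on the standard simplex, and carried along each singular simplex;
    the prism [prU] is handled in the same way. *)
Definition sdU n : SC K 'rV[R]_n n := real (sdv K (@vtx R n)).

Definition sd n (c : SC K X n) : SC K X n := fglift (fun g => push g (sdU n)) c.

HB.instance Definition _ n := GRing.Linear.copy (@sd n)
  (fglift (fun g => push g (sdU n))).

Lemma sdE n (g : 'rV[R]_n -> X) : sd << g >> = push g (sdU n).
Proof. exact: fgliftU1. Qed.

Lemma cin_vtx n (c : LC K 'rV[R]_n n) : lin (Delta R n) c -> cin (Delta R n) (real c).
Proof. by apply: cin_real; exact: cvx_Delta. Qed.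

Lemma lin_vtx n : lin (Delta R n) (<< @vtx R n >> : LC K 'rV[R]_n n).
Proof. by apply: supportedU1 => i; exact: vtx_Delta. Qed.

Lemma cin_sdU n : cin (Delta R n) (sdU n).
Proof.
apply: cin_vtx; rewrite -sdLU; apply: lin_sdL; first exact: cvx_Delta.
exact: lin_vtx.
Qed.

Lemma bd_vtx n : bdL << @vtx R n.+1 >> =
  \sum_(i < n.+1) (-1) ^+ i *: pushL (fc i) << @vtx R n >> :> LC K 'rV[R]_n.+1 n.
Proof.
rewrite [bdL _]bdU; apply: eq_bigr => i _; rewrite pushLU.
by congr (_ *: << _ >>); apply/funext => k /=; rewrite fc_vtx.
Qed.

Lemma push_face n (i : 'I_n.+1) (g : 'rV[R]_n.+1 -> X) m (c : SC K 'rV[R]_n m) :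
  cin (Delta R n) c -> push g (push (fc i) c) = push (faceS i g) c.
Proof.
by move=> Dc; rewrite push_comp; apply: eq_push Dc => t Dt; rewrite faceSE.
Qed.

Lemma bd_sd n (c : SC K X n.+1) : bdS (sd c) = sd (bdS c).
Proof.
apply: (@linear_eq _ _ _ (@bdS R K X n \o @sd n.+1) (@sd n \o @bdS R K X n)) => g /=.
rewrite sdE bd_push bd_real -sdLU bd_sdL bd_vtx bdSU !linear_sum.
apply: eq_bigr => i _; rewrite !linearZ /= sdE; congr (_ *: _).
rewrite -push_sdL sdLU -push_real; last by move=> v t _; exact: comb_linear.
exact/push_face/cin_sdU.
Qed.

Lemma cin_sd (A : set X) n (c : SC K X n) : cin A c -> cin A (sd c).
Proof.
apply: supported_lift => g [rg cg Ag].
exact: (cin_push cg Ag (@cin_sdU n)).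
Qed.

End Subdivision.

Section Homotopy.

Definition prU n : SC K ('rV[R]_n * R^o)%type n.+1 := real (prv K (@vtx R n)).

Variables X Y : normedModType R.

Definition track n (F : (X * R^o)%type -> Y) (g : 'rV[R]_n -> X)
    (p : ('rV[R]_n * R^o)%type) : Y := F (g p.1, p.2).

Definition pr (F : (X * R^o)%type -> Y) n (c : SC K X n) : SC K Y n.+1 :=
  fglift (fun g => push (track F g) (prU n)) c.

HB.instance Definition _ F n := GRing.Linear.copy (@pr F n)
  (fglift (fun g => push (track F g) (prU n))).

Lemma prE F n (g : 'rV[R]_n -> X) : pr F << g >> = push (track F g) (prU n).
Proof. exact: fgliftU1. Qed.

Lemma cin_prU n : cin (cylinder (Delta R n)) (prU n).
Proof.
apply: cin_real; first exact/cvx_cylinder/cvx_Delta.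
rewrite -prLU; apply: lin_prL; first exact: cvx_Delta.
exact: lin_vtx.
Qed.

Lemma at_time_comb n m (v : 'I_m -> 'rV[R]_n) (s : R) t : Delta R m t ->
  at_time s (comb v t) = comb (at_time s \o v) t.
Proof.
move=> [_ t1]; rewrite comb_pair /at_time; congr pair.
by rewrite /comb -scaler_suml t1 scale1r.
Qed.

Lemma cin_pr (A : set X) (B : set Y) F n (c : SC K X n) :
  cont_on (cylinder A) F -> (forall p, cylinder A p -> B (F p)) ->
  cin A c -> cin B (pr F c).
Proof.
move=> cF AB; apply: supported_lift => g [rg cg Ag].
apply: (cin_push _ _ (@cin_prU n)).
- apply: (cont_on_comp _ cF) => [|[t s] [/= Dt s01]]; last by split=> //=; exact: Ag.
  move=> [t s] [/= Dt s01] U [[U1 U2] [/= U1g U2s] UU].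
  exists ([set y | Delta R n y -> U1 (g y)], U2) => /=.
    by split=> //; exact: cg.
  by move=> [y r] [/= y1 y2] [/= Dy _]; apply: UU; split=> //; exact: y1.
- by move=> [t s] [/= Dt s01]; apply: AB; split=> //=; exact: Ag.
Qed.

Lemma bd_pr F n (c : SC K X n.+1) : bdS (pr F c) =
  push (fun x => F (x, 1)) c - push (fun x => F (x, 0)) (sd c) - pr F (bdS c).
Proof.
apply: (@linear_eq _ _ _ (@bdS R K Y n.+1 \o @pr F n.+1)
 ((push (fun x => F (x, 1)) \- (push (fun x => F (x, 0)) \o @sd X n.+1))
   \- (@pr F n \o @bdS R K X n))) => g /=.
rewrite prE bd_push bd_real bd_prv sdE !linearB /=; congr (_ - _ - _).
- rewrite -push_real; last by move=> *; exact: at_time_comb.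
  rewrite push_comp realU !pushU; congr << _ >>; apply: eq_restr => t Dt /=.
  by rewrite /aff restr_in // comb_vtx.
- rewrite -push_real; last by move=> *; exact: at_time_comb.
  by rewrite !push_comp sdLU.
rewrite bd_vtx bdSU !linear_sum; apply: eq_bigr => i _; rewrite !linearZ /= prE.
congr (_ *: _); rewrite -push_prL prLU -push_real; last first.
  by move=> v t _; rewrite !comb_pair /= comb_linear.
rewrite push_comp; apply: eq_push (@cin_prU n) => -[t s] [/= Dt _].
by rewrite /track /= faceSE.
Qed.

End Homotopy.
End Operators.

Section ContOn.
Variable R : realType.
Implicit Types X Y Z : normedModType R.

Lemma cont_on_pair X Y Z (A : set X) (F : X -> Y) (G : X -> Z) :
  cont_on A F -> cont_on A G -> cont_on A (fun x => (F x, G x)).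
Proof.
move=> cF cG x Ax U [[U1 U2] /= [U1F U2G] UU].
apply: filterS2 (cF x Ax _ U1F) (cG x Ax _ U2G) => y /= y1 y2 Ay.
by apply: UU; split; [exact: y1|exact: y2].
Qed.

Lemma cont_on_continuous X Y (A : set X) (F : X -> Y) : continuous F -> cont_on A F.
Proof. by move=> cF; apply: continuous_cont_on => x _; exact: cF. Qed.

Lemma cont_on_cst X Y (A : set X) (y : Y) : cont_on A (fun=> y).
Proof. by apply: cont_on_continuous; exact: cst_continuous. Qed.

Lemma cont_on_id X (A : set X) : cont_on A id.
Proof. by apply: cont_on_continuous => x. Qed.

Lemma cont_on_fst X Y (A : set (X * Y)%type) : cont_on A fst.
Proof. by apply: cont_on_continuous => x; exact: cvg_fst. Qed.

Lemma cont_on_snd X Y (A : set (X * Y)%type) : cont_on A snd.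
Proof. by apply: cont_on_continuous => x; exact: cvg_snd. Qed.

Lemma cont_on_compT X Y Z (A : set X) (F : X -> Y) (G : Y -> Z) :
  continuous G -> cont_on A F -> cont_on A (fun x => G (F x)).
Proof. by move=> cG cF; apply: (cont_on_comp cF (cont_on_continuous (A := setT) cG)). Qed.

Lemma cont_onD X Y (A : set X) (F G : X -> Y) :
  cont_on A F -> cont_on A G -> cont_on A (fun x => F x + G x).
Proof.
move=> cF cG.
exact: (cont_on_compT (G := fun p : Y * Y => p.1 + p.2) (@add_continuous Y)
  (cont_on_pair cF cG)).
Qed.

Lemma cont_onZ X Y (A : set X) (f : X -> R^o) (G : X -> Y) :
  cont_on A f -> cont_on A G -> cont_on A (fun x => (f x : R) *: G x).
Proof.
move=> cF cG.
exact: (cont_on_compT (G := fun p : R^o * Y => (p.1 : R) *: p.2)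
  (@scale_continuous _ Y) (cont_on_pair cF cG)).
Qed.

Lemma cont_onN X Y (A : set X) (F : X -> Y) :
  cont_on A F -> cont_on A (fun x => - F x).
Proof. by move=> cF; exact: (cont_on_compT (@opp_continuous Y) cF). Qed.

Lemma cont_onB X Y (A : set X) (F G : X -> Y) :
  cont_on A F -> cont_on A G -> cont_on A (fun x => F x - G x).
Proof. by move=> cF cG; apply: cont_onD => //; exact: cont_onN. Qed.

End ContOn.

(** * Homotopies and boundaries *)

Section Hom.
Variables (R : realType) (K : comNzRingType).

Lemma push_pr (X Y Z : normedModType R) (F : (X * R^o)%type -> Y) (G : Y -> Z) n
  (c : SC K X n) : push G (pr F c) = pr (G \o F) c.
Proof.
apply: (@linear_eq _ _ _ (push G \o pr F (n := n)) (pr (G \o F) (n := n))) => g /=.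
by rewrite !prE push_comp.
Qed.

Lemma pr_push (X Y Z : normedModType R) (F : (Y * R^o)%type -> Z) (G : X -> Y) n
  (c : SC K X n) : pr F (push G c) = pr (fun p => F (G p.1, p.2)) c.
Proof.
apply: (@linear_eq _ _ _ (pr F (n := n) \o push G) (pr (fun p => F (G p.1, p.2)) (n := n))) => g /=.
rewrite pushU !prE; apply: eq_push (@cin_prU R K n) => -[t s] [/= Dt s01].
by rewrite /track /= restr_in.
Qed.

(* The bottom of the prism is subdivided; the prism over the constant homotopy
   cancels the subdivision. *)
Definition hom (X Y : normedModType R) (F : (X * R^o)%type -> Y) n (c : SC K X n) :
  SC K Y n.+1 := pr F c - pr (fun p => F (p.1, 0)) c.

Lemma bd_hom (X Y : normedModType R) (F : (X * R^o)%type -> Y) n (c : SC K X n.+1) :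
  bdS (hom F c) = push (fun x => F (x, 1)) c - push (fun x => F (x, 0)) c - hom F (bdS c).
Proof.
have zE (V : zmodType) (a b s p q : V) : a - s - p - (b - s - q) = a - b - (p - q).
  by rewrite opprB [q - _]addrC addrACA opprB [in X in X + _]addrA subrK [- p + q]addrC opprB.
by rewrite /hom linearB /= !bd_pr /= zE.
Qed.

Lemma cin_hom (X Y : normedModType R) (A : set X) (B : set Y) F n (c : SC K X n) :
  cont_on (cylinder A) F -> (forall p, cylinder A p -> B (F p)) ->
  cin A c -> cin B (hom F c).
Proof.
move=> cF AB Ac; apply: supportedB; first exact: (cin_pr cF AB Ac).
have C0 p : cylinder A p -> cylinder A (p.1, 0).
  by move=> [? _]; split; rewrite //= lexx ler01.
have cC : cont_on (cylinder A) (fun p : (X * R^o)%type => (p.1, 0) : (X * R^o)%type).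
  by apply: cont_on_pair; [exact: cont_on_fst|exact: cont_on_cst].
apply: (cin_pr _ _ Ac) => [|p /C0 /AB //].
exact: (cont_on_comp cC cF C0).
Qed.

Lemma push_hom (X Y Z : normedModType R) (F : (X * R^o)%type -> Y) (G : Y -> Z) n
  (c : SC K X n) : push G (hom F c) = hom (G \o F) c.
Proof. by rewrite /hom linearB /= !push_pr. Qed.

Lemma hom_push (X Y Z : normedModType R) (F : (Y * R^o)%type -> Z) (G : X -> Y) n
  (c : SC K X n) : hom F (push G c) = hom (fun p => F (G p.1, p.2)) c.
Proof. by rewrite /hom !pr_push. Qed.

Lemma hom0 (X Y : normedModType R) (F : (X * R^o)%type -> Y) n : hom F (0 : SC K X n) = 0.
Proof. by rewrite /hom !linear0 addr0. Qed.

Definition bounds (X : normedModType R) (A : set X) n (c : SC K X n) :=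
  exists2 w, cin A w & bdS w = c.

Section Bounds.
Variables (X : normedModType R) (A : set X).

Lemma bounds0 n : bounds A (0 : SC K X n).
Proof. by exists 0; [exact: supported0|rewrite linear0]. Qed.

Lemma boundsD n (c d : SC K X n) : bounds A c -> bounds A d -> bounds A (c + d).
Proof.
by move=> [w Aw <-] [v Av <-]; exists (w + v); [exact: supportedD|rewrite linearD].
Qed.

Lemma boundsZ n k (c : SC K X n) : bounds A c -> bounds A (k *: c).
Proof.
by move=> [w Aw <-]; exists (k *: w); [exact: supportedZ|rewrite linearZ].
Qed.

Lemma boundsN n (c : SC K X n) : bounds A c -> bounds A (- c).
Proof. by rewrite -scaleN1r; exact: boundsZ. Qed.

Lemma boundsB n (c d : SC K X n) : bounds A c -> bounds A d -> bounds A (c - d).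
Proof. by move=> Ac Ad; apply: boundsD => //; exact: boundsN. Qed.

Lemma boundsS (B : set X) n (c : SC K X n) : A `<=` B -> bounds A c -> bounds B c.
Proof. by move=> AB [w Aw <-]; exists w => //; exact: cinS AB Aw. Qed.

Lemma bounds_push (Y : normedModType R) (B : set Y) (F : X -> Y) n (c : SC K X n) :
  cont_on A F -> (forall x, A x -> B (F x)) -> bounds A c -> bounds B (push F c).
Proof.
move=> cF AB [w Aw <-]; exists (push F w); last exact: bd_push.
exact: cin_push cF AB Aw.
Qed.

Lemma bounds_hom (Y : normedModType R) (B : set Y) (F : (X * R^o)%type -> Y) n
    (c : SC K X n.+1) :
  cont_on (cylinder A) F -> (forall p, cylinder A p -> B (F p)) ->
  cin A c -> bdS c = 0 ->
  bounds B (push (fun x => F (x, 1)) c - push (fun x => F (x, 0)) c).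
Proof.
move=> cF AB Ac c0; exists (hom F c); first exact: cin_hom cF AB Ac.
by rewrite bd_hom c0 hom0 subr0.
Qed.

(** The prism over the constant homotopy has [c] on top and its subdivision at the bottom. *)
Lemma bounds_sd n (c : SC K X n.+1) : cin A c -> bdS c = 0 -> bounds A (c - sd c).
Proof.
move=> Ac c0; exists (pr fst c).
  apply: (cin_pr _ _ Ac) => [|p [] //].
  exact: cont_on_fst.
by rewrite bd_pr c0 linear0 subr0 !(push_id (A := A)) //; exact: cin_sd.
Qed.

Lemma bounds_iter_sd j n (c : SC K X n.+1) : cin A c -> bdS c = 0 ->
  [/\ cin A (iter j (@sd R K X n.+1) c), bdS (iter j (@sd R K X n.+1) c) = 0 &
   bounds A (c - iter j (@sd R K X n.+1) c)].
Proof.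
move=> Ac c0; elim: j => [|j [IH1 IH2 IH3]]; first by rewrite subrr; split=> //; exact: bounds0.
split; first by rewrite iterS; exact: cin_sd.
  by rewrite iterS bd_sd IH2 linear0.
rewrite (_ : c - _ = (c - iter j (@sd R K X n.+1) c) +
  (iter j (@sd R K X n.+1) c - iter j.+1 (@sd R K X n.+1) c)); last by rewrite addrA subrK.
by apply: boundsD => //; exact: bounds_sd.
Qed.

Lemma push_cst (p : X) n (c : SC K X n) : exists a : K,
  push (fun=> p) c = a *: << restr (fun=> p) >>.
Proof.
(* The coefficient is the augmentation of [c], the sum of its coefficients. *)
exists (fglift (fun=> 1 : K^o) c); rewrite /push -(freeg_sumE c) !linear_sum scaler_suml.
apply: eq_bigr => g _ /=.
by rewrite !liftU; congr (_ *: _); exact: (esym (mulr1 _)).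
Qed.

Lemma simplex_cst (p : X) n : A p -> cin A (<< restr (fun=> p) >> : SC K X n).
Proof.
move=> Ap; apply: supportedU1; split; first exact: restrK.
- apply: (@eq_cont_on _ _ _ _ (fun=> p)) => [t Dt|]; first by rewrite restr_in.
  exact: cont_on_cst.
- by move=> t Dt; rewrite restr_in.
Qed.

Lemma bd_cst (p : X) n : bdS << restr (fun=> p) >> =
  (~~ odd n)%:R *: << restr (fun=> p) >> :> SC K X n.
Proof.
rewrite bdSU (eq_bigr (fun i : 'I_n.+1 => (-1) ^+ i *: << restr (fun=> p) >>)); last first.
  move=> i _; congr (_ *: << _ >>); apply: eq_restr => t Dt /=.
  by rewrite restr_in //; exact: fc_Delta.
rewrite -scaler_suml; congr (_ *: _).
elim: n => [|n IH]; first by rewrite big_ord_recl big_ord0 addr0 expr0.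
by rewrite big_ord_recr /= IH -signr_odd /=; case: (odd n); rewrite /= ?expr1 ?subrr ?expr0 ?add0r.
Qed.

(** Index 0 is the end of the augmented complex, where every chain is closed. *)
Definition cycle n : SC K X n -> Prop :=
  if n is m.+1 then fun c : SC K X m.+1 => bdS c = 0 else fun=> True.

Lemma cycle_push n (F : X -> X) (c : SC K X n) : cycle c -> cycle (push F c).
Proof. by case: n c => // n c /= c0; rewrite bd_push c0 linear0. Qed.

(** For even [n] the constant simplex is the boundary of the one with one more vertex; for odd [n]
    its own boundary is not 0, so that a closed multiple of it vanishes. *)
Lemma push_cst_bounds (p : X) n (c : SC K X n) : A p -> cycle c -> bounds A (push (fun=> p) c).
Proof.
move=> Ap /(cycle_push (fun=> p)); have [a ->] := push_cst p c.
have even : ~~ odd n -> bounds A (a *: << restr (fun=> p) >> : SC K X n).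
  move=> n_even; exists (a *: << restr (fun=> p) >>).
    by apply: supportedZ; exact: simplex_cst.
  by rewrite linearZ /= bd_cst n_even scale1r.
case: n c even => [|n] c even; first by move=> _; exact: even.
rewrite /= linearZ /= bd_cst; case: (boolP (odd n)) => [on _|en].
  by apply: even; rewrite /= negbK.
rewrite scale1r => /(congr1 (coeff (restr (fun=> p)))).
rewrite coeffZ coeffU eqxx mulr1 mulr1 coeff0 => ->.
by rewrite scale0r; exact: bounds0.
Qed.

(** The straight-line homotopy to [p] reduces the claim to constant chains. *)
Lemma star_bounds (p : X) n (c : SC K X n) :
  (forall x s, A x -> 0 <= s <= 1 -> A (p + s *: (x - p))) -> A p ->
  cycle c -> cin A c -> bounds A c.
Proof.
move=> Astar Ap cc Ac; rewrite -(subrK (push (fun=> p) c) c).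
apply: boundsD; last exact: push_cst_bounds.
pose F (q : (X * R^o)%type) := p + (q.2 : R) *: (q.1 - p).
have F0 : push (fun x => F (x, 0)) c = push (fun=> p) c.
  by apply: eq_push Ac => x _; rewrite /F /= scale0r addr0.
have F1 : push (fun x => F (x, 1)) c = c.
  by apply: push_id Ac => x _; rewrite /F /= scale1r addrC subrK.
rewrite -[X in X - _]F1 -F0; case: n c cc Ac {F0 F1} => [|n] c cc Ac.
  rewrite (_ : _ - _ = 0); first exact: bounds0.
  apply/eqP; rewrite subr_eq0; apply/eqP; apply: linear_eq => g /=.
  rewrite !pushU; congr << _ >>; apply: eq_restr => t [_].
  by rewrite big_ord0 => /eqP; rewrite eq_sym oner_eq0.
apply: bounds_hom => // [|q [Aq q01]]; last exact: Astar.
apply: cont_onD; first exact: cont_on_cst.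
apply: cont_onZ; first exact: cont_on_snd.
by apply: cont_onB; [exact: cont_on_fst|exact: cont_on_cst].
Qed.

End Bounds.

End Hom.

(** * Small chains *)

Section Mesh.
Variables (R : realType) (K : comNzRingType).

Definition small (E : normedModType R) (d : R) n (v : 'I_n -> E) :=
  forall i j, `|v i - v j| <= d.

Lemma cvx_ball (E : normedModType R) (b : E) (r : R) : cvx [set x | `|b - x| <= r].
Proof.
move=> n v t [t0 t1] vr /=.
have -> : b - comb v t = \sum_i t 0 i *: (b - v i).
  under [RHS]eq_bigr do rewrite scalerBr.
  by rewrite sumrB -scaler_suml t1 scale1r.
apply: (le_trans (ler_norm_sum _ _ _)); rewrite -[leRHS]mul1r -t1 mulr_suml.
by apply: ler_sum => i _; rewrite normrZ ger0_norm // ler_wpM2l //; exact: vr.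
Qed.

(** The difference is the mean of all [v i - v k], where the term [i = k] vanishes; hence the factor
    n / (n + 1). *)
Lemma bary_dist (E : normedModType R) (d : R) n (v : 'I_n.+1 -> E) k : small d v ->
  `|bary v - v k| <= n%:R / n.+1%:R * d.
Proof.
move=> vd; have -> : bary v - v k = n.+1%:R^-1 *: \sum_(i | i != k) (v i - v k).
  transitivity (n.+1%:R^-1 *: \sum_i (v i - v k)).
    rewrite sumrB sumr_const card_ord scalerBr -[v k *+ _]scaler_nat scalerA mulVf ?scale1r ?pnatr_eq0 //.
  by rewrite (bigD1 k) //= subrr add0r.
rewrite normrZ ger0_norm ?invr_ge0 ?ler0n // [n%:R / _]mulrC -mulrA.
rewrite ler_wpM2l ?invr_ge0 ?ler0n //; apply: (le_trans (ler_norm_sum _ _ _)).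
apply: le_trans (_ : \sum_(i < n.+1 | i != k) d <= _).
  by apply: ler_sum => i _; exact: vd.
by rewrite sumr_const (eq_card (_ : _ =i predC1 k)) // cardC1 card_ord mulr_natl.
Qed.

(** The classical factor by which barycentric subdivision shrinks a simplex with [n] vertices. *)
Definition ratio n : R := n.-1%:R / n%:R.

Lemma ratio_mono n : ratio n <= ratio n.+1.
Proof.
rewrite /ratio; case: n => [|n] /=; first by rewrite mul0r divr_ge0 ?ler0n.
by rewrite ler_pdivrMr ?ltr0n // mulrAC ler_pdivlMr ?ltr0n // -!natrM ler_nat mulSn !mulnS leq_add2r leqnSn.
Qed.

Lemma mesh_sdv (E : normedModType R) (d : R) n (v : 'I_n -> E) : 0 <= d -> small d v ->
  supported (small (ratio n * d) (n := n)) (sdv K v).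
Proof.
move=> d0; elim: n v => [|n IH] v vd; first by apply: supportedU1 => -[].
(* Vertices other than the barycentre are compared by induction on the faces; all of them lie in a
   ball around the barycentre, because subdivision stays in convex sets. *)
pose S := fun u : 'I_n -> E => small (ratio n * d) u /\
  forall i, `|bary v - u i| <= ratio n.+1 * d.
have HS : supported S (sdL (bdL << v >> : LC K E n)).
  have H1 : supported (small (ratio n * d) (n := n)) (sdL (bdL << v >> : LC K E n)).
    apply: (supported_lift IH); apply: supported_lift (supportedU1 vd) => u ud.
    apply: supported_sum => i _; apply: supportedZ; apply: supportedU1 => j k.
    exact: ud.
  have H2 : lin [set x | `|bary v - x| <= ratio n.+1 * d] (sdL (bdL << v >> : LC K E n)).
    apply: lin_sdL; first exact: cvx_ball.
    by apply: lin_bd; apply: supportedU1 => i; exact: bary_dist.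
  by move=> u uS; split; [exact: H1|exact: H2].
apply: supported_lift HS => u [u1 u2]; apply: supportedU1 => i j.
have r0 : 0 <= ratio n.+1 * d by rewrite mulr_ge0 // divr_ge0 ?ler0n.
rewrite /ccons; case: unliftP => [i' _|_] /=; case: unliftP => [j' _|_] /=.
- by rewrite (le_trans (u1 _ _)) // ler_wpM2r // ratio_mono.
- by rewrite distrC.
- by [].
- by rewrite subrr normr0.
Qed.

End Mesh.

(** * Lebesgue numbers on simplices *)

Section Lebesgue.
Variable R : realType.

Lemma compact_Delta n : compact (Delta R n).
Proof.
have cI : compact [set v : 'rV[R]_n | forall i, `[0, 1]%classic (v ord0 i)].
  by apply: (@rV_compact R n (fun=> `[0, 1]%classic)) => i; exact: segment_compact.
apply: (subclosed_compact _ cI) => [|t [t0 t1] i]; last first.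
  rewrite /= in_itv /= t0 -t1 (bigD1 i) //= lerDl; exact: sumr_ge0.
rewrite (_ : Delta R n = (\bigcap_(i in setT) (fun t : 'rV[R]_n => t 0 i) @^-1` [set x | 0 <= x])
   `&` (comb (fun=> 1 : R^o)) @^-1` [set 1]); last first.
  apply/seteqP; split=> t /= [t0 t1]; split.
  - by move=> i _; exact: t0.
  - by rewrite /= -[RHS]t1; apply: eq_bigr => i _; exact: mulr1.
  - by move=> i; exact: t0.
  - by rewrite -[RHS]t1; apply: eq_bigr => i _; exact: (esym (mulr1 _)).
apply: closedI.
  apply: closed_bigI => i _; apply: closed_comp; last exact: closed_ge.
  by move=> t _; exact: coord_continuous.
apply: closed_comp; last exact: closed_eq.
by move=> t _; exact: comb_continuous.
Qed.

(** The cover of the simplex by the preimages of [U] and [V] has a Lebesgue number: near-covering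
    compactness turns the radii at single points into a common one. *)
Lemma lebesgue_simplex (X : normedModType R) n (g : 'rV[R]_n -> X) (U V : set X) :
  open U -> open V -> simplex_in (U `|` V) g ->
  exists2 d : R, 0 < d & forall t, Delta R n t ->
    (forall s, Delta R n s -> `|t - s| < d -> U (g s)) \/
    (forall s, Delta R n s -> `|t - s| < d -> V (g s)).
Proof.
move=> oU oV [_ cg gUV].
pose P (d : R) (t : 'rV[R]_n) := Delta R n t ->
    (forall s, Delta R n s -> `|t - s| < d -> U (g s)) \/
    (forall s, Delta R n s -> `|t - s| < d -> V (g s)).
have key W t : open W -> W (g t) -> Delta R n t -> exists2 e : R, 0 < e &
    forall s, Delta R n s -> `|t - s| < e -> W (g s).
  move=> oW Wt Dt; have := cg t Dt W (open_nbhs_nbhs (conj oW Wt)).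
  move=> /nbhs_ballP[e /= e0 eW]; exists e => // s Ds ts.
  by apply: eW Ds; rewrite -ball_normE.
have near0 W t : open W -> W (g t) -> Delta R n t ->
    \forall t' \near t & d \near (0 : R)^'+, forall s, Delta R n s -> `|t' - s| < d -> W (g s).
  move=> oW Wt Dt; have [e e0 eW] := key W t oW Wt Dt.
  (* Halving the radius makes the condition stable when the centre moves. *)
  exists (ball t (e / 2), [set d | d < e / 2]) => /=.
    split; first by apply: nbhsx_ballx; rewrite divr_gt0.
    by apply: nbhs_right_lt; rewrite divr_gt0.
  move=> [t' d] [/= tt' de] s Ds ts; apply: eW => //.
  move: tt'; rewrite -ball_normE /= => tt'.
  rewrite -(subrK t' t) -addrA (le_lt_trans (ler_normD _ _)) //.
  by rewrite (splitr e) ltrD // (lt_trans ts).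
have cov t : Delta R n t -> \forall t' \near t & d \near (0 : R)^'+, P d t'.
  move=> Dt; have [Ut|Vt] := gUV t Dt.
    by apply: filterS (near0 U t oU Ut Dt) => -[t' d] /= H _; left.
  by apply: filterS (near0 V t oV Vt Dt) => -[t' d] /= H _; right.
have := (compact_near_coveringP (Delta R n)).1 (@compact_Delta n) R (0^'+) P _ cov.
move=> /(_ _) H.
have /filter_ex[d [d0 Hd]] : \forall d \near (0 : R)^'+, 0 < d /\ Delta R n `<=` P d.
  by apply: filterI => //; exact: nbhs_right_gt.
by exists d => // t Dt; exact: Hd.
Qed.

End Lebesgue.

Section SmallChains.
Variables (R : realType) (K : comNzRingType) (X : normedModType R).

Lemma sd_real (E : normedModType R) n (c : LC K E n) : sd (real c) = real (sdL c).
Proof.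
apply: (@linear_eq _ _ _ (@sd R K E n \o @real R K E n) (@real R K E n \o @sdL R K E n)).
move=> v /=; rewrite realU sdE sdLU.
rewrite (eq_push (G := comb v) _ (@cin_sdU R K n)) => [|t Dt]; last first.
  by rewrite /aff restr_in.
rewrite push_real => [|u t _]; last exact: comb_linear.
rewrite -sdLU push_sdL pushLU sdLU; congr (real (sdv _ _)).
by apply/funext => k /=; rewrite comb_at_vtx.
Qed.

Lemma push_sd (E : normedModType R) (F : E -> X) n (c : SC K E n) :
  push F (sd c) = sd (push F c).
Proof.
apply: (@linear_eq _ _ _ (push F \o @sd R K E n) (@sd R K X n \o push F)).
move=> g /=; rewrite pushU !sdE push_comp; apply: eq_push (@cin_sdU R K n) => t Dt /=.
by rewrite restr_in.
Qed.

(** Reduces the iterated subdivision of a singular simplex to linear chains, where the mesh can be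
    measured. *)
Lemma iter_sdE j n (g : 'rV[R]_n -> X) : simplex_in setT g ->
  iter j (@sd R K X n) << g >> = push g (real (iter j (@sdL R K _ n) << @vtx R n >>)).
Proof.
move=> [rg _ _]; elim: j => [|j IH] /=.
  rewrite realU pushU -[in LHS]rg; congr << _ >>; apply: eq_restr => t Dt /=.
  by rewrite /aff restr_in // comb_vtx.
by rewrite IH -push_sd sd_real.
Qed.

Definition diam n : R := \sum_(p : 'I_n * 'I_n) `|vtx R p.1 - vtx R p.2|.

Lemma mesh_iter j n : supported (fun v : 'I_n -> 'rV[R]_n =>
    small (ratio R n ^+ j * diam n) v /\ forall i, Delta R n (v i))
  (iter j (@sdL R K _ n) << @vtx R n >>).
Proof.
have D1 : lin (Delta R n) (iter j (@sdL R K _ n) << @vtx R n >>).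
  elim: j => [|j IH] /=; first exact: lin_vtx.
  by apply: lin_sdL => //; exact: cvx_Delta.
have r0 : 0 <= ratio R n by rewrite divr_ge0 ?ler0n.
suff D2 : supported (small (ratio R n ^+ j * diam n) (n := n))
    (iter j (@sdL R K _ n) << @vtx R n >>).
  by move=> v vS; split; [exact: D2|exact: D1].
elim: j {D1} => [|j IH] /=.
  apply: supportedU1 => i k; rewrite expr0 mul1r.
  by rewrite /diam (bigD1 (i, k)) //= lerDl; exact: sumr_ge0.
apply: (supported_lift _ IH) => v vd; rewrite exprS -mulrA; apply: mesh_sdv => //.
by rewrite mulr_ge0 ?exprn_ge0 //; exact: sumr_ge0.
Qed.

Variables (U V : set X).
Hypotheses (oU : open U) (oV : open V).

Definition splits n (c : SC K X n) :=
  exists c1 c2, [/\ cin U c1, cin V c2 & c = c1 + c2].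

Lemma splitsD n (c d : SC K X n) : splits c -> splits d -> splits (c + d).
Proof.
move=> [c1 [c2 [U1 V1 ->]]] [d1 [d2 [U2 V2 ->]]]; exists (c1 + d1), (c2 + d2).
by split; [exact: supportedD|exact: supportedD|rewrite addrACA].
Qed.

Lemma splitsZ n k (c : SC K X n) : splits c -> splits (k *: c).
Proof.
move=> [c1 [c2 [U1 V1 ->]]]; exists (k *: c1), (k *: c2).
by split; [exact: supportedZ|exact: supportedZ|rewrite scalerDr].
Qed.

Lemma splits0 n : splits (0 : SC K X n).
Proof. by exists 0, 0; split; [exact: supported0|exact: supported0|rewrite addr0]. Qed.

Lemma splits_sd j n (c : SC K X n) : splits c -> splits (iter j (@sd R K X n) c).
Proof.
move=> [c1 [c2 [U1 V1 ->]]]; elim: j => [|j [d1 [d2 [U2 V2 /= ->]]]]; first by exists c1, c2.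
by exists (sd d1), (sd d2); split; [exact: cin_sd|exact: cin_sd|rewrite linearD].
Qed.

Lemma supported_splits n (c : SC K X n) :
  supported (fun g => simplex_in U g \/ simplex_in V g) c -> splits c.
Proof.
move=> UV; rewrite -(freeg_sumE c) big_seq.
apply: (big_ind (@splits n)) => [||g /UV [gU|gV]]; first exact: splits0.
- by move=> ? ?; exact: splitsD.
- exists << coeff g c *g g >>, 0; split; rewrite ?addr0 //; last exact: supported0.
  by rewrite freegUZ; apply: supportedZ; exact: supportedU1.
- exists 0, << coeff g c *g g >>; split; rewrite ?add0r //; first exact: supported0.
  by rewrite freegUZ; apply: supportedZ; exact: supportedU1.
Qed.

Lemma small_simplex n (g : 'rV[R]_n -> X) : simplex_in (U `|` V) g ->
  exists j, splits (iter j (@sd R K X n) << g >>).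
Proof.
case: n g => [|n] g gUV.
  (* The empty simplex lies in every set. *)
  exists 0%N; exists << g >>, 0; split; rewrite ?addr0 //; last exact: supported0.
  apply: supportedU1; case: gUV => rg _ _; split => // t [_]; rewrite big_ord0 => /eqP;
  by rewrite eq_sym oner_eq0.
have [d d0 dP] := lebesgue_simplex oU oV gUV.
have r0 : 0 <= ratio R n.+1 by rewrite divr_ge0 ?ler0n.
have r1 : `|ratio R n.+1| < 1.
  by rewrite ger0_norm // /ratio ltr_pdivrMr ?ltr0n // mul1r ltr_nat.
have D0 : 0 <= diam n.+1 by exact: sumr_ge0.
have [j jd] : exists j, ratio R n.+1 ^+ j * diam n.+1 < d.
  (* Adding 1 keeps the divisor positive: [diam 1] is 0. *)
  have e0 : 0 < d / (diam n.+1 + 1) by rewrite divr_gt0 // ltr_wpDl.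
  have /cvgrPdist_lt /(_ _ e0) := cvg_expr r1.
  move=> /filter_ex[j]; rewrite sub0r normrN ger0_norm ?exprn_ge0 // => jd; exists j.
  apply: (@le_lt_trans _ _ (ratio R n.+1 ^+ j * (diam n.+1 + 1))).
    by rewrite ler_wpM2l ?exprn_ge0 // lerDl.
  by rewrite -ltr_pdivlMr // ltr_wpDl.
exists j; apply: supported_splits; rewrite iter_sdE; last by case: gUV.
have := @mesh_iter j n.+1.
set w := iter j _ _ => wS.
rewrite -(freeg_sumE w) big_seq !linear_sum; apply: supported_sum => v /wS[vs vD] /=.
rewrite freegUZ !linearZ /= realU pushU; apply: supportedZ; apply: supportedU1.
have cv t : Delta R n.+1 t -> Delta R n.+1 (comb v t) by move=> Dt; exact: cvx_Delta.
have near t : Delta R n.+1 t -> `|v ord0 - comb v t| < d.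
  move=> Dt; apply: le_lt_trans jd.
  by apply: (@cvx_ball R _ (v ord0) _ n.+1 v t Dt) => i; exact: vs.
have [rg cg gA] := gUV.
have cont : cont_on (Delta R n.+1) (restr (g \o aff v)).
  apply: (@eq_cont_on _ _ _ _ (g \o comb v)) => [t Dt|].
    by rewrite restr_in //= /aff restr_in.
  apply: (cont_on_comp _ cg cv).
  by apply: cont_on_continuous; exact: comb_continuous.
have [H|H] := dP (v ord0) (vD ord0); [left|right]; split => //; try exact: restrK; try exact: cont.
- by move=> t Dt; rewrite restr_in //= /aff restr_in //; apply: H; [exact: cv|exact: near].
- by move=> t Dt; rewrite restr_in //= /aff restr_in //; apply: H; [exact: cv|exact: near].
Qed.

Lemma small_chains n (c : SC K X n) : cin (U `|` V) c ->
  exists j, splits (iter j (@sd R K X n) c).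
Proof.
move=> cUV; rewrite -(freeg_sumE c) big_seq.
apply: (big_ind (fun c => exists j, splits (iter j (@sd R K X n) c))).
- by exists 0%N; exact: splits0.
- have itD j (x y : SC K X n) : iter j (@sd R K X n) (x + y) = iter j (@sd R K X n) x + iter j (@sd R K X n) y.
    by elim: j => //= j ->; rewrite linearD.
  (* Splittings survive further subdivision, so the exponents may be added. *)
  move=> x y [i xi] [j yj]; exists (i + j)%N; rewrite itD; apply: splitsD.
    by rewrite addnC iterD; exact: splits_sd.
  by rewrite iterD; exact: splits_sd.
- move=> g /cUV /small_simplex[j gj]; exists j; rewrite freegUZ.
  have -> : iter j (@sd R K X n) (coeff g c *: << g >>) = coeff g c *: iter j (@sd R K X n) << g >>.
    by elim: j {gj} => //= j ->; rewrite linearZ.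
  exact: splitsZ.
Qed.

End SmallChains.

(** * Spheres *)

Section LowDim.
Variables (R : realType) (K : comNzRingType) (X : normedModType R).

Lemma eq_simplex0 (g h : 'rV[R]_0 -> X) : restr g = restr h.
Proof.
by apply: eq_restr => t [_]; rewrite big_ord0 => /eqP; rewrite eq_sym oner_eq0.
Qed.

Lemma simplex0_in (A B : set X) (g : 'rV[R]_0 -> X) : simplex_in A g -> simplex_in B g.
Proof.
by case=> rg _ _; split=> // t [_]; rewrite big_ord0 => /eqP; rewrite eq_sym oner_eq0.
Qed.

Lemma cin0_in (A B : set X) (c : SC K X 0) : cin A c -> cin B c.
Proof. by apply: supportedW => g; exact: simplex0_in. Qed.

Lemma sd0 A (c : SC K X 0) : cin A c -> sd c = c.
Proof.
move=> Ac; apply: (@linear_eq_dom _ _ _ (@sd R K X 0) idfun) => g /Ac[rg _ _] /=.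
by rewrite sdE /sdU realU pushU -[in RHS]rg; congr << _ >>; exact: eq_simplex0.
Qed.

Lemma iter_sd_bounds (A : set X) j n (c : SC K X n) : cin A c -> cycle c ->
  cin A (iter j (@sd R K X n) c) /\ bounds A (c - iter j (@sd R K X n) c).
Proof.
case: n c => [|n] c Ac c0; last by have [] := bounds_iter_sd j Ac c0.
have -> : iter j (@sd R K X 0) c = c.
  by elim: j => //= j ->; exact: (sd0 Ac).
by rewrite subrr; split => //; exact: bounds0.
Qed.

(** The start of the induction over spheres: in index 0 the empty simplex is the only generator. *)
Lemma chain0 A (c : SC K X 0) : cin A c -> exists a : K, c = a *: << restr (fun=> 0) >>.
Proof.
move=> Ac; have [a aE] := push_cst (0 : X) c; exists a; rewrite -aE.
apply/esym/(@linear_eq_dom _ _ _ (push (fun=> 0)) idfun) => g /Ac[rg _ _] /=.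
by rewrite pushU -[in RHS]rg; congr << _ >>; exact: eq_simplex0.
Qed.

Lemma cycle_bd n (c : SC K X n.+1) : cycle (bdS c).
Proof. by case: n c => // n c; exact: bdSS. Qed.

Lemma cinI (A B : set X) n (c : SC K X n) : cin A c -> cin B c -> cin (A `&` B) c.
Proof. by move=> Ac Bc g gc; have [rg cg gA] := Ac g gc; have [_ _ gB] := Bc g gc; split=> // t Dt; split; [exact: gA|exact: gB]. Qed.

End LowDim.

Section Spheres.
Variables (R : realType) (N : nat).

(* [W m] has the homotopy type of the sphere of dimension [m - 1].  The sets
   [Wpos m] and [Wneg m] cover [W m.+1], meet in [W m] and are star-shaped around
   the poles [pole m] and [- pole m]. *)
Definition W m : set 'rV[R]_N.+1 := [set x | exists2 i, (i < m)%N & x 0 (inord i) != 0].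
Definition Wpos m : set 'rV[R]_N.+1 := [set x | W m x \/ 0 < x 0 (inord m)].
Definition Wneg m : set 'rV[R]_N.+1 := [set x | W m x \/ x 0 (inord m) < 0].

Lemma W0 : W 0 = set0.
Proof. by apply/seteqP; split=> x // [i]. Qed.

Lemma WS m : W m.+1 = Wpos m `|` Wneg m.
Proof.
apply/seteqP; split=> x.
  move=> [i]; rewrite ltnS leq_eqVlt => /orP[/eqP ->|im] xi.
    by have /orP[x0|x0] := lt_total xi; [right; right|left; right].
  by left; left; exists i.
have Wm : W m x -> W m.+1 x by move=> [i im xi]; exists i => //; rewrite ltnS ltnW.
move=> [[/Wm //|xm]|[/Wm //|xm]]; exists m => //; first by rewrite gt_eqF.
by rewrite lt_eqF.
Qed.

Lemma WI m : Wpos m `&` Wneg m = W m.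
Proof.
apply/seteqP; split=> x; last by move=> Wx; split; left.
by move=> [[//|x0] [//|x1]]; have := lt_trans x0 x1; rewrite ltxx.
Qed.

Lemma open_W m : open (W m).
Proof.
rewrite (_ : W m = \bigcup_(i in [set i | (i < m)%N]) (fun x : 'rV[R]_N.+1 => x 0 (inord i)) @^-1` [set x | x != 0]).
  apply: bigcup_open => i _; apply: open_comp; last exact: open_neq.
  by move=> x _; exact: coord_continuous.
apply/seteqP; split=> x.
  by move=> [i im xi]; exists i.
by move=> [i im xi]; exists i.
Qed.

Lemma open_Wpos m : open (Wpos m).
Proof.
apply: openU; first exact: open_W.
apply: (@open_comp _ _ (fun x : 'rV[R]_N.+1 => x 0 (inord m)) [set x | 0 < x]); last exact: open_gt.
by move=> x _; exact: coord_continuous.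
Qed.

Lemma open_Wneg m : open (Wneg m).
Proof.
apply: openU; first exact: open_W.
apply: (@open_comp _ _ (fun x : 'rV[R]_N.+1 => x 0 (inord m)) [set x | x < 0]); last exact: open_lt.
by move=> x _; exact: coord_continuous.
Qed.

Definition pole m : 'rV[R]_N.+1 := delta_mx 0 (inord m).

Lemma pole_coord m : pole m 0 (inord m) = 1.
Proof. by rewrite mxE !eqxx. Qed.

Lemma pole_coord0 m i : (m <= N)%N -> (i < m)%N -> pole m 0 (inord i) = 0.
Proof.
move=> mN im; rewrite mxE eqxx /= -val_eqE /= !inordK ?ltnS //.
  by rewrite (ltn_eqF im).
exact: leq_trans (ltnW im) mN.
Qed.

Lemma star_Wpos m x s : (m <= N)%N -> Wpos m x -> 0 <= s <= 1 ->
  Wpos m (pole m + s *: (x - pole m)).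
Proof.
have cE j : (pole m + s *: (x - pole m)) 0 j = pole m 0 j + s * (x 0 j - pole m 0 j).
  by rewrite !mxE.
move=> mN Wx /andP[s0 s1]; have [->|sn0] := eqVneq s 0.
  by rewrite scale0r addr0; right; rewrite pole_coord.
have sp : 0 < s by rewrite lt_neqAle eq_sym sn0.
case: Wx => [[i im xi]|xm]; [left|right].
  by exists i => //; rewrite cE pole_coord0 // add0r subr0 mulf_neq0.
rewrite cE pole_coord mulrBr mulr1 addrCA.
by rewrite ltr_pwDl ?subr_ge0 // mulr_gt0.
Qed.

Lemma WposN m x : Wpos m (- x) <-> Wneg m x.
Proof.
have WN y : W m y -> W m (- y) by move=> [i im yi]; exists i; rewrite // mxE oppr_eq0.
split=> [[/WN|]|[/WN|]]; [rewrite opprK; left => //|rewrite mxE oppr_gt0; right => //|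
  by left|by right; rewrite mxE oppr_gt0].
Qed.

Lemma WnegN m x : Wneg m (- x) <-> Wpos m x.
Proof. by rewrite -[X in Wpos m X]opprK WposN. Qed.

Lemma star_Wneg m x s : (m <= N)%N -> Wneg m x -> 0 <= s <= 1 ->
  Wneg m (- pole m + s *: (x + pole m)).
Proof.
move=> mN /WposN Wx s01; apply/WposN; rewrite opprD opprK -scalerN opprD.
exact: star_Wpos.
Qed.

Lemma Wpos_pole m : Wpos m (pole m).
Proof. by right; rewrite pole_coord. Qed.

Lemma Wneg_pole m : Wneg m (- pole m).
Proof. exact/WnegN/Wpos_pole. Qed.

Section Homology.
Variable K : comNzRingType.
Local Notation V := 'rV[R]_N.+1.

Lemma Wpos_bounds m n (c : SC K V n) : (m <= N)%N -> cycle c -> cin (Wpos m) c ->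
  bounds (Wpos m) c.
Proof.
move=> mN; apply: (@star_bounds _ _ _ _ (pole m)); last exact: Wpos_pole.
by move=> x s; exact: star_Wpos.
Qed.

Lemma Wneg_bounds m n (c : SC K V n) : (m <= N)%N -> cycle c -> cin (Wneg m) c ->
  bounds (Wneg m) c.
Proof.
move=> mN; apply: (@star_bounds _ _ _ _ (- pole m)); last exact: Wneg_pole.
by move=> x s; rewrite opprK; exact: star_Wneg.
Qed.

Lemma Wpos_sub m : Wpos m `<=` W m.+1. Proof. by rewrite WS => x; left. Qed.
Lemma Wneg_sub m : Wneg m `<=` W m.+1. Proof. by rewrite WS => x; right. Qed.
Lemma W_pos m : W m `<=` Wpos m. Proof. by move=> x; left. Qed.
Lemma W_neg m : W m `<=` Wneg m. Proof. by move=> x; left. Qed.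

(** The pieces come from a fine subdivision of [c]. Up to sign they have the same boundary, which
    therefore lies in both covering sets, hence in [W m]: this is the connecting map. *)
Lemma mayer_vietoris m n (c : SC K V n.+1) : cin (W m.+1) c -> bdS c = 0 ->
  exists u l, [/\ cin (Wpos m) u, cin (Wneg m) l, bounds (W m.+1) (c - (u + l)),
    bdS l = - bdS u & cin (W m) (bdS u)].
Proof.
move=> Wc c0; have := Wc; rewrite WS => /(small_chains (@open_Wpos m) (@open_Wneg m)).
move=> [j [u [l [Uu Vl jE]]]].
have [_ j0 jb] := bounds_iter_sd j Wc c0.
have bE : bdS l = - bdS u.
  by apply/eqP; rewrite -addr_eq0 addrC -linearD -jE /= j0.
exists u, l; split => //; first by rewrite -jE -WS.
rewrite -WI; apply: cinI; first exact: cin_bd.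
by rewrite -[bdS u]opprK -bE; apply: supportedN; exact: cin_bd.
Qed.

(** Index [n] means dimension n - 1, so the bound says below the dimension of the sphere. The seam
    of the two pieces bounds in [W m] by induction, and correcting both by the chain it bounds makes
    each a cycle in a star-shaped set. *)
Lemma W_vanish m n (c : SC K V n) : (n < m <= N.+1)%N -> cin (W m) c -> cycle c ->
  bounds (W m) c.
Proof.
elim: m n c => [|m IH] n c /andP[// nm mN] Wc c0.
case: n c nm Wc c0 => [|n] c nm Wc c0.
  by apply: boundsS (@Wpos_sub m) _; apply: Wpos_bounds => //; exact: cin0_in Wc.
have [u [l [Uu Vl cb bE Wu]]] := mayer_vietoris Wc c0.
have [y Wy yE] : bounds (W m) (bdS u).
  apply: IH => //; last exact: cycle_bd.
  by apply/andP; split; [exact: nm|exact: ltnW].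
rewrite -(subrK (u + l) c); apply: boundsD => //.
have -> : u + l = (u - y) + (l + y) by rewrite addrACA addNr addr0.
apply: boundsD.
  apply: boundsS (@Wpos_sub m) _; apply: Wpos_bounds => //=.
    by rewrite linearB /= yE subrr.
  by apply: supportedB => //; exact: cinS (@W_pos m) Wy.
apply: boundsS (@Wneg_sub m) _; apply: Wneg_bounds => //=.
  by rewrite linearD /= yE bE addNr.
by apply: supportedD => //; exact: cinS (@W_neg m) Wy.
Qed.

Variables (z e : forall m, SC K V m).

(* [z m] is a fundamental cycle of [W m], and [e m.+1] a hemisphere that it bounds. *)
Definition suspension_tower M :=
  [/\ z 0 = << restr (fun=> 0) >>,
   forall m, (m < M)%N -> cin (Wpos m) (e m.+1),
   forall m, (m < M)%N -> bdS (e m.+1) = z m &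
   forall m, (m < M)%N -> z m.+1 = e m.+1 - (-1) ^+ m *: push -%R (e m.+1)].

Variable M : nat.
Hypotheses (MN : (M <= N.+1)%N) (ze : suspension_tower M).

Definition opp_e m : SC K V m.+1 := (-1) ^+ m *: push -%R (e m.+1).

(** The degree (-1)^m of the antipode of the sphere of dimension m - 1, here an identity of chains
    thanks to the symmetric form of [z]. *)
Lemma tower_neg m : (m <= M)%N -> push -%R (z m) = (-1) ^+ m *: z m.
Proof.
have [z0 eU be zS] := ze; case: m => [_|m mN].
  rewrite z0 pushU expr0 scale1r; congr << _ >>; exact: eq_simplex0.
rewrite zS // linearB linearZ /= push_comp.
rewrite (push_id (A := setT) (F := -%R \o -%R)) => [|x _|]; last 2 first.
- by rewrite /= opprK.
- by apply: cinS (eU m mN).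
rewrite exprS mulN1r scaleNr scalerBr scalerA -exprD addnn -(signr_odd _ m.*2) odd_double.
by rewrite scale1r opprB.
Qed.

Lemma opp_e_neg m : (m < M)%N -> cin (Wneg m) (opp_e m).
Proof.
have [z0 eU be zS] := ze => mN; apply: supportedZ; apply: cin_push (eU m mN).
  by apply: cont_on_continuous; exact: opp_continuous.
by move=> x /WnegN.
Qed.

Lemma bd_opp_e m : (m < M)%N -> bdS (opp_e m) = z m.
Proof.
have [z0 eU be zS] := ze => mN; rewrite linearZ /= bd_push be //.
by rewrite tower_neg ?(ltnW mN) // scalerA -exprD addnn -(signr_odd _ m.*2) odd_double scale1r.
Qed.

Lemma cin_z m : (m <= M)%N -> cin (W m) (z m).
Proof.
have [z0 eU be zS] := ze; case: m => [_|m mN].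
  rewrite z0; apply: supportedU1; apply: (@simplex0_in R V setT); split=> //.
    exact: restrK.
  by move=> t [_]; rewrite big_ord0 => /eqP; rewrite eq_sym oner_eq0.
rewrite zS //; apply: supportedB; first exact: cinS (@Wpos_sub m) (eU m mN).
exact: cinS (@Wneg_sub m) (opp_e_neg mN).
Qed.

Lemma cycle_z m : (m <= M)%N -> cycle (z m).
Proof.
have [z0 eU be zS] := ze; case: m => // m mN /=.
by rewrite zS // linearB /= be // -/(opp_e m) bd_opp_e // subrr.
Qed.

(** The coefficient is found on the seam by induction. Subtracting that multiple of the two
    hemispheres leaves pieces that close up in star-shaped sets. *)
Lemma W_generator m (c : SC K V m) : (m <= M)%N -> cin (W m) c -> cycle c ->
  exists k, bounds (W m) (c - k *: z m).
Proof.
have [z0 eU be zS] := ze; elim: m c => [|m IH] c mN Wc c0.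
  have [k ->] := chain0 Wc; exists k; rewrite z0 subrr; exact: bounds0.
have [u [l [Uu Vl cb bE Wu]]] := mayer_vietoris Wc c0.
have [k [y Wy yE]] := IH _ (ltnW mN) Wu (cycle_bd u).
exists k; rewrite zS // -/(opp_e m).
have -> : c - k *: (e m.+1 - opp_e m) =
    (c - (u + l)) + ((u - k *: e m.+1 - y) + (l + k *: opp_e m + y)).
  rewrite [X in _ = _ + X]addrACA addNr addr0 [X in _ = _ + X]addrACA (addrA (c - _)) subrK.
  by rewrite scalerBr opprB [- _ + _]addrC.
apply: boundsD => //; apply: boundsD.
  apply: boundsS (@Wpos_sub m) _; apply: Wpos_bounds => //=; first by rewrite -ltnS (leq_trans mN MN).
    by rewrite !linearB linearZ /= yE be // subrr.
  apply: supportedB; last exact: cinS (@W_pos m) Wy.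
  by apply: supportedB => //; apply: supportedZ; exact: eU.
apply: boundsS (@Wneg_sub m) _; apply: Wneg_bounds => //=; first by rewrite -ltnS (leq_trans mN MN).
  by rewrite !linearD linearZ /= yE bd_opp_e // bE [X in X + _]addrC addrA subrK subrr.
apply: supportedD; last exact: cinS (@W_neg m) Wy.
by apply: supportedD => //; apply: supportedZ; exact: opp_e_neg.
Qed.

(** A fine subdivision of the bounding chain splits as [a + b]. The chain [x] below, computed from
    [a] or from [b], lies in both covering sets, hence in [W m], and there it bounds a subdivision
    of [k *: z m]. *)
Lemma W_nontrivial m k : (m <= M)%N -> bounds (W m) (k *: z m) -> k = 0.
Proof.
have [z0 eU be zS] := ze; elim: m => [|m IH] mN.
  rewrite z0 W0 => -[w w0 wE].
  (* The simplices of [w] have a vertex but lie in the empty set. *)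
  have : w = 0.
    apply/eqP; rewrite -dom_eq0; case dE : (dom w) => [//|g s].
    have gw : g \in dom w by rewrite dE mem_head.
    by have [_ _ gW] := w0 g gw; case: (gW _ (vtx_Delta R (ord0 : 'I_1))).
  move=> w00; move: wE; rewrite w00 linear0.
  move=> /(congr1 (coeff (restr (fun=> 0)))).
  by rewrite coeffZ coeffU eqxx mulr1 mulr1 coeff0.
move=> [w Ww wE]; apply: IH (ltnW mN) _.
have := Ww; rewrite WS => /(small_chains (@open_Wpos m) (@open_Wneg m)).
move=> [j [a [b [Ua Vb jE]]]].
have sdZ i n (x : SC K V n) r : iter i (@sd R K V n) (r *: x) = r *: iter i (@sd R K V n) x.
  by elim: i => //= i ->; rewrite linearZ.
have sdB i n (x y : SC K V n) : iter i (@sd R K V n) (x - y) = iter i (@sd R K V n) x - iter i (@sd R K V n) y.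
  by elim: i => //= i ->; rewrite linearB.
have bdsd i n (x : SC K V n.+1) : bdS (iter i (@sd R K V n.+1) x) = iter i (@sd R K V n) (bdS x).
  by elim: i => //= i IHi; rewrite bd_sd IHi.
have cinsd i n A (x : SC K V n) : cin A x -> cin A (iter i (@sd R K V n) x).
  by move=> Ax; elim: i => //= i; exact: cin_sd.
set s := fun n => iter j (@sd R K V n) in sdZ sdB bdsd cinsd jE *.
pose x := k *: iter j (@sd R K V _) (e m.+1) - bdS a.
have xE : x = k *: iter j (@sd R K V _) (opp_e m) + bdS b.
  apply/eqP; rewrite subr_eq -addrA [bdS b + _]addrC -linearD -jE /= bdsd wE sdZ.
  by rewrite zS // -/(opp_e m) sdB scalerBr addrC subrK.
have [_ zb] := iter_sd_bounds j (cin_z (ltnW mN)) (cycle_z (ltnW mN)).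
rewrite -(subrK (iter j (@sd R K V _) (z m)) (z m)) scalerDr.
apply: boundsD; first exact: boundsZ.
exists x; last by rewrite linearB linearZ /= bdSS subr0 bdsd be.
rewrite -WI; apply: cinI.
  by apply: supportedB; [apply: supportedZ; apply: cinsd; exact: eU|exact: cin_bd].
rewrite xE.
by apply: supportedD; [apply: supportedZ; apply: cinsd; exact: opp_e_neg|exact: cin_bd].
Qed.

End Homology.
End Spheres.

(** * Integral chains and reduction of coefficients *)

Section Reduction.
Variables (R : realType).

(** [rho] changes the ring of coefficients, so only additivity is at hand; over the integers it
    suffices. *)
Lemma int_additive_eq (T : choiceType) (M : zmodType) (f g : {additive {freeg T / int} -> M}) :
  (forall x, f << x >> = g << x >>) -> f =1 g.
Proof.
move=> fg c; rewrite -(freeg_sumE c) !raddf_sum; apply: eq_bigr => x _ /=.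
have -> : << coeff x c *g x >> = << x >> *~ coeff x c :> {freeg T / int}.
  by rewrite freegU_mulz intz.
by rewrite !raddfMz fg.
Qed.

Variables (K : comNzRingType) (X : normedModType R).

Definition rho n (c : SC int X n) : SC K X n :=
  fglift (fun g => (<< g >> : zmodule (SC K X n))) c.

Lemma rho_is_additive n : zmod_morphism (@rho n).
Proof. by move=> x y; rewrite /rho linearB. Qed.

HB.instance Definition _ n := GRing.isZmodMorphism.Build (SC int X n) (SC K X n)
  (@rho n) (@rho_is_additive n).

Lemma rhoU n (g : 'rV[R]_n -> X) : rho << g >> = << g >>.
Proof. by rewrite /rho fgliftU1. Qed.

Lemma rhoZ n (a : int) (c : SC int X n) : rho (a *: c) = a%:~R *: rho c.
Proof.
rewrite /rho linearZ /=; move: (fglift _ _) => d; rewrite scalezrE.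
exact: esym (scaler_int _ (d : SC K X n)).
Qed.

Lemma bd_rho n (c : SC int X n.+1) : bdS (rho c) = rho (bdS c).
Proof.
apply: (@int_additive_eq _ _ (@bdS R K X n \o @rho n.+1) (@rho n \o @bdS R int X n)).
move=> g /=; rewrite rhoU !bdSU raddf_sum; apply: eq_bigr => i _ /=.
by rewrite rhoZ rhoU rmorphXn /= rmorphN1.
Qed.

Lemma cin_rho A n (c : SC int X n) : cin A c -> cin A (rho c).
Proof.
move=> Ac; rewrite -(freeg_sumE c) raddf_sum big_seq; apply: supported_sum => g /Ac gA /=.
by rewrite freegUZ rhoZ rhoU; apply: supportedZ; exact: supportedU1.
Qed.

End Reduction.

Lemma push_rho (R : realType) (K : comNzRingType) (X Y : normedModType R) (F : X -> Y) n
  (c : SC int X n) : push F (rho K c) = rho K (push F c).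
Proof.
apply: (@int_additive_eq _ _ (push F \o @rho R K X n) (@rho R K Y n \o push F)).
by move=> g /=; rewrite rhoU !pushU rhoU.
Qed.

(** * Integral fundamental cycles of spheres *)

Section Tower.
Variables (R : realType) (N : nat).
Local Notation V := 'rV[R]_N.+1.

(** Built over the integers because the degree of h is given on integral homology, and reduced
    modulo 4 afterwards. A bounding hemisphere is chosen at each stage; [tower_int] proves that one
    exists. *)
Fixpoint sphere_cycle m : SC int V m :=
  match m with
  | 0 => << restr (fun=> 0) >>
  | n.+1 => let e := xget 0 [set w | cin (Wpos n) w /\ bdS w = sphere_cycle n] in
     e - (-1) ^+ n *: push -%R e
  end.

Definition hemisphere m : SC int V m :=
  match m with
  | 0 => 0
  | n.+1 => xget 0 [set w | cin (Wpos n) w /\ bdS w = sphere_cycle n]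
  end.

Lemma tower_int M : (M <= N.+1)%N -> suspension_tower sphere_cycle hemisphere M.
Proof.
elim: M => [|M IH] MN; first by split.
have ze := IH (ltnW MN); have [_ eU be zS] := ze.
have [eM bM] : cin (Wpos M) (hemisphere M.+1) /\ bdS (hemisphere M.+1) = sphere_cycle M.
  apply: (@xgetPex _ 0 [set w | cin (Wpos M) w /\ bdS w = sphere_cycle M]).
  have zW : cin (Wpos M) (sphere_cycle M).
    by apply: cinS (@W_pos R N M) _; apply: (cin_z ze).
  have zc : cycle (sphere_cycle M) by apply: (cycle_z ze).
  by have [w Ww wE] := @Wpos_bounds R N int M M _ MN zc zW; exists w.
by split=> // m; rewrite ltnS leq_eqVlt => /orP[/eqP ->|] //; [exact: eU|exact: be].
Qed.

Lemma tower_rho (K : comNzRingType) M : (M <= N.+1)%N ->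
  suspension_tower (fun m => rho K (sphere_cycle m)) (fun m => rho K (hemisphere m)) M.
Proof.
move=> /tower_int [z0 eU be zS]; split=> [|m mM|m mM|m mM].
- by rewrite z0 rhoU.
- by apply: cin_rho; exact: eU.
- by rewrite bd_rho be.
- by rewrite zS // raddfB /= rhoZ rmorphXn /= rmorphN1 push_rho.
Qed.

End Tower.

(** * Comparison with the singular chains of the statement *)

Section Extension.
Variables (R : realType) (X : normedModType R).

Definition extend (Y : zmodType) (A : set X) (f : A -> Y) (x : X) : Y :=
  if pselect (A x) is left Ax then f (exist _ x (mem_set Ax)) else 0.

Lemma extend_val (Y : zmodType) (A : set X) (f : A -> Y) (t : A) : extend f (set_val t) = f t.
Proof.
rewrite /extend; case: pselect => [p|]; last by have := set_valP t.
by congr f; apply/val_inj.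
Qed.

Lemma extend_in (Y : zmodType) (A : set X) (f : A -> Y) x (Ax : A x) :
  extend f x = f (exist _ x (mem_set Ax)).
Proof. exact: (extend_val f (exist _ x (mem_set Ax))). Qed.

Lemma cont_on_extend (Y : normedModType R) (A : set X) (f : A -> Y) :
  continuous f -> cont_on A (extend f).
Proof.
move=> cf x Ax U; rewrite (extend_in _ Ax) => Uf.
have [B [oB Bx] BU] := cf _ _ Uf.
case: oB => O oO OB; rewrite -OB /= in Bx BU.
have : nbhs x O by apply: open_nbhs_nbhs; split.
by apply: filterS => y Oy Ay; rewrite /= (extend_in _ Ay); exact: BU.
Qed.

Lemma continuous_val (Y : normedModType R) (A : set X) (F : X -> Y) :
  cont_on A F -> continuous (fun t : A => F (set_val t)).
Proof.
move=> cF t U /(cF _ (set_valP t)); rewrite nbhsE => -[B [oB Bt] BU].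
have nB : nbhs t ((set_val : A -> X) @^-1` B).
  apply: (@initial_continuous A X set_val t B).
  by apply: open_nbhs_nbhs; split.
apply: (@filterS _ (nbhs t) _ _ _ _ nB) => s Bs.
by apply: BU => //; exact: set_valP.
Qed.

End Extension.

Section DefsChains.
Variables (R : realType) (X : normedModType R) (A : set X).

(** A simplex of dimension [n] has [n.+1] vertices, whence the shift of index; it is extended by 0,
    in agreement with [restr]. *)
Definition unf n (s : singular_simplex R n A) : 'rV[R]_n.+1 -> X :=
  @extend R 'rV[R]_n.+1 X (std_simplex R n) (fun t => set_val (s t)).

Lemma unf_in n (s : singular_simplex R n A) : simplex_in A (unf s).
Proof.
split.
- apply/funext => t; rewrite /restr /unf; case: ifPn => // tD; rewrite /extend.
  by case: pselect => // Dt; move: tD; rewrite mem_set.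
- apply: cont_on_extend => t; apply: continuous_comp; first exact: cts_fun.
  exact: initial_continuous.
- by move=> t Dt; rewrite /unf (extend_in _ Dt); exact: set_valP.
Qed.

Lemma unf_inj n : injective (@unf n).
Proof.
move=> s t st; apply/continuousEP => x; apply/val_inj.
have := congr1 (fun g => g (set_val x)) st.
by rewrite /unf !extend_val.
Qed.

Lemma unf_surj n (g : 'rV[R]_n.+1 -> X) : simplex_in A g -> exists s : singular_simplex R n A, unf s = g.
Proof.
move=> [rg cg gA].
pose f (t : std_simplex R n) : A := exist _ (g (set_val t)) (mem_set (gA _ (set_valP t))).
have cf : continuous f.
  apply: continuous_comp_initial; exact: (continuous_val cg).
exists (mkcts cf); rewrite -rg; apply/funext => t; rewrite /restr /unf /extend.
case: pselect => Dt; first by rewrite mem_set.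
by case: ifPn => // /set_mem.
Qed.

Definition unchain n (c : chain R n A) : SC int X n.+1 := fglift (fun s => << unf s >>) c.

HB.instance Definition _ n := GRing.Linear.copy (@unchain n)
  (fglift (fun s => << unf s >>)).

Lemma unchainU n s : @unchain n << s >> = << unf s >>.
Proof. exact: fgliftU1. Qed.

Lemma cin_unchain n (c : chain R n A) : cin A (unchain c).
Proof.
apply: (supported_lift (P := fun=> True)) => // s _; apply: supportedU1; exact: unf_in.
Qed.

Lemma unchain_inj n (c : chain R n A) : unchain c = 0 -> c = 0.
Proof.
move=> c0; apply/eqP/freeg_eqP => s; have := congr1 (coeff (unf s)) c0.
rewrite !coeff0 => <-; rewrite -{2}(freeg_sumE c) linear_sum raddf_sum /=.
rewrite -{1}(freeg_sumE c) raddf_sum /=; apply: eq_bigr => t _.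
rewrite freegUZ linearZ /= unchainU !coeffZ !coeffU.
by rewrite (inj_eq (@unf_inj n)).
Qed.

Lemma unchain_surj n (c : SC int X n.+1) : cin A c -> exists d : chain R n A, unchain d = c.
Proof.
move=> Ac; rewrite -(freeg_sumE c) big_seq.
apply: (big_ind (fun c => exists d, unchain d = c)).
- by exists 0; rewrite linear0.
- by move=> _ _ [d <-] [d' <-]; exists (d + d'); rewrite linearD.
- move=> g /Ac /unf_surj[s sg]; exists (coeff g c *: << s >>).
  by rewrite linearZ /= unchainU (freegUZ (coeff g c) g) sg.
Qed.

Lemma face_rowE n (i : 'I_n.+2) (t : 'rV[R]_n.+1) : face_row i t = fc i t.
Proof.
apply/rowP => j; rewrite mxE /fc /comb summxE.
case: (unliftP i j) => [k ->|->].
  rewrite (bigD1 k) //= big1 ?addr0 => [|l lk]; rewrite !mxE eqxx ?eqxx ?mulr1 //=.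
  by rewrite (inj_eq (@lift_inj _ i)) eq_sym (negbTE lk) mulr0.
by rewrite big1 // => k _; rewrite !mxE eqxx /= eq_liftF mulr0.
Qed.

Lemma unchain_boundary n (c : chain R n.+1 A) : unchain (boundary c) = bdS (unchain c).
Proof.
apply: (@int_additive_eq _ _ (@unchain n \o @boundary R n A) (@bdS R int X n.+1 \o @unchain n.+1)).
move=> s /=; rewrite /boundary fgliftU1 unchainU bdSU linear_sum.
apply: eq_bigr => i _ /=; rewrite freegUZ linearZ /= unchainU.
congr (_ *: << _ >>); apply/funext => t; rewrite /faceS /restr; case: ifPn => [|nDt].
  move=> /set_mem Dt; rewrite /unf (extend_in _ Dt) /=.
  have Dft : Delta R n.+2 (fc i t) by exact: fc_Delta.
  rewrite (extend_in _ Dft); congr (set_val (s _)); apply/val_inj => /=.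
  exact: face_rowE.
by rewrite /unf /extend; case: pselect => // Dt; move: nDt; rewrite mem_set.
Qed.

Lemma unchain_push n (h : continuousType A A) (c : chain R n A) :
  unchain (push_chain h c) = push (extend (fun x : A => set_val (h x))) (unchain c).
Proof.
apply: (@int_additive_eq _ _ (@unchain n \o @push_chain R n A A h)
  (push (extend (fun x : A => set_val (h x))) \o @unchain n)) => s /=.
rewrite /push_chain fgliftU1 !unchainU pushU; congr << _ >>; apply/funext => t.
rewrite /restr; case: ifPn => [/set_mem Dt|nDt].
  by rewrite /= /unf !(extend_in _ Dt) /= extend_val.
by rewrite /unf /extend; case: pselect => // Dt; move: nDt; rewrite mem_set.
Qed.

Lemma acts_on_homology_bounds n (h : continuousType A A) (d : int) (c : SC int X n.+2) :
  acts_on_homology_by R n h d -> cin A c -> bdS c = 0 ->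
  bounds A (push (extend (fun x : A => set_val (h x))) c - d *: c).
Proof.
move=> hd Ac c0; have [b bE] := unchain_surj Ac.
have [w wE] : exists w : chain R n.+2 A, push_chain h b - b *~ d = boundary w.
  (* Injectivity of [unchain] turns the vanishing boundary of [c] into that of [b]. *)
  by apply: hd; apply: unchain_inj; rewrite unchain_boundary bE.
exists (unchain w); first exact: cin_unchain.
rewrite -unchain_boundary -wE linearB /= unchain_push bE raddfMz /= bE.
by rewrite -scaler_int intz.
Qed.

End DefsChains.

(** * Pairs of distinct points of the sphere *)

Section Config.
Variables (R : realType) (K : comNzRingType).
Local Notation V := 'rV[R]_4.

Definition sq (x : V) : R := \sum_i x 0 i ^+ 2.
Definition nrm (x : V) : V := (Num.sqrt (sq x))^-1 *: x.
Definition W4 : set V := [set x | x != 0].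
Local Notation S := (S3 R).

Lemma W4E : W4 = W 4.
Proof.
apply/seteqP; split=> x.
  move=> /eqP x0; apply: contrapT => nW; apply: x0; apply/rowP => i; rewrite mxE.
  apply/eqP; apply: contrapT => /negP xi; apply: nW; exists (i : nat); first exact: ltn_ord.
  by rewrite inord_val.
move=> [i _ xi]; apply: contraNneq xi => ->; by rewrite mxE.
Qed.

Lemma sq_ge0 x : 0 <= sq x.
Proof. by apply: sumr_ge0 => i _; exact: sqr_ge0. Qed.

Lemma sq_eq0 x : (sq x == 0) = (x == 0).
Proof.
apply/idP/eqP => [|->]; last by rewrite /sq big1 // => i _; rewrite mxE expr0n.
rewrite psumr_eq0 => [/allP x0|i _]; last exact: sqr_ge0.
apply/rowP => i; rewrite mxE; apply/eqP; rewrite -sqrf_eq0.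
by have /implyP := x0 i (mem_index_enum i); apply.
Qed.

Lemma sq_gt0 x : x != 0 -> 0 < sq x.
Proof. by move=> x0; rewrite lt_neqAle sq_ge0 andbT eq_sym sq_eq0. Qed.

Lemma sqZ a x : sq (a *: x) = a ^+ 2 * sq x.
Proof. by rewrite /sq mulr_sumr; apply: eq_bigr => i _; rewrite mxE exprMn. Qed.

Lemma S3E x : S x = (sq x = 1). Proof. by []. Qed.

Lemma S3_W4 x : S x -> W4 x.
Proof. by rewrite S3E /W4 /= -sq_eq0 => ->; exact: oner_neq0. Qed.

Lemma nrm_S3 x : W4 x -> S (nrm x).
Proof.
move=> /sq_gt0 x0; rewrite S3E sqZ exprVn sqr_sqrtr ?sq_ge0 // mulVf //.
by rewrite gt_eqF.
Qed.

Lemma nrm_id x : S x -> nrm x = x.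
Proof. by rewrite S3E /nrm => ->; rewrite sqrtr1 invr1 scale1r. Qed.

Lemma nrmN x : nrm (- x) = - nrm x.
Proof. by rewrite /nrm -scaleN1r sqZ sqrrN expr1n mul1r scaleN1r scalerN. Qed.

Lemma nrm_pos x : W4 x -> 0 < (Num.sqrt (sq x))^-1.
Proof. by move=> /sq_gt0 x0; rewrite invr_gt0 sqrtr_gt0. Qed.

Lemma nrm_W4 x : W4 x -> W4 (nrm x).
Proof. by move=> /nrm_S3/S3_W4. Qed.

Lemma sq_continuous : continuous (sq : V -> R^o).
Proof.
suff H (r : seq 'I_4) : @cont_on R V R^o setT (fun x : V => \sum_(i <- r) x 0 i ^+ 2).
  move=> x U /(H _ x I) xU; apply: (@filterS _ (nbhs x) _ _ _ _ xU) => y; exact.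
elim: r => [|i r IH].
  by apply: (@eq_cont_on R V R^o _ (fun=> 0)) => [x _|]; [rewrite big_nil|exact: cont_on_cst].
apply: (@eq_cont_on R V R^o _ (fun x : V =>
  (x 0 i : R) *: (x 0 i : R^o) + ((\sum_(j <- r) x 0 j ^+ 2) : R^o))).
  by move=> x _; rewrite big_cons expr2.
have cx : @cont_on R V R^o setT (fun x : V => x 0 i).
  by apply: cont_on_continuous; exact: coord_continuous.
by apply: cont_onD IH; exact: cont_onZ.
Qed.

Lemma nrm_cont : cont_on W4 nrm.
Proof.
apply: (@cont_onZ R V V W4 (fun x => (Num.sqrt (sq x))^-1 : R^o) id); last exact: cont_on_id.
apply: continuous_cont_on => x Wx.
have s0 : Num.sqrt (sq x) != 0 by rewrite sqrtr_eq0 -ltNge sq_gt0.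
apply: (@cvgV R V (nbhs x) _ (fun x => Num.sqrt (sq x)) _ s0).
apply: (@continuous_comp _ _ _ (sq : V -> R^o) (@Num.sqrt R)); first exact: sq_continuous.
exact: sqrt_continuous.
Qed.

Definition Conf : set (V * V)%type := [set p | [/\ S p.1, S p.2 & p.1 != p.2]].
Definition antidiag (u : V) : (V * V)%type := (nrm u, - nrm u).
Definition diff (p : (V * V)%type) : V := p.1 - p.2.

Lemma SN x : S x -> S (- x).
Proof. by rewrite !S3E -scaleN1r sqZ sqrrN expr1n mul1r. Qed.

Lemma antidiag_Conf u : W4 u -> Conf (antidiag u).
Proof.
move=> Wu; split; rewrite /=; [exact: nrm_S3|by apply: SN; exact: nrm_S3|].
rewrite -subr_eq0 opprK -mulr2n -scaler_nat scaler_eq0 pnatr_eq0 /=.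
exact: nrm_W4.
Qed.

Lemma diff_W4 p : Conf p -> W4 (diff p).
Proof. by move=> [_ _ xy]; rewrite /W4 /= subr_eq0. Qed.

Lemma Conf_sub_W4 x y t : Conf (x, y) -> 0 <= t <= 1 -> W4 (x - t *: y).
Proof.
move=> [/= Sx Sy xy] /andP[t0 t1]; rewrite /W4 /= subr_eq0; apply: contraNneq xy => xE.
move: Sx; rewrite S3E xE sqZ (Sy : sq y = 1) mulr1 => /eqP; rewrite sqrf_eq1.
by case/orP => /eqP tE; [rewrite tE scale1r|move: t0; rewrite tE oppr_ge0 ler10].
Qed.

Lemma Conf_swap x y : Conf (x, y) -> Conf (y, x).
Proof. by move=> [Sx Sy xy]; split; rewrite //= eq_sym. Qed.

(* Deforms a pair of distinct points to an antipodal one. *)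
Definition Cpull (q : ((V * V) * R^o)%type) : (V * V)%type :=
  (nrm (q.1.1 - (q.2 : R) *: q.1.2), nrm (q.1.2 - (q.2 : R) *: q.1.1)).

(** Equal lengths let both components of [Cpull] be normalised by one factor, so that distinct
    points remain distinct. *)
Lemma sq_sub x y t : S x -> S y -> sq (x - t *: y) = sq (y - t *: x).
Proof.
move=> Sx Sy.
have E u v : sq (u - t *: v) = sq u - (\sum_i u 0 i * v 0 i) * (2 * t) + t ^+ 2 * sq v.
  rewrite /sq mulr_suml mulr_sumr -sumrN -!big_split; apply: eq_bigr => i _ /=.
  by rewrite !mxE; ring.
rewrite !E (Sx : sq x = 1) (Sy : sq y = 1); congr (_ - _ * _ + _).
by apply: eq_bigr => i _; rewrite mulrC.
Qed.

Lemma Cpull_Conf q : cylinder Conf q -> Conf (Cpull q).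
Proof.
move: q => [[x y] t] [/= cxy t01]; have [/= Sx Sy xy] := cxy.
have Wx := Conf_sub_W4 cxy t01; have Wy := Conf_sub_W4 (Conf_swap cxy) t01.
split; rewrite /=; try exact: nrm_S3.
rewrite /nrm (sq_sub t Sx Sy) -subr_eq0 -scalerBr scaler_eq0 negb_or.
rewrite (gt_eqF (nrm_pos Wy)) /=.
have -> : x - t *: y - (y - t *: x) = (1 + t) *: (x - y).
  by apply/rowP => i; rewrite !mxE; ring.
rewrite scaler_eq0 negb_or subr_eq0 xy andbT gt_eqF //.
by case/andP: t01 => t0 _; rewrite ltr_pwDl.
Qed.

Lemma sub_cont (A : set ((V * V) * R^o)%type) :
  cont_on A (fun q => q.1.1 - (q.2 : R) *: q.1.2) /\
  cont_on A (fun q => q.1.2 - (q.2 : R) *: q.1.1).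
Proof.
have c11 : cont_on A (fun q => q.1.1).
  exact: (cont_on_comp (cont_on_fst (A := A)) (cont_on_fst (A := setT))).
have c12 : cont_on A (fun q => q.1.2).
  exact: (cont_on_comp (cont_on_fst (A := A)) (cont_on_snd (A := setT))).
have c2 : cont_on A (fun q => q.2) by exact: cont_on_snd.
by split; apply: cont_onB => //; apply: cont_onZ.
Qed.

Lemma Cpull_cont : cont_on (cylinder Conf) Cpull.
Proof.
have [c1 c2] := sub_cont (cylinder Conf).
apply: cont_on_pair.
  apply: (cont_on_comp c1 nrm_cont) => -[[x y] t] [/= cxy t01].
  exact: Conf_sub_W4 t01.
apply: (cont_on_comp c2 nrm_cont) => -[[x y] t] [/= cxy t01].
by apply: Conf_sub_W4 t01; exact: Conf_swap.
Qed.

Lemma diff_cont A : cont_on A diff.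
Proof. by apply: cont_onB; [exact: cont_on_fst|exact: cont_on_snd]. Qed.

Lemma antidiag_cont : cont_on W4 antidiag.
Proof. by apply: cont_on_pair; [exact: nrm_cont|apply: cont_onN; exact: nrm_cont]. Qed.

(** [Cpull] deforms [Conf] onto the antidiagonal, a copy of the 3-sphere, where cycles of dimension
    at most 2 bound. *)
Lemma Conf_bounds n (c : SC K (V * V)%type n.+1) : (n.+1 < 4)%N -> cin Conf c -> bdS c = 0 ->
  bounds Conf c.
Proof.
move=> n4 Cc c0.
have E0 : push (fun p => Cpull (p, 0)) c = c.
  apply: push_id Cc => -[x y] [/= Sx Sy _].
  by rewrite /Cpull /= !scale0r !subr0 !nrm_id.
have E1 : push (fun p => Cpull (p, 1)) c = push antidiag (push diff c).
  rewrite push_comp; apply: eq_push Cc => -[x y] [/= Sx Sy _].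
  by rewrite /Cpull /antidiag /diff /= !scale1r -nrmN opprB.
have H1 : bounds Conf (push antidiag (push diff c)).
  apply: bounds_push antidiag_cont antidiag_Conf _.
  rewrite W4E; apply: W_vanish; rewrite ?n4 //= -?W4E.
    exact: cin_push (@diff_cont Conf) diff_W4 Cc.
  by rewrite bd_push c0 linear0.
have := bounds_hom Cpull_cont Cpull_Conf Cc c0.
by rewrite E1 E0 => /boundsN; rewrite opprB => /boundsD /(_ H1); rewrite subrK.
Qed.

(* A quarter turn without fixed lines; its square is the antipodal map, which is
   therefore homotopic to the identity. *)
Definition rotv (i : 'I_4) : V :=
  if odd i then - vtx R (inord i.-1) else vtx R (inord i.+1).
Definition rot : V -> V := comb rotv.

Lemma rot_rot x : rot (rot x) = - x.
Proof.
rewrite /rot comb_comb -[in RHS](comb_vtx x) -scaleN1r.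
have -> : -1 *: comb (@vtx R 4) x = comb (fun i => - vtx R i) x.
  rewrite /comb scaler_sumr; apply: eq_bigr => i _; by rewrite scaleN1r scalerN.
congr (comb _ x); apply/funext => i /=; rewrite {2}/rotv.
have iN := ltn_ord i.
case: ifPn => oi.
  rewrite linearN /= comb_at_vtx /rotv inordK; last by rewrite (leq_ltn_trans (leq_pred i)).
  have i0 : (0 < i)%N by case: (i : nat) oi.
  have -> : odd i.-1 = false by rewrite -subn1 oddB // oi.
  by rewrite prednK // inord_val.
have i3 : (i.+1 < 4)%N.
  by move: oi iN; case: (i : nat) => [|[|[|[|]]]].
by rewrite comb_at_vtx /rotv inordK //= oi inord_val.
Qed.

Lemma rot_W4 x s : W4 x -> W4 ((1 - s) *: x + s *: rot x).
Proof.
move=> x0; apply: contraNneq x0 => E.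
(* Applying [rot] to [E] gives a second relation; together they annihilate [x] times (1 - s)^2 +
   s^2, which is positive. *)
have E2 : (1 - s) *: rot x - s *: x = 0.
  by rewrite -(linear0 (comb rotv)) -E linearD !linearZ /= -/(rot _) -/(rot _) rot_rot scalerN.
have : ((1 - s) ^+ 2 + s ^+ 2) *: x = 0.
  transitivity ((1 - s) *: ((1 - s) *: x + s *: rot x) - s *: ((1 - s) *: rot x - s *: x)).
    by apply/rowP => i; rewrite !mxE; ring.
  by rewrite E E2 !scaler0 subr0.
move=> /eqP; rewrite scaler_eq0 => /orP[|//]; rewrite gt_eqF //.
have -> : (1 - s) ^+ 2 + s ^+ 2 = ((1 - 2 * s) ^+ 2 + 1) / 2 by field.
by rewrite divr_gt0 // ltr_wpDl // sqr_ge0.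
Qed.

Lemma bounds_rot n (c : SC K V n.+1) : cin W4 c -> bdS c = 0 ->
  bounds W4 (push rot c - c).
Proof.
move=> Wc c0.
pose F (q : (V * R^o)%type) : V := (1 - q.2 : R) *: q.1 + (q.2 : R) *: rot q.1.
have cF : cont_on (cylinder W4) F.
  have c1 : cont_on (cylinder W4) fst by exact: cont_on_fst.
  have c2 : cont_on (cylinder W4) snd by exact: cont_on_snd.
  apply: cont_onD; apply: cont_onZ => //.
    by apply: cont_onB => //; exact: cont_on_cst.
  exact: (cont_on_compT (@comb_continuous R V 4 rotv) c1).
have := bounds_hom cF (B := W4) _ Wc c0.
have -> : push (fun x => F (x, 1)) c = push rot c.
  by apply: eq_push Wc => x _; rewrite /F /= subrr scale0r add0r scale1r.
have -> : push (fun x => F (x, 0)) c = c.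
  by apply: push_id Wc => x _; rewrite /F /= subr0 scale0r addr0 scale1r.
by apply; move=> [x s] [/= Wx _]; exact: rot_W4.
Qed.

Lemma bounds_opp n (c : SC K V n.+1) : cin W4 c -> bdS c = 0 ->
  bounds W4 (push -%R c - c).
Proof.
move=> Wc c0.
have Wr : cin W4 (push rot c).
  apply: (cin_push _ _ Wc) => [|x Wx].
    by apply: cont_on_continuous; exact: comb_continuous.
  by have := rot_W4 1 Wx; rewrite subrr scale0r add0r scale1r.
have r0 : bdS (push rot c) = 0 by rewrite bd_push c0 linear0.
have -> : push -%R c = push rot (push rot c).
  by rewrite push_comp; apply: eq_push Wc => x _ /=; rewrite rot_rot.
have -> : push rot (push rot c) - c = (push rot (push rot c) - push rot c) + (push rot c - c).
  by rewrite addrA subrK.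
by apply: boundsD; exact: bounds_rot.
Qed.

Lemma bounds_nrm n (c : SC K V n.+1) : cin W4 c -> bdS c = 0 ->
  bounds W4 (push nrm c - c).
Proof.
move=> Wc c0.
pose F (q : (V * R^o)%type) : V := (1 - q.2 : R) *: q.1 + (q.2 : R) *: nrm q.1.
have cF : cont_on (cylinder W4) F.
  have c1 : cont_on (cylinder W4) fst by exact: cont_on_fst.
  have c2 : cont_on (cylinder W4) snd by exact: cont_on_snd.
  apply: cont_onD; apply: cont_onZ => //.
    by apply: cont_onB => //; exact: cont_on_cst.
  by apply: (cont_on_comp c1 nrm_cont) => -[x s] [].
have := bounds_hom cF (B := W4) _ Wc c0.
have -> : push (fun x => F (x, 1)) c = push nrm c.
  by apply: eq_push Wc => x _; rewrite /F /= subrr scale0r add0r scale1r.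
have -> : push (fun x => F (x, 0)) c = c.
  by apply: push_id Wc => x _; rewrite /F /= subr0 scale0r addr0 scale1r.
apply; move=> [x s] [/= Wx /andP[s0 s1]]; rewrite /F /= /nrm scalerA -scalerDl.
rewrite /W4 /= scaler_eq0 negb_or Wx andbT gt_eqF //.
have := nrm_pos Wx; set a := _^-1 => a0.
have [->|sn1] := eqVneq s 1; first by rewrite subrr add0r mul1r.
by rewrite ltr_pwDl ?mulr_ge0 ?(ltW a0) // subr_gt0 lt_neqAle sn1.
Qed.

(** For (x, y) in [Conf] the paths x - t y and y - t x avoid 0, so [fst] is homotopic to [diff] and
    [snd] to its negative; the antipode, homotopic to the identity, links the two. *)
Lemma bounds_fst_snd n (c : SC K (V * V)%type n.+1) : cin Conf c -> bdS c = 0 ->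
  bounds W4 (push fst c - push snd c).
Proof.
move=> Cc c0; have [c1 c2] := sub_cont (cylinder Conf).
have B1 := bounds_hom c1 (B := W4) _ Cc c0.
have B2 := bounds_hom c2 (B := W4) _ Cc c0.
have {}B1 : bounds W4 (push diff c - push fst c).
  have := B1; have -> : push (fun x => (x, 1 : R^o).1.1 - ((x, 1 : R^o).2 : R) *: (x, 1 : R^o).1.2) c = push diff c.
    by apply: eq_push Cc => x _; rewrite /= scale1r.
  have -> : push (fun x => (x, 0 : R^o).1.1 - ((x, 0 : R^o).2 : R) *: (x, 0 : R^o).1.2) c = push fst c.
    by apply: eq_push Cc => x _; rewrite /= scale0r subr0.
  by apply; move=> [[x y] t] [/= cxy t01]; exact: Conf_sub_W4.
have {}B2 : bounds W4 (push -%R (push diff c) - push snd c).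
  have := B2; have -> : push (fun x => (x, 1 : R^o).1.2 - ((x, 1 : R^o).2 : R) *: (x, 1 : R^o).1.1) c = push -%R (push diff c).
    by rewrite push_comp; apply: eq_push Cc => x _; rewrite /= scale1r /diff opprB.
  have -> : push (fun x => (x, 0 : R^o).1.2 - ((x, 0 : R^o).2 : R) *: (x, 0 : R^o).1.1) c = push snd c.
    by apply: eq_push Cc => x _; rewrite /= scale0r subr0.
  apply; move=> [[x y] t] [/= cxy t01]; apply: Conf_sub_W4 => //; exact: Conf_swap.
have Wd : cin W4 (push diff c) by exact: cin_push (@diff_cont Conf) diff_W4 Cc.
have d0 : bdS (push diff c) = 0 by rewrite bd_push c0 linear0.
have B3 := bounds_opp Wd d0.
have -> : push fst c - push snd c = (push -%R (push diff c) - push snd c) -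
   (push diff c - push fst c) - (push -%R (push diff c) - push diff c).
  set a := push fst c; set b := push snd c; set d := push diff c; set e := push -%R d.
  rewrite -addrA -opprD [d - a + _]addrC addrA subrK opprB addrC addrA subrK.
  by [].
by apply: boundsB => //; exact: boundsB.
Qed.

End Config.

Ltac fring := apply/eqP/freeg_eqP => ?;
  rewrite ?(coeffB, coeffD, coeffN, coeffZ, coeff0); ring.

Section PushLinear.
Variables (R : realType) (K : comNzRingType) (X Y : normedModType R) (F : X -> Y) (n : nat).
Implicit Types c d : SC K X n.

Lemma pushD c d : push F (c + d) = push F c + push F d. Proof. exact: linearD. Qed.
Lemma pushN c : push F (- c) = - push F c. Proof. exact: linearN. Qed.
Lemma pushB c d : push F (c - d) = push F c - push F d. Proof. exact: linearB. Qed.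
Lemma pushZ k c : push F (k *: c) = k *: push F c. Proof. exact: linearZ. Qed.

End PushLinear.

Arguments sphere_cycle : simpl never.
Arguments hemisphere : simpl never.

(** * Towers for the swap and the contradiction of degrees *)

Section Parity.
Variables (R : realType) (K : comNzRingType).
Hypothesis K4 : 4%:R = 0 :> K.
Local Notation V := 'rV[R]_4.
Local Notation S := (S3 R).

Definition swap (X : Type) (p : X * X) := (p.2, p.1).

Lemma swap_cont (X : normedModType R) (A : set (X * X)%type) : cont_on A (@swap X).
Proof. by apply: cont_on_pair; [exact: cont_on_snd|exact: cont_on_fst]. Qed.

Lemma cin_swap n (c : SC K (V * V)%type n) : cin (@Conf R) c -> cin (@Conf R) (push (@swap V) c).
Proof.
apply: cin_push; first exact: swap_cont.
by move=> [x y]; exact: Conf_swap.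
Qed.

Lemma swapK n (c : SC K (V * V)%type n) : cin (@Conf R) c ->
  push (@swap V) (push (@swap V) c) = c.
Proof. by move=> Cc; rewrite push_comp; apply: push_id Cc => -[]. Qed.

Notation z := (fun m => rho K (@sphere_cycle R 3 m)).
Notation e := (fun m => rho K (@hemisphere R 3 m)).

Lemma tower4 : suspension_tower z e 4.
Proof. exact: tower_rho. Qed.

Lemma W_sub4 m : (m <= 4)%N -> W m `<=` @W4 R.
Proof. by rewrite W4E => m4 x [i im xi]; exists i => //; exact: leq_trans m4. Qed.

Definition antidiag_hemisphere m : SC K (V * V)%type m := push (@antidiag R) (e m).

Lemma cin_hemisphere m : (m < 4)%N -> cin (@W4 R) (e m.+1).
Proof.
have [_ eU _ _] := tower4 => m4; apply: cinS (eU m m4) => x /Wpos_sub; exact: W_sub4.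
Qed.

Lemma cin_antidiag_hemisphere m : (m < 4)%N -> cin (@Conf R) (antidiag_hemisphere m.+1).
Proof.
move=> m4; exact: cin_push (@antidiag_cont R) (@antidiag_Conf R) (cin_hemisphere m4).
Qed.

(** On the antidiagonal the swap is the antipode, so that the hemispheres of the sphere form a tower
    for the swap. *)
Lemma swap_antidiag_hemisphere m : (m < 4)%N ->
  push (@swap V) (antidiag_hemisphere m.+1) = push (@antidiag R) (push -%R (e m.+1)).
Proof.
move=> m4; rewrite !push_comp; apply: eq_push (cin_hemisphere m4) => x _ /=.
by rewrite /swap /antidiag /= nrmN opprK.
Qed.

Lemma bd_antidiag_hemisphere m : (m.+1 < 4)%N -> bdS (antidiag_hemisphere m.+2) = antidiag_hemisphere m.+1 - (-1) ^+ m *: push (@swap V) (antidiag_hemisphere m.+1).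
Proof.
move=> m4; have [_ _ be zS] := tower4.
by rewrite bd_push be // zS ?(ltnW m4) // linearB linearZ /= swap_antidiag_hemisphere // ltnW.
Qed.

(* The corrections exist because [Conf] is 2-connected. *)
Lemma lift_tower (a : SC K (V * V)%type 1) b c (ep : K) :
  cin (@Conf R) a -> cin (@Conf R) b -> cin (@Conf R) c ->
  bdS a = ep *: << restr (fun=> 0) >> ->
  bdS b = a - push (@swap V) a -> bdS c = b + push (@swap V) b ->
  exists q, [/\ cin (@Conf R) q &
    bdS (ep *: antidiag_hemisphere 4 + (q - push (@swap V) q)) = c - push (@swap V) c].
Proof.
move=> Ca Cb Cc aE bE cE.
set t := fun n => @push R K (V * V)%type (V * V)%type n (@swap V).
have tb n (x : SC K _ n.+1) : bdS (t n.+1 x) = t n (bdS x) by exact: bd_push.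
have tK n (x : SC K _ n) : cin (@Conf R) x -> t n (t n x) = x by exact: swapK.
have tC n (x : SC K _ n) : cin (@Conf R) x -> cin (@Conf R) (t n x) by exact: cin_swap.
have tD n x y : t n (x + y) = t n x + t n y by exact: linearD.
have tB n x y : t n (x - y) = t n x - t n y by exact: linearB.
have tZ n k x : t n (k *: x) = k *: t n x by exact: linearZ.
have [_ _ be _] := tower4.
have j1 : bdS (antidiag_hemisphere 1) = << restr (fun=> 0) >>.
  by rewrite bd_push be //= rhoU pushU; congr << _ >>; exact: eq_simplex0.
have j2 : bdS (antidiag_hemisphere 2) = antidiag_hemisphere 1 - t _ (antidiag_hemisphere 1) by rewrite bd_antidiag_hemisphere // expr0 scale1r.
have j3 : bdS (antidiag_hemisphere 3) = antidiag_hemisphere 2 + t _ (antidiag_hemisphere 2) by rewrite bd_antidiag_hemisphere // expr1 scaleN1r opprK.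
have j4 : bdS (antidiag_hemisphere 4) = antidiag_hemisphere 3 - t _ (antidiag_hemisphere 3) by rewrite bd_antidiag_hemisphere // sqrrN expr1n scale1r.
have C1 := @cin_antidiag_hemisphere 0 isT; have C2 := @cin_antidiag_hemisphere 1 isT.
have C3 := @cin_antidiag_hemisphere 2 isT; have C4 := @cin_antidiag_hemisphere 3 isT.
(* At each stage [ep] times a hemisphere and the previous correction, made symmetric or
   antisymmetric, are subtracted; what is left is closed and bounds the next correction. *)
have [u Cu uE] : bounds (@Conf R) (a - ep *: antidiag_hemisphere 1).
  apply: Conf_bounds => //; first by apply: supportedB => //; exact: supportedZ.
  by rewrite linearB linearZ /= aE j1 subrr.
have [v Cv vE] : bounds (@Conf R) (b - (u - t _ u) - ep *: antidiag_hemisphere 2).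
  apply: Conf_bounds => //.
    apply: supportedB; last exact: supportedZ.
    by apply: supportedB => //; apply: supportedB => //; exact: tC.
  by rewrite !linearB linearZ /= tb uE bE j2 tB tZ -/(t _ _); fring.
have [q Cq qE] : bounds (@Conf R) (c - (v + t _ v) - ep *: antidiag_hemisphere 3).
  apply: Conf_bounds => //.
    apply: supportedB; last exact: supportedZ.
    by apply: supportedB => //; apply: supportedD => //; exact: tC.
  rewrite !linearB linearD linearZ /= tb vE cE j3 !tB tZ tK // -/(t _ _); fring.
exists q; split => //; rewrite -/(t _ _).
rewrite linearD linearB linearZ /= tb qE j4 !tB tZ tD tK //; fring.
Qed.

Definition pmap (X Y : Type) (F : X -> Y) (p : X * X) : Y * Y := (F p.1, F p.2).

(* The ambiguity [q] enters [push fst w - push snd w] with coefficient 2. *)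
Lemma double_fst (q : SC K (V * V)%type 4) (ep : K) : ep *+ 2 = 2%:R ->
  cin (@Conf R) q ->
  let w := ep *: antidiag_hemisphere 4 + (q - push (@swap V) q) in
  2%:R *: (push fst w - push snd w) = 2%:R *: push (@nrm R) (z 4%N).
Proof.
move=> ep2 Cq w.
have sndE n (x : SC K (V * V)%type n) : push snd x = push fst (push (@swap V) x).
  by rewrite push_comp.
have C4 := @cin_antidiag_hemisphere 3 isT.
have [_ _ _ zS] := tower4.
have fjE : push fst (antidiag_hemisphere 4) = push (@nrm R) (e 4%N) by rewrite push_comp.
have fsjE : push fst (push (@swap V) (antidiag_hemisphere 4)) = push (@nrm R) (push -%R (e 4%N)).
  by rewrite swap_antidiag_hemisphere // push_comp.
rewrite sndE /w !(pushD, pushN, pushZ) swapK // fjE fsjE.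
rewrite zS // !exprS expr0 mulr1 mulrNN mulr1 mulN1r scaleN1r opprK pushD.
set x := push (@nrm R) (e 4%N); set y := push (@nrm R) (push _ _).
set r := push fst q; set s := push fst (push _ q).
have -> : 2%:R *: (ep *: x + (r - s) - (ep *: y + (s - r))) =
   (ep *+ 2) *: x - (ep *+ 2) *: y + 4%:R *: (r - s) by fring.
rewrite ep2 K4 scale0r addr0.
(* The fundamental cycle is the sum of a hemisphere and its antipode, while the projections yield
   their difference; once doubled, the two agree modulo 4. *)
have -> : 2%:R *: (x + y) = 2%:R *: x - 2%:R *: y + 4%:R *: y by fring.
by rewrite K4 scale0r addr0.
Qed.

Hypothesis K2 : 2%:R != 0 :> K.
Variable H : V -> V.
Hypothesis H_cont : cont_on S H.
Hypothesis H_S3 : forall x, S x -> S (H x).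
Hypothesis H_inj : forall x y, S x -> S y -> H x = H y -> x = y.
Hypothesis H_rev : forall c : SC int V 4, cin S c -> bdS c = 0 ->
  bounds S (push H c - (-1) *: c).

(** [P] joins the cycle to its image, so [r] is closed. As both projections kill [P], comparing them
    on [r] shows that [n] and its image are homologous, while the degree makes the image homologous
    to [- n]. *)
Lemma degree_contradiction (a : SC K (V * V)%type 1) b c (ep : K) P :
  cin (@Conf R) a -> cin (@Conf R) b -> cin (@Conf R) c ->
  bdS a = ep *: << restr (fun=> 0) >> -> ep *+ 2 = 2%:R ->
  bdS b = a - push (@swap V) a -> bdS c = b + push (@swap V) b ->
  push fst (c - push (@swap V) c) = 0 ->
  cin (@Conf R) P -> push fst P = 0 -> push snd P = 0 ->
  bdS P = push (pmap H) (c - push (@swap V) c) - (c - push (@swap V) c) -> False.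
Proof.
move=> Ca Cb Cc aE ep2 bE cE Z1 CP P1 P2 PE.
have [q [Cq]] := lift_tower Ca Cb Cc aE bE cE.
have := double_fst ep2 Cq; set w := _ + _; set Z := c - _ in Z1 PE * => /= N2 wE.
have Cw : cin (@Conf R) w.
  apply: supportedD; first by apply: supportedZ; exact: (@cin_antidiag_hemisphere 3).
  by apply: supportedB => //; exact: cin_swap.
have Z2 : push snd Z = 0.
  have -> : push snd Z = push fst (push (@swap V) Z) by rewrite push_comp.
  have -> : push (@swap V) Z = - Z by rewrite /Z linearB /= swapK // opprB.
  by rewrite linearN /= Z1 oppr0.
set n := push fst w - push snd w in N2.
have cf : cont_on (@Conf R) (fst : V * V -> V) by exact: cont_on_fst.
have cs : cont_on (@Conf R) (snd : V * V -> V) by exact: cont_on_snd.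
have Sn : cin S n.
  apply: supportedB.
    by apply: cin_push cf _ Cw => p [].
  by apply: cin_push cs _ Cw => p [].
have n0 : bdS n = 0 by rewrite linearB /= !bd_push wE Z1 Z2 subrr.
have HH : forall p, Conf p -> Conf (pmap H p).
  move=> [x y] [/= Sx Sy xy]; split; rewrite /=; [exact: H_S3|exact: H_S3|].
  by apply: contraNneq xy => /(H_inj Sx Sy) ->.
have cHH : cont_on (@Conf R) (pmap H).
  apply: cont_on_pair.
    by apply: (cont_on_comp cf H_cont) => p [].
  by apply: (cont_on_comp cs H_cont) => p [].
pose r := push (pmap H) w - w - P.
have Cr : cin (@Conf R) r.
  apply: supportedB => //; apply: supportedB => //.
  exact: cin_push cHH HH Cw.
have r0 : bdS r = 0 by rewrite !linearB /= bd_push wE PE subrr.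
have S4 : S `<=` @W4 R by exact: S3_W4.
have B1 : bounds (@W4 R) (push H n - n).
  have := bounds_fst_snd Cr r0.
  rewrite /r !pushB P1 P2 !subr0.
  have -> : push fst (push (pmap H) w) = push H (push fst w) by rewrite !push_comp.
  have -> : push snd (push (pmap H) w) = push H (push snd w) by rewrite !push_comp.
  rewrite /n.
  by set x1 := push H _; set x2 := push H _; rewrite (_ : x1 - _ - _ = x1 - x2 - (push fst w - push snd w)) //; fring.
have z4W : cin (@W4 R) (z 4%N) by rewrite W4E; exact: (@cin_z R 3 K z e 4 tower4 4 isT).
have z40 : bdS (z 4%N) = 0 by exact: (@cycle_z R 3 K z e 4 tower4 4 isT).
(* [n] is homologous to a multiple of the fundamental cycle; normalising moves this relation from
   [W4] to the sphere, where [H] is continuous. *)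
have [k B2] : exists k, bounds (@W4 R) (n - k *: z 4%N).
  rewrite W4E; apply: (@W_generator R 3 K z e 4 isT tower4 4 n isT _ n0).
  by rewrite -W4E; exact: cinS S4 Sn.
have nS x : W4 x -> S (nrm x) by exact: nrm_S3.
have {}B2 : bounds S (n - k *: push (@nrm R) (z 4%N)).
  have := bounds_push (@nrm_cont R) nS B2.
  by rewrite pushB pushZ (push_id (@nrm_id R) Sn).
have B3 := bounds_push H_cont H_S3 B2.
(* The degree is known over the integers, so the bounding chain is taken there and then reduced. *)
have B4 : bounds S (push H (push (@nrm R) (z 4%N)) + push (@nrm R) (z 4%N)).
  have zi : cin (@W4 R) (sphere_cycle R 3 4).
    by rewrite W4E; exact: (@cin_z R 3 int _ _ 4 (@tower_int R 3 4 isT) 4 isT).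
  have zi0 : bdS (sphere_cycle R 3 4) = 0 by exact: (@cycle_z R 3 int _ _ 4 (@tower_int R 3 4 isT) 4 isT).
  have [y Sy yE] : bounds S (push H (push (@nrm R) (sphere_cycle R 3 4)) - (-1) *: push (@nrm R) (sphere_cycle R 3 4)).
    by apply: H_rev; [exact: cin_push (@nrm_cont R) nS zi|rewrite bd_push zi0 linear0].
  exists (rho K y); first exact: cin_rho.
  by rewrite bd_rho yE raddfB /= rhoZ -!push_rho rmorphN1 scaleN1r opprK.
have {B3}B5 : bounds (@W4 R) (push H n + n).
  have := boundsD (boundsD B3 (boundsZ k B4)) B2.
  rewrite pushB pushZ => /(boundsS S4).
  by set x1 := push H n; set x2 := push H _; rewrite (_ : _ + _ = x1 + n) //; fring.
have {B1}B6 : bounds (@W4 R) (2%:R *: z 4%N).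
  have B7 : bounds (@W4 R) (2%:R *: push (@nrm R) (z 4%N)).
    rewrite -N2; have := boundsB B5 B1.
    by set x1 := push H n; rewrite (_ : _ - _ = 2%:R *: n) //; fring.
  have := boundsB B7 (boundsZ 2%:R (bounds_nrm z4W z40)).
  by set x1 := push _ _; rewrite (_ : _ - _ = 2%:R *: z 4%N) //; fring.
move: B6; rewrite W4E => /(@W_nontrivial R 3 K z e 4 tower4 4 _ isT) H2.
by move/eqP: K2; apply; exact: H2.
Qed.

End Parity.

(** * Self-homeomorphisms of a cubic graph *)

Section GraphMaps.
Variables (R : realType) (n : nat) (ed : rel 'I_n).
Hypotheses (ed_sym : symmetric ed) (ed_irr : irreflexive ed).
Local Notation V := 'rV[R]_n.
Local Notation G := (realization R n ed).

Definition seg (i j : 'I_n) : set V :=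
  [set t | Delta R n t /\ forall k, t 0 k != 0 -> (k == i) || (k == j)].

Definition arc (i j : 'I_n) (s : R) : V := (1 - s) *: vtx R i + s *: vtx R j.

Lemma GP x : G x <-> exists i j, ((i == j) || ed i j) /\ seg i j x.
Proof.
split=> [[x0 x1 [i [j [ij xij]]]]|[i [j [ij [[x0 x1] xij]]]]].
  by exists i, j; split=> //; split.
by split=> //; exists i, j.
Qed.

Lemma arcE i j s k : arc i j s 0 k = (1 - s) * (k == i)%:R + s * (k == j)%:R.
Proof. by rewrite !mxE eqxx. Qed.

Lemma arc0 i j : arc i j 0 = vtx R i.
Proof. by rewrite /arc subr0 scale1r scale0r addr0. Qed.

Lemma arc1 i j : arc i j 1 = vtx R j.
Proof. by rewrite /arc subrr scale1r scale0r add0r. Qed.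

Lemma arc_seg i j s : 0 <= s <= 1 -> seg i j (arc i j s).
Proof.
move=> /andP[s0 s1]; split; last first.
  move=> k; rewrite arcE; case: (k == i); case: (k == j) => //=.
  by rewrite !mulr0 addr0 eqxx.
split=> [k|]; first by rewrite arcE addr_ge0 // mulr_ge0 ?subr_ge0 ?ler0n.
under eq_bigr do rewrite arcE.
rewrite big_split /= -!mulr_sumr.
have sum1 l : \sum_(k < n) (k == l)%:R = 1 :> R.
  by rewrite (bigD1 l) //= eqxx big1 ?addr0 // => k /negbTE ->.
by rewrite !sum1 !mulr1 subrK.
Qed.

Lemma seg_sum i j x : i != j -> seg i j x -> x 0 i + x 0 j = 1.
Proof.
move=> ij [[x0 x1] xij]; rewrite -x1 (bigD1 i) //= (bigD1 j) 1?eq_sym //=.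
rewrite big1 ?addr0 // => k /andP[ki kj]; apply/eqP/negPn/negP => /xij.
by rewrite (negbTE ki) (negbTE kj).
Qed.

Lemma seg_arc i j x : i != j -> seg i j x -> x = arc i j (x 0 j).
Proof.
move=> ij xs; have xsum := seg_sum ij xs; have [[x0 x1] xij] := xs.
have x1E : 1 - x 0 j = x 0 i by rewrite -xsum addrK.
apply/rowP => k; rewrite arcE x1E.
have [->|ki] := eqVneq k i; first by rewrite (negbTE ij) mulr1 mulr0 addr0.
have [->|kj] := eqVneq k j; first by rewrite mulr1 mulr0 add0r.
rewrite !mulr0 addr0; apply/eqP/negPn/negP => /xij.
by rewrite (negbTE ki) (negbTE kj).
Qed.

Lemma seg_ge0 i j x k : seg i j x -> 0 <= x 0 k.
Proof. by move=> [[]]. Qed.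

Lemma seg_ends i j x a b : seg i j x -> a != b -> x 0 a != 0 -> x 0 b != 0 ->
  (a = i /\ b = j) \/ (a = j /\ b = i).
Proof.
move=> [_ xij] ab /xij ha /xij hb.
case/orP: ha => /eqP ae; case/orP: hb => /eqP be; subst; rewrite ?eqxx // in ab *.
  by left.
by right.
Qed.

Lemma segC i j x : seg i j x -> seg j i x.
Proof. by move=> [? H]; split=> // k /H; rewrite orbC. Qed.

(** Two nonzero coordinates, an open condition, place a point in the interior of one edge; this
    replaces charts of the graph. *)
Lemma G_pair x a b : G x -> a != b -> x 0 a != 0 -> x 0 b != 0 -> ed a b /\ seg a b x.
Proof.
move=> /GP[i [j [ij xs]]] ab xa xb.
have [[? ?]|[? ?]] := seg_ends xs ab xa xb; subst a b.
  by rewrite (negbTE ab) in ij.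
by rewrite eq_sym (negbTE ab) /= in ij; rewrite ed_sym; split=> //; exact: segC.
Qed.

Lemma seg_vtx i x : seg i i x -> x = vtx R i.
Proof.
move=> [[x0 x1] xi].
have x0k k : k != i -> x 0 k = 0.
  by move=> ki; apply/eqP/negPn/negP => /xi; rewrite orbb (negbTE ki).
have xi1 : x 0 i = 1 by rewrite -x1 (bigD1 i) //= big1 ?addr0 // => k /x0k.
apply/rowP => k; rewrite mxE eqxx /=; have [->|/x0k ->] := eqVneq k i; rewrite ?xi1 //.
Qed.

Lemma G_cases x : G x -> (exists i, x = vtx R i) \/
  exists a b, [/\ a != b, x 0 a != 0 & x 0 b != 0].
Proof.
move=> /GP[i [j [ij xs]]]; have [ijE|ijN] := eqVneq i j.
  by left; exists i; apply: seg_vtx; rewrite {2}ijE.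
have xE := seg_arc ijN xs; have sE := seg_sum ijN xs.
have [xj|xj] := eqVneq (x 0 j) 0; first by left; exists i; rewrite xE xj arc0.
have [xi|xi] := eqVneq (x 0 i) 0.
  by left; exists j; rewrite xE; move: sE; rewrite xi add0r => ->; rewrite arc1.
by right; exists i, j.
Qed.

Lemma vtx_G i : G (vtx R i).
Proof.
apply/GP; exists i, i; rewrite eqxx; split=> //.
by rewrite -(arc0 i i); apply: arc_seg; rewrite lexx ler01.
Qed.

Lemma arc_G i j s : ed i j -> 0 <= s <= 1 -> G (arc i j s).
Proof. by move=> ij s01; apply/GP; exists i, j; rewrite ij orbT; split=> //; exact: arc_seg. Qed.

Lemma vtx_inj : injective (@vtx R n).
Proof.
move=> i j /rowP /(_ i); rewrite !mxE !eqxx /=; case: eqVneq => // _ /eqP.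
by rewrite oner_eq0.
Qed.

Lemma vtx_pair (i a b : 'I_n) : a != b -> vtx R i 0 a != 0 -> vtx R i 0 b != 0 -> False.
Proof.
rewrite !mxE eqxx /=; have [<-|_] := eqVneq a i; last by rewrite eqxx.
by move=> ab _; rewrite (eq_sym b) (negbTE ab) eqxx.
Qed.

Variable q : V -> V.
Hypothesis q_cont : cont_on G q.
Hypothesis q_G : forall x, G x -> G (q x).
Hypothesis q_inj : forall x y, G x -> G y -> q x = q y -> x = y.

Lemma arc_continuous i j : continuous (arc i j : R^o -> V).
Proof.
have : cont_on (setT : set R^o) (arc i j).
  apply: cont_onD; apply: cont_onZ; try exact: cont_on_cst; last exact: cont_on_id.
  by apply: cont_onB; [exact: cont_on_cst|exact: cont_on_id].
by move=> c x U /(c x I); apply: filterS => y; exact.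
Qed.

Definition unit_itv : set R^o := [set s | 0 <= s <= 1].

Lemma qarc_cont i j : ed i j -> cont_on unit_itv (fun s : R^o => q (arc i j s)).
Proof.
move=> ij; apply: (cont_on_comp (B := G) _ q_cont).
  by apply: cont_on_continuous; exact: arc_continuous.
by move=> s s01; exact: arc_G.
Qed.

Lemma nz_nbhs (x : V) k : x 0 k != 0 -> nbhs x [set y : V | y 0 k != 0].
Proof.
move=> xk; apply: open_nbhs_nbhs; split => //.
apply: (@open_comp _ _ (fun y : V => y 0 k) [set r | r != 0]); last exact: open_neq.
by move=> y _; exact: coord_continuous.
Qed.

(** On an edge the coordinate [i] determines the point. Were its value at the end of the first arc
    between those at the two ends of the second, the second arc would attain it, against
    injectivity. *)
Lemma two_arcs v w w' i j s (p := q (vtx R v)) :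
  ed v w -> ed v w' -> w != w' -> 0 < s <= 1 -> i != j ->
  (forall u r, ed v u -> 0 <= r <= s -> q (arc v u r) 0 i != 0 /\ q (arc v u r) 0 j != 0) ->
  ~ (Num.min (p 0 i) (q (arc v w' s) 0 i) <= q (arc v w s) 0 i <=
     Num.max (p 0 i) (q (arc v w' s) 0 i)).
Proof.
move=> vw vw' ww' /andP[s0 s1] ij nz btw.
pose y (r : R) : R := q (arc v w' r) 0 i.
have cy : {within `[0, s], continuous y}.
  apply/subspace_continuousP => r /=; rewrite in_itv /= => /andP[r0 rs].
  have r01 : unit_itv r by rewrite /unit_itv /= r0 (le_trans rs).
  move=> U Uy.
  have Uq : nbhs (q (arc v w' r)) [set x : V | U (x 0 i)] by exact: coord_continuous.
  have := qarc_cont vw' r01 Uq; apply: filterS => r' /= H; rewrite in_itv /= => /andP[r'0 r's].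
  by apply: H; rewrite /unit_itv /= r'0 (le_trans r's).
have y0 : y 0 = p 0 i by rewrite /y arc0.
have [|r] := @IVT R y 0 s (q (arc v w s) 0 i) (ltW s0) cy.
  by rewrite y0.
rewrite in_itv /= => /andP[r0 rs] yr.
have rG : G (arc v w' r) by apply: arc_G; rewrite ?r0 ?(le_trans rs).
have sG : G (arc v w s) by apply: arc_G; rewrite ?(ltW s0).
have [n1 n2] := nz w' r vw' (introT andP (conj r0 rs)).
have [n3 n4] : q (arc v w s) 0 i != 0 /\ q (arc v w s) 0 j != 0.
  by apply: nz => //; rewrite lexx (ltW s0).
have [_ g1] := G_pair (q_G rG) ij n1 n2; have [_ g2] := G_pair (q_G sG) ij n3 n4.
have e1 : q (arc v w' r) 0 j = q (arc v w s) 0 j.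
  by apply: (addrI (q (arc v w s) 0 i)); rewrite (seg_sum ij g2) -yr (seg_sum ij g1).
have : q (arc v w' r) = q (arc v w s) by rewrite (seg_arc ij g1) e1 -(seg_arc ij g2).
move=> /(q_inj rG sG) /rowP /(_ w); rewrite !arcE eqxx (negbTE ww').
have -> : (w == v) = false by apply/eqP => wv; rewrite wv ed_irr in vw.
by rewrite !mulr0 addr0 add0r mulr1 => /eqP; rewrite eq_sym gt_eqF.
Qed.

Hypothesis ed_deg3 : forall v, exists w1 w2 w3,
  [/\ ed v w1, ed v w2 & ed v w3] /\ [/\ w1 != w2, w1 != w3 & w2 != w3].

(* Near a point interior to an edge the graph is an interval, and two of three arcs issuing from such
   a point must overlap. *)
Lemma q_vtx v : exists i, q (vtx R v) = vtx R i.
Proof.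
have [//|[i [j [ij pi pj]]]] := G_cases (q_G (vtx_G v)); exfalso.
pose N u := [set r : R^o | ed v u -> unit_itv r -> q (arc v u r) 0 i != 0 /\ q (arc v u r) 0 j != 0].
have nN : \forall r \near (0 : R^o), forall u, N u r.
  apply: (@filter_forall _ 'I_n N (nbhs (0 : R^o)) (nbhs_filter _)) => u.
  have [vu|nvu] := boolP (ed v u); last by apply: nearW => r /=; rewrite /N /= (negbTE nvu).
  have u0 : unit_itv 0 by rewrite /unit_itv /= lexx ler01.
  have U : nbhs (q (arc v u 0)) ([set y : V | y 0 i != 0] `&` [set y : V | y 0 j != 0]).
    by rewrite arc0; apply: filterI; exact: nz_nbhs.
  by apply: filterS (qarc_cont vu u0 U) => r H _ r01; exact: H.
have [d /= d0 dN] := (nbhs_ballP _ _).1 nN.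
pose s := Num.min (d / 2) 1.
have s0 : 0 < s by rewrite lt_min divr_gt0 // ltr01.
have s1 : s <= 1 by rewrite ge_min lexx orbT.
have sd : s < d by rewrite (@le_lt_trans _ _ (d / 2)) ?ge_min ?lexx // ltr_pdivrMr // mulr_natr mulr2n ltrDl.
have s01 : 0 < s <= 1 by rewrite s0.
have nz u r : ed v u -> 0 <= r <= s -> q (arc v u r) 0 i != 0 /\ q (arc v u r) 0 j != 0.
  move=> vu /andP[r0 rs]; apply: dN => //; last by rewrite /unit_itv /= r0 (le_trans rs).
  by rewrite -ball_normE /= sub0r normrN ger0_norm // (le_lt_trans rs).
set p := q (vtx R v) in pi pj *.
pose y u := q (arc v u s) 0 i.
(* Any two of the arcs end on opposite sides of [p], which three arcs cannot do. *)
have side w w' : ed v w -> ed v w' -> w != w' -> (p 0 i < y w) = ~~ (p 0 i < y w').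
  suff H w1 w2 : ed v w1 -> ed v w2 -> w1 != w2 -> y w1 <= y w2 ->
      y w1 < p 0 i /\ p 0 i < y w2.
    move=> vw vw' ww'; case: (leP (y w) (y w')) => [yy|/ltW yy].
      by have [h1 ->] := H _ _ vw vw' ww' yy; rewrite ltNge (ltW h1).
    rewrite eq_sym in ww'; have [h1 ->] := H _ _ vw' vw ww' yy.
    by rewrite -leNgt (ltW h1).
  move=> vw vw' ww' yy; rewrite !ltNge; split; apply/negP => hp.
    apply: (two_arcs vw vw' ww' s01 ij nz); rewrite -/p -/(y w1) -/(y w2).
    by rewrite ge_min hp le_max yy orbT.
  rewrite eq_sym in ww'; apply: (two_arcs vw' vw ww' s01 ij nz); rewrite -/p -/(y w1) -/(y w2).
  by rewrite ge_min yy orbT le_max hp.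
have [w1 [w2 [w3 [[v1 v2 v3] [w12 w13 w23]]]]] := ed_deg3 v.
have := side _ _ v1 v2 w12; rewrite (side _ _ v1 v3 w13) (side _ _ v2 v3 w23).
by case: (_ < _).
Qed.

Definition vmap v : 'I_n := xget v [set i | q (vtx R v) = vtx R i].

Lemma vmapE v : q (vtx R v) = vtx R (vmap v).
Proof. by have [i qi] := q_vtx v; exact: (@xgetPex _ v [set i | q (vtx R v) = vtx R i] (ex_intro _ i qi)). Qed.

Lemma vmap_inj : injective vmap.
Proof.
move=> i j ij; apply: vtx_inj; apply: q_inj; try exact: vtx_G.
by rewrite !vmapE ij.
Qed.

(** The vertices are permuted among themselves, so by injectivity no interior point reaches one. *)
Lemma qarc_nvtx i j s : ed i j -> 0 < s < 1 ->
  exists a b, [/\ a != b, q (arc i j s) 0 a != 0 & q (arc i j s) 0 b != 0].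
Proof.
move=> ij /andP[s0 s1].
have s01 : 0 <= s <= 1 by rewrite !ltW.
have aG := arc_G ij s01.
have [[l ql]|//] := G_cases (q_G aG); exfalso.
have [phi phiK Kphi] := injF_bij vmap_inj.
move: ql; rewrite -(Kphi l) -vmapE => /(q_inj aG (vtx_G _)) E.
have ijN : i != j by apply: contraTneq ij => ->; rewrite ed_irr.
apply: (@vtx_pair (phi l) i j ijN); rewrite -E arcE eqxx.
  by rewrite (negbTE ijN) mulr1 mulr0 addr0 subr_eq0 gt_eqF.
by rewrite (eq_sym j) (negbTE ijN) mulr1 mulr0 add0r gt_eqF.
Qed.

(** The edge that contains the image of a moving interior point is locally constant, hence constant
    by connectedness. *)
Lemma qarc_seg i j : ed i j -> exists a b, [/\ a != b, ed a b &
  forall s, 0 < s < 1 -> seg a b (q (arc i j s))].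
Proof.
move=> ij; have h01 : 0 < (2^-1 : R) < 1 by rewrite invr_gt0 ltr0n /= invf_lt1 ?ltr1n ?ltr0n.
have [a [b [ab qa qb]]] := qarc_nvtx ij h01.
have in01 (s : R) : 0 < s < 1 -> unit_itv s by move=> /andP[s0 s1]; rewrite /unit_itv /= !ltW.
have [eab _] := G_pair (q_G (arc_G ij (in01 _ h01))) ab qa qb.
exists a, b; split=> //.
pose P : set R := [set s | q (arc i j s) 0 a != 0 /\ q (arc i j s) 0 b != 0].
have loc (s : R) : 0 < s < 1 -> \forall s' \near s, (0 < s' < 1) /\ (P s' <-> P s).
  move=> s01; have [c [d [cd qc qd]]] := qarc_nvtx ij s01.
  have U : nbhs (q (arc i j s)) ([set y : V | y 0 c != 0] `&` [set y : V | y 0 d != 0]).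
    by apply: filterI; exact: nz_nbhs.
  have sI : s \in `](0 : R), 1[ by rewrite in_itv.
  apply: filterS2 (near_in_itvoo sI) (qarc_cont ij (in01 _ s01) U) => s' s'I H.
  have s'01 : 0 < s' < 1 by move: s'I; rewrite /= in_itv.
  split => //.
  have [/= qc' qd'] := H (in01 _ s'01).
  have [ecd scd] := G_pair (q_G (arc_G ij (in01 _ s01))) cd qc qd.
  have [_ scd'] := G_pair (q_G (arc_G ij (in01 _ s'01))) cd qc' qd'.
  split=> -[h1 h2].
    by have [[? ?]|[? ?]] := seg_ends scd' ab h1 h2; subst a b.
  by have [[? ?]|[? ?]] := seg_ends scd ab h1 h2; subst a b.
have PT : `]0, 1[%classic `&` P = `]0, 1[%classic.
  have cI : connected (`]0, 1[%classic : set R).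
    by apply/connected_intervalP; exact: interval_is_interval.
  apply: cI.
  - by exists 2^-1; split; [rewrite /= in_itv|].
  - exists (`]0, 1[%classic `&` P); last by rewrite [RHS]setIA setIid.
    rewrite openE => s [/=]; rewrite in_itv /= => s01 Ps.
    by apply: filterS (loc s s01) => s' [s'I [_ PP]]; split; [rewrite /= in_itv|exact: PP].
  - exists (~` (`]0, 1[%classic `&` ~` P)).
      apply: open_closedC; rewrite openE => s [/=]; rewrite in_itv /= => s01 Ps.
      by apply: filterS (loc s s01) => s' [s'I [PP _]]; split; [rewrite /= in_itv|move=> /= /PP].
    apply/seteqP; split=> s [sI Ps]; split=> //; first by case.
    by apply: contrapT => nPs; exact: Ps.
move=> s s01; have : (`]0, 1[%classic `&` P) s by rewrite PT /= in_itv.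
move=> [_ [h1 h2]].
by have [_] := G_pair (q_G (arc_G ij (in01 _ s01))) ab h1 h2.
Qed.

Lemma q_edge i j : ed i j -> ed (vmap i) (vmap j) /\
  forall x, seg i j x -> seg (vmap i) (vmap j) (q x).
Proof.
move=> ij; have [a [b [ab eab H]]] := qarc_seg ij.
have ijN : i != j by apply: contraTneq ij => ->; rewrite ed_irr.
(* A coordinate nonzero at an end of the arc stays so at nearby interior parameters, whose images
   lie on the edge from [a] to [b]. *)
have close s : unit_itv s -> forall k, q (arc i j s) 0 k != 0 -> (k == a) || (k == b).
  move=> s01 k /nz_nbhs /(qarc_cont ij s01) nk.
  have [d /= d0 dN] := (nbhs_ballP _ _).1 nk.
  have [s' [s'01 s's]] : exists s' : R, 0 < s' < 1 /\ ball (s : R^o) d s'.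
    have [s0 s1] := andP s01; pose t := Num.min d 1 / 2.
    have m0 : 0 < Num.min d 1 by rewrite lt_min d0 ltr01.
    have md : Num.min d 1 <= d by rewrite ge_min lexx.
    have m1 : Num.min d 1 <= 1 by rewrite ge_min lexx orbT.
    have t0 : 0 < t by rewrite divr_gt0.
    have t1 : t < 1 by rewrite /t; lra.
    have td : t < d by rewrite /t; lra.
    (* [s] is moved towards 1/2 by the proportion [t], hence into the open interval and by less than
       [d]. *)
    exists ((1 - t) * s + t / 2); split; first by apply/andP; split; nra.
    rewrite -ball_normE /= (_ : s - _ = t * (s - 2^-1)); last by field.
    rewrite normrM (ger0_norm (ltW t0)) (le_lt_trans _ td) //.
    rewrite -[leRHS]mulr1 ler_wpM2l ?(ltW t0) // ler_norml; apply/andP; split; lra.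
  have [_] := H s' s'01; apply.
  by apply: dN => //=; case/andP: s'01 => s0 s1; rewrite /unit_itv /= !ltW.
have vab : (vmap i == a) || (vmap i == b).
  apply: (close 0); first by rewrite /unit_itv /= lexx ler01.
  by rewrite arc0 vmapE mxE !eqxx oner_eq0.
have vab' : (vmap j == a) || (vmap j == b).
  apply: (close 1); first by rewrite /unit_itv /= lexx ler01.
  by rewrite arc1 vmapE mxE !eqxx oner_eq0.
have vN : vmap i != vmap j by rewrite (inj_eq vmap_inj).
have E : (vmap i = a /\ vmap j = b) \/ (vmap i = b /\ vmap j = a).
  case/orP: vab vN => /eqP ->; case/orP: vab' => /eqP ->; rewrite ?eqxx //; by [left|right].
split; first by case: E => [[-> ->]|[-> ->]]; rewrite // ed_sym.
move=> x xs; have qab : seg a b (q x).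
  rewrite (seg_arc ijN xs).
  have s01 : unit_itv (x 0 j).
    rewrite /unit_itv /= (seg_ge0 _ xs) -(seg_sum ijN xs) lerDr; exact: seg_ge0 xs.
  split; last exact: close.
  by have [x0 x1 _] := q_G (arc_G ij s01).
by case: E => [[-> ->]|[-> ->]] //; exact: segC.
Qed.

End GraphMaps.

(** * Products of edges *)

Section Cells.
Variables (R : realType) (K : comNzRingType) (N : nat).
Local Notation V := 'rV[R]_N.
Local Notation E := (V * V)%type.
Implicit Types (a b u v : 'I_N).

Definition pt (p : E) : LC K E 1 := << fun=> p >>.
Definition cell0 u v : LC K E 1 := pt (vtx R u, vtx R v).
(** Cells are coned from midpoints, so that reversing an edge, swapping the factors and relabelling
    act on the chains exactly, up to sign, and not merely up to homology. *)
Definition mid a b : V := 2^-1 *: (vtx R a + vtx R b).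

Definition cell1 v a b : LC K E 2 :=
  cone (vtx R v, mid a b) (cell0 v b - cell0 v a).

Definition flip n (c : LC K E n) : LC K E n := pushL (@swap V) c.

HB.instance Definition _ n := GRing.Linear.copy (@flip n) (pushL (@swap V)).

Lemma flipB n (c d : LC K E n) : flip (c - d) = flip c - flip d.
Proof. exact: linearB. Qed.

Lemma flipN n (c : LC K E n) : flip (- c) = - flip c.
Proof. exact: linearN. Qed.

(** The boundary of the oriented product of the edges ab and a'b', with the Leibniz sign in the
    second factor. *)
Definition rim a b a' b' : LC K E 2 :=
  cell1 b a' b' - cell1 a a' b' - flip (cell1 b' a b - cell1 a' a b).

Definition cell2 a b a' b' : LC K E 3 := cone (mid a b, mid a' b') (rim a b a' b').

Lemma midC a b : mid a b = mid b a. Proof. by rewrite /mid addrC. Qed.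

Lemma bd_pt p : bdL (pt p) = << fun=> 0 >>.
Proof.
rewrite /bdL bdU big_ord_recl big_ord0 addr0 expr0 scale1r.
by congr << _ >>; apply/funext => -[].
Qed.

Lemma flip_cell0 u v : flip (cell0 u v) = cell0 v u.
Proof. by rewrite /flip pushLU. Qed.

Lemma flipK n (c : LC K E n) : flip (flip c) = c.
Proof.
rewrite /flip pushL_comp; apply: (@linear_eq _ _ _ (pushL _) idfun) => v /=.
by rewrite pushLU; congr << _ >>; apply/funext => i /=; case: (v i).
Qed.

Lemma bd_flip n (c : LC K E n.+1) : bdL (flip c) = flip (bdL c).
Proof. exact: bd_pushL. Qed.

Lemma bd_cell1 v a b : bdL (cell1 v a b) = cell0 v b - cell0 v a.
Proof. by rewrite bd_cone linearB /= !bd_pt subrr linear0 subr0. Qed.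

Lemma bd_cell2 a b a' b' : bdL (cell2 a b a' b') = rim a b a' b'.
Proof.
rewrite bd_cone [bdL _](_ : _ = 0) ?linear0 ?subr0 ?addr0 //.
rewrite /rim !linearB /= !bd_flip ?linearB /= !bd_cell1 !flipB !flip_cell0.
fring.
Qed.

Lemma cell1C v a b : cell1 v b a = - cell1 v a b.
Proof. by rewrite /cell1 midC -[RHS]linearN /= opprB. Qed.

Lemma cell2C a b a' b' : cell2 b a b' a' = cell2 a b a' b'.
Proof.
rewrite /cell2 (midC b) (midC b'); congr cone.
rewrite /rim (cell1C a a' b') (cell1C b a' b') (cell1C a' a b) (cell1C b' a b).
by rewrite !flipB !flipN; fring.
Qed.

Lemma flip_cell2 a b a' b' : flip (cell2 a b a' b') = - cell2 a' b' a b.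
Proof.
rewrite /flip push_cone -[RHS]linearN /=; congr cone.
rewrite -/(flip _) /rim !flipB !flipK; fring.
Qed.

(** Two sides of the rim project to zero chains, because their ends have the same image; the other
    two have the same projection with opposite signs. *)
Lemma fst_cell2 a b a' b' : pushL fst (cell2 a b a' b') = 0.
Proof.
rewrite push_cone (_ : pushL _ _ = 0) ?linear0 // /rim !linearB /=.
have f1 v u w : pushL fst (cell1 v u w) = 0.
  rewrite push_cone linearB /= !pushLU (_ : _ - _ = 0) ?linear0 //.
  by apply/eqP; rewrite subr_eq0; apply/eqP; congr << _ >>; apply/funext.
have f2 v v' u w : pushL fst (flip (cell1 v u w)) = pushL fst (flip (cell1 v' u w)).
  rewrite /flip !pushL_comp !push_cone; congr cone.
  by rewrite !linearB /= !pushLU.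
by rewrite !f1 subrr (f2 b' a') subrr addr0.
Qed.

Definition relabel (s : 'I_N -> 'I_N) : V -> V := comb (fun i => vtx R (s i)).

HB.instance Definition _ s := GRing.Linear.copy (relabel s) (comb (fun i => vtx R (s i))).

Lemma relabel_vtx s i : relabel s (vtx R i) = vtx R (s i).
Proof. exact: comb_at_vtx. Qed.

Lemma relabel_mid s a b : relabel s (mid a b) = mid (s a) (s b).
Proof. by rewrite /mid linearZ linearD /= !relabel_vtx. Qed.

Lemma relabel_cell0 s u v : pushL (pmap (relabel s)) (cell0 u v) = cell0 (s u) (s v).
Proof.
rewrite pushLU; congr << _ >>; apply/funext => i /=.
by rewrite /pmap /= !relabel_vtx.
Qed.

Lemma relabel_cell1 s v a b : pushL (pmap (relabel s)) (cell1 v a b) = cell1 (s v) (s a) (s b).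
Proof.
by rewrite push_cone linearB /= !relabel_cell0 /pmap /= relabel_vtx relabel_mid.
Qed.

Lemma relabel_flip s n (c : LC K E n) :
  pushL (pmap (relabel s)) (flip c) = flip (pushL (pmap (relabel s)) c).
Proof. by rewrite /flip !pushL_comp. Qed.

Lemma relabel_cell2 s a b a' b' :
  pushL (pmap (relabel s)) (cell2 a b a' b') = cell2 (s a) (s b) (s a') (s b').
Proof.
rewrite push_cone /pmap /= !relabel_mid; congr cone.
by rewrite -/(pmap _) /rim !linearB /= !relabel_flip ?linearB /= !relabel_cell1.
Qed.

Definition box a b a' b' : set E := [set p | seg a b p.1 /\ seg a' b' p.2].

Lemma vtx_segl a b : seg a b (vtx R a).
Proof. by rewrite -(@arc0 R _ a b); apply: arc_seg; rewrite lexx ler01. Qed.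

Lemma vtx_segr a b : seg a b (vtx R b).
Proof. by rewrite -(@arc1 R _ a b); apply: arc_seg; rewrite lexx ler01. Qed.

Lemma mid_seg a b : seg a b (mid a b).
Proof.
have -> : mid a b = arc a b 2^-1.
  by rewrite /mid /arc scalerDr; congr (_ *: _ + _); field.
by apply: arc_seg; rewrite invr_ge0 ler0n invf_le1 ?ler1n ?ltr0n.
Qed.

Lemma cvx_seg a b : cvx (@seg R N a b).
Proof.
move=> m w t Dt ws; split; first by apply: cvx_Delta => // i; case: (ws i).
move=> k; apply: contraNT => kab; apply/eqP; rewrite summxE big1 // => i _.
rewrite mxE; apply/eqP; rewrite mulf_eq0; apply/orP; right; apply: contraNT kab => wk.
by have [_] := ws i; apply.
Qed.

Lemma cvx_box a b a' b' : cvx (box a b a' b').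
Proof.
move=> m w t Dt ws; rewrite comb_pair; split; apply: cvx_seg => // i; by have [] := ws i.
Qed.

Lemma lin_cell0 u v : lin (box u u v v) (cell0 u v).
Proof. by apply: supportedU1 => i; split; apply: vtx_segl. Qed.

Lemma lin_cell1 v a b : lin (box v v a b) (cell1 v a b).
Proof.
apply: lin_cone; first by split; [exact: vtx_segl|exact: mid_seg].
by apply: supportedB; apply: supportedU1 => i; split; rewrite /=;
  [exact: vtx_segl|exact: vtx_segr|exact: vtx_segl|exact: vtx_segl].
Qed.

Lemma seg_sub v a b : (v == a) || (v == b) -> seg v v `<=` @seg R N a b.
Proof.
move=> vab x [Dx H]; split=> // k /H; rewrite orbb => /eqP ->; exact: vab.
Qed.

Lemma lin_cell2 a b a' b' : lin (box a b a' b') (cell2 a b a' b').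
Proof.
have inl v : (v == a) || (v == b) -> lin (box a b a' b') (cell1 v a' b').
  move=> vab; apply: supportedW (@lin_cell1 v a' b') => w ws i.
  by have [h1 h2] := ws i; split=> //; exact: seg_sub h1.
have inr v : (v == a') || (v == b') -> lin (box a b a' b') (flip (cell1 v a b)).
  move=> vab; apply: (lin_push _ (@lin_cell1 v a b)) => p [h1 h2].
  by split=> //=; exact: seg_sub h1.
apply: lin_cone; first by split; exact: mid_seg.
rewrite /rim flipB; apply: supportedB; apply: supportedB.
- by apply: inl; rewrite eqxx orbT.
- by apply: inl; rewrite eqxx.
- by apply: inr; rewrite eqxx orbT.
- by apply: inr; rewrite eqxx.
Qed.

End Cells.

(** * The weighted sum of products of disjoint edges *)

Section Weights.

(** Adjacency on plain numbers, so that the finite checks below run by [vm_compute]; nested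
    conditionals in the weights stop the evaluation early. *)
Definition adjn (i j : nat) : bool :=
  [|| j == i + 1 %[mod 14], ~~ odd i && (j == i + 5 %[mod 14]),
      i == j + 1 %[mod 14] | ~~ odd j && (i == j + 5 %[mod 14])]%N.

Definition disj (a b a' b' : nat) := [&& a != a', a != b', b != a' & b != b'].

Definition near (a b a' b' : nat) := [|| adjn a a', adjn a b', adjn b a' | adjn b b'].

Definition wgt a b a' b' : nat :=
  if adjn a' b' then if adjn a b then if disj a b a' b' then
    (if near a b a' b' then 2 else 1)%N else 0%N else 0%N else 0%N.

(* One of the two orders of each pair of edges, and [full p] both; edges are
   oriented by the parity of the first vertex. *)
Definition half a b a' b' : nat :=
  if odd a then 0%N else if odd a' then 0%N else
  if (a * 14 + b < a' * 14 + b')%N then wgt a b a' b' else 0%N.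

Definition full (p : bool) a b a' b' : nat :=
  if (odd a == p) && (odd a' == p) then wgt a b a' b' else 0%N.

Definition sum14 (f : nat -> nat) : nat := sumn (map f (iota 0 14)).

(* The coefficient 3 stands for -1 modulo 4. *)
Definition trace1 (x : nat -> nat -> nat -> nat -> nat) v a b :=
  (sum14 (fun u => x u v a b + 3 * x v u a b) %% 4)%N.
(** The coefficient of a face with its vertex [v] in the second factor, listed vertex first as after
    a swap. *)
Definition trace2 (x : nat -> nat -> nat -> nat -> nat) v a b :=
  (sum14 (fun u => x a b u v + 3 * x a b v u) %% 4)%N.
Definition trace0 (y : nat -> nat -> nat -> nat) v w :=
  (sum14 (fun u => y v u w + 3 * y v w u) %% 4)%N.
(** Keeps one order of each pair, which writes an antisymmetric chain of points as a chain minus its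
    swap. *)
Definition upper (s : nat -> nat -> nat) v w := if (v < w)%N then s v w else 0%N.

Definition all14 (p : nat -> bool) := all p (iota 0 14).

Lemma all14P (p : nat -> bool) : all14 p -> forall i : 'I_14, p i.
Proof. by move=> /allP H i; apply: H; rewrite mem_iota /= add0n. Qed.

(** With signs restored, each sum is 0 or 4 up to sign, by the count 2 + 2 or 2 + 1 + 1 over the
    edges at [v]. *)
Lemma trace12_half : all14 (fun v => all14 (fun a => all14 (fun b =>
  (trace1 half v a b + trace2 half v a b) %% 4 == 0)))%N.
Proof. by vm_compute. Qed.

(** The computed values of the double trace; entries missing from a row are 0, the default of
    [nth]. *)
Definition table : seq (seq nat) :=
  [:: [::]; [:: 0; 0; 0; 1; 0; 2; 0; 0; 0; 0; 0; 2; 0; 3];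
      [::]; [:: 0; 3; 0; 0; 0; 1; 0; 2; 0; 0; 0; 0; 0; 2];
      [::]; [:: 0; 2; 0; 3; 0; 0; 0; 1; 0; 2];
      [::]; [:: 0; 0; 0; 2; 0; 3; 0; 0; 0; 1; 0; 2];
      [::]; [:: 0; 0; 0; 0; 0; 2; 0; 3; 0; 0; 0; 1; 0; 2];
      [::]; [:: 0; 2; 0; 0; 0; 0; 0; 2; 0; 3; 0; 0; 0; 1];
      [::]; [:: 0; 1; 0; 2; 0; 0; 0; 0; 0; 2; 0; 3]]%N.

Lemma trace0_table : all14 (fun v => all14 (fun w =>
  trace0 (trace1 half) v w == nth 0%N (nth [::] table v) w)).
Proof. by vm_compute. Qed.

Definition trace_table v w := nth 0%N (nth [::] table v) w.

Lemma trace0E (v w : 'I_14) : trace0 (trace1 half) v w = trace_table v w.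
Proof. exact/eqP/(all14P (all14P trace0_table v)). Qed.

Lemma trace_table_antisym : all14 (fun v => all14 (fun w =>
  ((trace_table v w + trace_table w v) %% 4 == 0) && (trace_table v v == 0)))%N.
Proof. by vm_compute. Qed.

(** The number of points, odd as required: twice 23 is 2 modulo 4. *)
Lemma trace_table_upper_sum : sum14 (fun v => sum14 (fun w => upper trace_table v w)) = 23%N.
Proof. by vm_compute. Qed.

Lemma adjn_sym : symmetric adjn.
Proof. by move=> i j; rewrite /adjn orbA orbC -orbA. Qed.

Lemma heawoodE (i j : 'I_14) : heawood i j = adjn i j.
Proof. by rewrite /heawood /= /heawood_arc /adjn -!orbA. Qed.

Lemma adjn_odd : all14 (fun i => all14 (fun j => adjn i j ==> (odd i != odd j))).
Proof. by vm_compute. Qed.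

Lemma heawood_odd (i j : 'I_14) : heawood i j -> odd i != odd j.
Proof. by rewrite heawoodE; exact/implyP/(all14P (all14P adjn_odd i)). Qed.

Lemma heawood_deg3 (v : 'I_14) : exists w1 w2 w3, [/\ heawood v w1, heawood v w2 & heawood v w3] /\
  [/\ w1 != w2, w1 != w3 & w2 != w3].
Proof.
have H : [exists w1, [exists w2, [exists w3, [&& heawood v w1, heawood v w2, heawood v w3,
   w1 != w2, w1 != w3 & w2 != w3]]]].
  apply/existsP; exists (inord ((v + 1) %% 14)%N); apply/existsP; exists (inord ((v + 13) %% 14)%N).
  apply/existsP; exists (inord (if odd v then (v + 9) %% 14 else (v + 5) %% 14)%N).
  rewrite !heawoodE -!val_eqE /= !inordK ?ltn_mod //; last by case: ifP; rewrite ltn_mod.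
  by case: v => -[|[|[|[|[|[|[|[|[|[|[|[|[|[|//]]]]]]]]]]]]]].
have /existsP[w1 /existsP[w2 /existsP[w3 /and5P[h1 h2 h3 n12 /andP[n13 n23]]]]] := H.
by exists w1, w2, w3.
Qed.

Lemma disj_flip a b a' b' : disj a' b' a b = disj a b a' b'.
Proof.
rewrite /disj ![a' == _]eq_sym ![b' == _]eq_sym.
by case: (a == a'); case: (b == a'); case: (a == b'); case: (b == b').
Qed.

Lemma disj_rev a b a' b' : disj b a b' a' = disj a b a' b'.
Proof. by rewrite /disj; case: (a == a'); case: (b == a'); case: (a == b'); case: (b == b'). Qed.

Lemma near_flip a b a' b' : near a' b' a b = near a b a' b'.
Proof.
rewrite /near ![adjn a' _]adjn_sym ![adjn b' _]adjn_sym.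
by case: (adjn a a'); case: (adjn b a'); case: (adjn a b'); case: (adjn b b').
Qed.

Lemma near_rev a b a' b' : near b a b' a' = near a b a' b'.
Proof.
by rewrite /near; case: (adjn a a'); case: (adjn b a'); case: (adjn a b'); case: (adjn b b').
Qed.

Lemma wgt_flip a b a' b' : wgt a' b' a b = wgt a b a' b'.
Proof. by rewrite /wgt disj_flip near_flip; case: (adjn a b); case: (adjn a' b'). Qed.

Lemma wgt_rev a b a' b' : wgt b a b' a' = wgt a b a' b'.
Proof. by rewrite /wgt disj_rev near_rev (adjn_sym b) (adjn_sym b'). Qed.

Lemma wgt_neq0 a b a' b' : wgt a b a' b' != 0%N -> [/\ adjn a b, adjn a' b' & disj a b a' b'].
Proof.
rewrite /wgt; case: ifP => [h1|//]; case: ifP => [h2|//]; case: ifP => [h3|//] _.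
by split.
Qed.

Lemma half_neq0 a b a' b' : half a b a' b' != 0%N -> [/\ adjn a b, adjn a' b' & disj a b a' b'].
Proof.
rewrite /half; case: ifP => [//|_]; case: ifP => [//|_]; case: ifP => [_|//].
exact: wgt_neq0.
Qed.

Lemma sum14E f : sum14 f = (\sum_(u < 14) f u)%N.
Proof. by rewrite /sum14 sumnE big_map -[iota 0 14]/(index_iota 0 14) big_mkord. Qed.

Lemma trace1_neq0 v a b : trace1 half v a b != 0%N -> [/\ adjn a b, v != a & v != b].
Proof.
move=> H; have [u] : exists u : 'I_14, (half u v a b + 3 * half v u a b != 0)%N.
  apply/existsP; apply: contraNT H => /existsPn H; rewrite /trace1 sum14E big1 // => u _.
  by apply/eqP; have := H u; rewrite negbK.
have [u0|/half_neq0[_ ? /and4P[]]] := eqVneq (half u v a b) 0%N; last by split.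
rewrite u0 add0n muln_eq0 /= => /half_neq0[_ ? /and4P[]]; by split.
Qed.

Lemma half_full (a b a' b' : 'I_14) : (half a b a' b' + half a' b' a b)%N = full false a b a' b'.
Proof.
rewrite /half /full (wgt_flip a b); case: (odd a); case: (odd a') => //=.
have [w0|/wgt_neq0[_ _ /and4P[aa _ _ _]]] := eqVneq (wgt a b a' b') 0%N; first by rewrite w0 !if_same.
case: ltngtP; rewrite ?addn0 //= => E.
(* Edges are ordered by their codes in base 14; equal codes would give equal first vertices, against
   disjointness. *)
suff : a = a' by move=> aE; rewrite aE eqxx in aa.
apply/val_inj/eqP; have := congr1 (fun n => n %/ 14)%N E.
by rewrite /= !divnMDl // !divn_small // !addn0 => ->.
Qed.

End Weights.

(** * Chains of cells and their boundaries modulo 4 *)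

Section Sums.
Variables (R : realType) (K : comNzRingType).
Hypothesis K4 : 4%:R = 0 :> K.
Local Notation V := 'rV[R]_14.
Local Notation E := (V * V)%type.
Implicit Types (x : nat -> nat -> nat -> nat -> nat) (y : nat -> nat -> nat -> nat)
  (s : nat -> nat -> nat).

Definition C2 x : LC K E 3 :=
  \sum_(a < 14) \sum_(b < 14) \sum_(a' < 14) \sum_(b' < 14)
    (x a b a' b')%:R *: cell2 R K a b a' b'.
Definition C1 y : LC K E 2 :=
  \sum_(v < 14) \sum_(a < 14) \sum_(b < 14) (y v a b)%:R *: cell1 R K v a b.
Definition C0 s : LC K E 1 :=
  \sum_(v < 14) \sum_(w < 14) (s v w)%:R *: cell0 R K v w.

Lemma natr_mod4 m : (m %% 4)%N%:R = m%:R :> K.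
Proof. by rewrite [in RHS](divn_eq m 4) natrD natrM K4 mulr0 add0r. Qed.

Lemma natr3 m : (3 * m)%N%:R = - m%:R :> K.
Proof. by apply/eqP; rewrite -subr_eq0 opprK -natrD -mulSnr natrM K4 mul0r. Qed.

Lemma trace1E x v a b : (trace1 x v a b)%:R =
  \sum_(u < 14) ((x u v a b)%:R - (x v u a b)%:R) :> K.
Proof.
by rewrite natr_mod4 sum14E natr_sum; apply: eq_bigr => u _; rewrite natrD natr3.
Qed.

Lemma trace2E x v a b : (trace2 x v a b)%:R =
  \sum_(u < 14) ((x a b u v)%:R - (x a b v u)%:R) :> K.
Proof.
by rewrite natr_mod4 sum14E natr_sum; apply: eq_bigr => u _; rewrite natrD natr3.
Qed.

Lemma trace0_natr y v w : (trace0 y v w)%:R =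
  \sum_(u < 14) ((y v u w)%:R - (y v w u)%:R) :> K.
Proof.
by rewrite natr_mod4 sum14E natr_sum; apply: eq_bigr => u _; rewrite natrD natr3.
Qed.

Section Exchange.
Variable M : zmodType.
Implicit Type F : 'I_14 -> 'I_14 -> 'I_14 -> 'I_14 -> M.

Lemma sum_swap_last F :
  \sum_a \sum_b \sum_c \sum_d F a b c d = \sum_a \sum_b \sum_d \sum_c F a b c d.
Proof. by do 2!apply: eq_bigr => ? _; exact: exchange_big. Qed.

Lemma sum_swap_mid F :
  \sum_a \sum_b \sum_c \sum_d F a b c d = \sum_a \sum_c \sum_b \sum_d F a b c d.
Proof. by apply: eq_bigr => ? _; exact: exchange_big. Qed.

Lemma sum_swap_first F :
  \sum_a \sum_b \sum_c \sum_d F a b c d = \sum_b \sum_a \sum_c \sum_d F a b c d.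
Proof. exact: exchange_big. Qed.

End Exchange.

(** Regroups the boundary by faces, the sum in [trace1] running over the other end of the first
    edge. *)
Lemma C1_trace1 x : C1 (trace1 x) =
  \sum_(a < 14) \sum_(b < 14) \sum_(a' < 14) \sum_(b' < 14)
    (x a b a' b')%:R *: (cell1 R K b a' b' - cell1 R K a a' b').
Proof.
transitivity (\sum_(v < 14) \sum_(a < 14) \sum_(b < 14) \sum_(u < 14)
    ((x u v a b)%:R *: cell1 R K v a b - (x v u a b)%:R *: cell1 R K v a b)).
  do 3!apply: eq_bigr => ? _; rewrite trace1E scaler_suml; apply: eq_bigr => u _.
  by rewrite scalerBl.
rewrite sum_swap_last sum_swap_mid.
transitivity (\sum_(v < 14) \sum_(u < 14) \sum_(a < 14) \sum_(b < 14)
    (x u v a b)%:R *: cell1 R K v a b -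
  \sum_(v < 14) \sum_(u < 14) \sum_(a < 14) \sum_(b < 14) (x v u a b)%:R *: cell1 R K v a b).
  by rewrite -sumrB; apply: eq_bigr => ? _; rewrite -sumrB; apply: eq_bigr => ? _;
    rewrite -sumrB; apply: eq_bigr => ? _; rewrite -sumrB.
rewrite sum_swap_first -sumrB; apply: eq_bigr => ? _; rewrite -sumrB; apply: eq_bigr => ? _.
rewrite -sumrB; apply: eq_bigr => ? _; rewrite -sumrB; apply: eq_bigr => ? _.
by rewrite scalerBr.
Qed.

Lemma C1_trace2 x : C1 (trace2 x) =
  \sum_(a < 14) \sum_(b < 14) \sum_(a' < 14) \sum_(b' < 14)
    (x a b a' b')%:R *: (cell1 R K b' a b - cell1 R K a' a b).
Proof.
transitivity (\sum_(v < 14) \sum_(a < 14) \sum_(b < 14) \sum_(u < 14)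
    ((x a b u v)%:R *: cell1 R K v a b - (x a b v u)%:R *: cell1 R K v a b)).
  do 3!apply: eq_bigr => ? _; rewrite trace2E scaler_suml; apply: eq_bigr => u _.
  by rewrite scalerBl.
rewrite sum_swap_first sum_swap_mid.
transitivity (\sum_(a < 14) \sum_(b < 14) \sum_(v < 14) \sum_(u < 14)
    (x a b u v)%:R *: cell1 R K v a b -
  \sum_(a < 14) \sum_(b < 14) \sum_(v < 14) \sum_(u < 14) (x a b v u)%:R *: cell1 R K v a b).
  by rewrite -sumrB; apply: eq_bigr => ? _; rewrite -sumrB; apply: eq_bigr => ? _;
    rewrite -sumrB; apply: eq_bigr => ? _; rewrite -sumrB.
rewrite sum_swap_last -sumrB; apply: eq_bigr => ? _; rewrite -sumrB; apply: eq_bigr => ? _.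
rewrite -sumrB; apply: eq_bigr => ? _; rewrite -sumrB; apply: eq_bigr => ? _.
by rewrite scalerBr.
Qed.

Lemma bd_C2 x : bdL (C2 x) = C1 (trace1 x) - flip (C1 (trace2 x)).
Proof.
rewrite C1_trace1 C1_trace2 /C2 !linear_sum /= -big_split; apply: eq_bigr => a _ /=.
rewrite !linear_sum /= -big_split; apply: eq_bigr => b _ /=.
rewrite !linear_sum /= -big_split; apply: eq_bigr => a' _ /=.
rewrite !linear_sum /= -big_split; apply: eq_bigr => b' _ /=.
by rewrite !linearZ /= bd_cell2 /rim scalerBr scalerN.
Qed.

Lemma C0_trace0 y : bdL (C1 y) = C0 (trace0 y).
Proof.
transitivity (\sum_(v < 14) \sum_(a < 14) \sum_(b < 14)
    ((y v a b)%:R *: cell0 R K v b - (y v a b)%:R *: cell0 R K v a)).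
  rewrite /C1 linear_sum; apply: eq_bigr => v _; rewrite linear_sum; apply: eq_bigr => a _.
  rewrite linear_sum; apply: eq_bigr => b _ /=.
  by rewrite linearZ /= bd_cell1 scalerBr.
apply: eq_bigr => v _.
transitivity (\sum_(w < 14) \sum_(u < 14)
   ((y v u w)%:R *: cell0 R K v w - (y v w u)%:R *: cell0 R K v w)); last first.
  apply: eq_bigr => w _; rewrite trace0_natr scaler_suml; apply: eq_bigr => u _.
  by rewrite scalerBl.
transitivity (\sum_(a < 14) \sum_(b < 14) (y v a b)%:R *: cell0 R K v b -
  \sum_(a < 14) \sum_(b < 14) (y v a b)%:R *: cell0 R K v a).
  by rewrite -sumrB; apply: eq_bigr => a _; rewrite -sumrB.
by rewrite exchange_big -sumrB; apply: eq_bigr => w _; rewrite -sumrB.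
Qed.

Lemma flip_C0 s : flip (C0 s) = C0 (fun v w => s w v).
Proof.
rewrite /C0 exchange_big !linear_sum; apply: eq_bigr => v _ /=.
by rewrite linear_sum; apply: eq_bigr => w _ /=; rewrite linearZ /= flip_cell0.
Qed.

Definition half2 : LC K E 3 := C2 half.
Definition half1 : LC K E 2 := C1 (trace1 half).
Definition half0 : LC K E 1 := C0 (upper trace_table).

Lemma bd_half2 : bdL half2 = half1 + flip half1.
Proof.
rewrite bd_C2; congr (_ + _); rewrite -linearN /=; congr flip.
rewrite /half1 /C1 -sumrN; apply: eq_bigr => v _; rewrite -sumrN; apply: eq_bigr => a _.
rewrite -sumrN; apply: eq_bigr => b _; rewrite -scaleNr; congr (_ *: _).
apply/eqP; rewrite eq_sym -subr_eq0 opprK -natrD -natr_mod4.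
by rewrite (eqP (all14P (all14P (all14P trace12_half v) a) b)).
Qed.

Lemma bd_half1 : bdL half1 = half0 - flip half0.
Proof.
rewrite C0_trace0 /half0 flip_C0 /C0 -sumrB; apply: eq_bigr => v _.
rewrite -sumrB; apply: eq_bigr => w _; rewrite trace0E -scalerBl; congr (_ *: _).
have /andP[/eqP sym /eqP diag] := all14P (all14P trace_table_antisym v) w.
rewrite /upper; case: ltngtP => [vw|wv|/val_inj vw]; rewrite ?subr0 //.
  apply/eqP; rewrite sub0r -subr_eq0 opprK -natrD -natr_mod4 sym //.
by rewrite -vw diag.
Qed.

Lemma bd_half0 : bdL half0 = 23%:R *: << fun=> 0 >>.
Proof.
rewrite /half0 /C0 linear_sum -trace_table_upper_sum sum14E natr_sum scaler_suml.
apply: eq_bigr => v _; rewrite linear_sum sum14E natr_sum scaler_suml; apply: eq_bigr => w _ /=.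
by rewrite linearZ /= bd_pt.
Qed.

Lemma half2_flip : half2 - flip half2 = C2 (full false).
Proof.
have -> : half2 - flip half2 = \sum_(a < 14) \sum_(b < 14) \sum_(a' < 14) \sum_(b' < 14)
    ((half a b a' b')%:R *: cell2 R K a b a' b' + (half a b a' b')%:R *: cell2 R K a' b' a b).
  rewrite /half2 /C2 linear_sum -sumrB; apply: eq_bigr => a _.
  rewrite linear_sum -sumrB; apply: eq_bigr => b _.
  rewrite linear_sum -sumrB; apply: eq_bigr => a' _.
  rewrite linear_sum -sumrB; apply: eq_bigr => b' _ /=.
  by rewrite linearZ /= flip_cell2 scalerN opprK.
transitivity (\sum_(a < 14) \sum_(b < 14) \sum_(a' < 14) \sum_(b' < 14)
    (half a b a' b')%:R *: cell2 R K a b a' b' +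
    \sum_(a < 14) \sum_(b < 14) \sum_(a' < 14) \sum_(b' < 14)
    (half a b a' b')%:R *: cell2 R K a' b' a b).
  by rewrite -big_split; apply: eq_bigr => ? _; rewrite -big_split; apply: eq_bigr => ? _;
    rewrite -big_split; apply: eq_bigr => ? _; rewrite -big_split.
rewrite [X in _ + X]sum_swap_mid [X in _ + X]sum_swap_last [X in _ + X]sum_swap_first.
rewrite [X in _ + X]sum_swap_mid -big_split; apply: eq_bigr => a _.
rewrite -big_split; apply: eq_bigr => b _; rewrite -big_split; apply: eq_bigr => a' _.
rewrite -big_split; apply: eq_bigr => b' _ /=.
by rewrite -scalerDl -natrD half_full.
Qed.

(** Reversing both edges preserves the orientation of their product. *)
Lemma C2_full_parity : C2 (full true) = C2 (full false).
Proof.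
rewrite /C2 sum_swap_first sum_swap_last; apply: eq_bigr => a _; apply: eq_bigr => b _.
apply: eq_bigr => a' _; apply: eq_bigr => b' _; rewrite cell2C; congr (_%:R *: _).
rewrite /full wgt_rev; have [->|/wgt_neq0[ab ab' _]] := eqVneq (wgt a b a' b') 0%N; first by rewrite !if_same.
rewrite -!heawoodE in ab ab'; move: (heawood_odd ab) (heawood_odd ab').
by case: (odd a); case: (odd b); case: (odd a'); case: (odd b').
Qed.

(** Following the Hamiltonian cycle 0, 1, ..., 13, an automorphism either keeps or exchanges the
    parities throughout; [C2_full_parity] absorbs the exchange. *)
Lemma relabel_C2 (f : 'I_14 -> 'I_14) : injective f ->
  (forall i j, heawood (f i) (f j) = heawood i j) ->
  pushL (pmap (@relabel R 14 f)) (C2 (full false)) = C2 (full false).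
Proof.
move=> f_inj f_adj.
have f_odd (i : 'I_14) : odd (f i) = odd i (+) odd (f ord0).
  have H m : (m < 14)%N -> odd (f (inord m)) = odd m (+) odd (f ord0).
    elim: m => [_|m IH m14].
      by rewrite /=; congr (odd (f _)); apply/val_inj; rewrite /= inordK.
    have adj : heawood (inord m : 'I_14) (inord m.+1).
      rewrite heawoodE inordK; last exact: ltnW.
      by rewrite inordK // /adjn addn1 eqxx.
    rewrite -f_adj in adj; have := heawood_odd adj; rewrite IH /=; last exact: ltnW.
    by case: (odd m); case: (odd (f ord0)); case: (odd (f _)).
  by rewrite -[in LHS](inord_val i) H.
have fullE (a b a' b' : 'I_14) : full false a b a' b' = full (odd (f ord0)) (f a) (f b) (f a') (f b').
  rewrite /full (f_odd a) (f_odd a').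
  have -> : wgt (f a) (f b) (f a') (f b') = wgt a b a' b'.
    have adjE (i j : 'I_14) : adjn (f i) (f j) = adjn i j by rewrite -2!heawoodE f_adj.
    have eqE (i j : 'I_14) : (f i == f j :> nat) = (i == j :> nat).
      by rewrite -[LHS]/(f i == f j) (inj_eq f_inj).
    by rewrite /wgt /disj /near !adjE !eqE.
  by case: (odd a); case: (odd a'); case: (odd (f ord0)).
transitivity (C2 (full (odd (f ord0)))); last by case: (odd _); rewrite ?C2_full_parity.
rewrite /C2 [RHS](reindex_inj f_inj) linear_sum; apply: eq_bigr => a _ /=.
rewrite [RHS](reindex_inj f_inj) linear_sum; apply: eq_bigr => b _ /=.
rewrite [RHS](reindex_inj f_inj) linear_sum; apply: eq_bigr => a' _ /=.
rewrite [RHS](reindex_inj f_inj) linear_sum; apply: eq_bigr => b' _ /=.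
by rewrite linearZ /= relabel_cell2 fullE.
Qed.

End Sums.

(** * The cycle in the deleted product *)

Section Deleted.
Variables (R : realType) (K : comNzRingType).
Local Notation V := 'rV[R]_14.
Local Notation E := (V * V)%type.
Local Notation G := (realization R 14 heawood).

(** The degenerate case [a = b] stands for a vertex, which admits the faces of the products of
    edges. *)
Definition delprod : set E := [set p | exists a b a' b' : 'I_14,
  [/\ (a == b) || heawood a b, (a' == b') || heawood a' b', disj a b a' b' & box a b a' b' p]].

Lemma cin_cell n (c : LC K E n) (a b a' b' : 'I_14) :
  (a == b) || heawood a b -> (a' == b') || heawood a' b' -> disj a b a' b' ->
  lin (box a b a' b') c -> cin delprod (real c).
Proof.
move=> ab ab' dj /(cin_real (@cvx_box R 14 a b a' b')); apply: cinS => p pb.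
by exists a, b, a', b'.
Qed.

(** The sums run over all quadruples; a nonzero weight is what forces adjacency and disjointness. *)
Lemma cinZ_nat (X : normedModType R) (A : set X) n (m : nat) (c : SC K X n) :
  (m != 0%N -> cin A c) -> cin A (m%:R *: c).
Proof.
have [-> _|m0 /(_ isT)] := eqVneq m 0%N; last exact: supportedZ.
by rewrite scale0r; exact: supported0.
Qed.

Lemma cin_half2 : cin delprod (real (half2 R K)).
Proof.
rewrite /half2 /C2 linear_sum; apply: supported_sum => a _; rewrite linear_sum.
apply: supported_sum => b _; rewrite linear_sum; apply: supported_sum => a' _.
rewrite linear_sum; apply: supported_sum => b' _; rewrite linearZ /=.
apply: cinZ_nat => /half_neq0[ab ab' dj].
apply: (@cin_cell 3 _ a b a' b'); rewrite ?heawoodE ?ab ?ab' ?orbT //.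
exact: lin_cell2.
Qed.

Lemma cin_half1 : cin delprod (real (half1 R K)).
Proof.
rewrite /half1 /C1 linear_sum; apply: supported_sum => v _; rewrite linear_sum.
apply: supported_sum => a _; rewrite linear_sum; apply: supported_sum => b _.
rewrite linearZ /=; apply: cinZ_nat => /trace1_neq0[ab va vb].
apply: (@cin_cell 2 _ v v a b); rewrite ?eqxx ?heawoodE ?ab ?orbT //.
  by rewrite /disj va vb.
exact: lin_cell1.
Qed.

Lemma cin_half0 : cin delprod (real (half0 R K)).
Proof.
rewrite /half0 /C0 linear_sum; apply: supported_sum => v _; rewrite linear_sum.
apply: supported_sum => w _; rewrite linearZ /=; apply: cinZ_nat; rewrite /upper.
case: ifP => // vw _; apply: (@cin_cell 1 _ v v w w); rewrite ?eqxx //.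
  by rewrite /disj (ltn_eqF vw).
exact: lin_cell0.
Qed.

Lemma seg_G (a b : 'I_14) (x : V) : (a == b) || heawood a b -> seg a b x -> G x.
Proof. by move=> ab xs; apply/GP; exists a, b. Qed.

Lemma delprod_G p : delprod p -> [/\ G p.1, G p.2 & p.1 != p.2].
Proof.
move=> [a [b [a' [b' [ab ab' dj [xs ys]]]]]]; split; [exact: seg_G xs|exact: seg_G ys|].
apply: contraTneq dj => xy; rewrite -xy in ys.
have [[x0 x1] xab] := xs; have [_ xab'] := ys.
have [k xk] : exists k, p.1 0 k != 0.
  apply/existsP; apply: contraT => /existsPn H; have := x1; rewrite big1 => [/eqP|k _].
    by rewrite eq_sym oner_eq0.
  by apply/eqP; have := H k; rewrite negbK.
have := xab k xk; have := xab' k xk; rewrite /disj.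
by move=> /orP[]/eqP -> /orP[]/eqP ->; rewrite eqxx ?andbF.
Qed.

Lemma push_swap_real n (c : LC K E n) : push (@swap V) (real c) = real (flip c).
Proof. by apply: push_real => v t _; rewrite !comb_pair. Qed.

Lemma fst_C2 x : pushL fst (C2 R K x) = 0.
Proof.
rewrite /C2 linear_sum big1 // => a _; rewrite linear_sum big1 // => b _.
rewrite linear_sum big1 // => a' _; rewrite linear_sum big1 // => b' _.
by rewrite linearZ /= fst_cell2 scaler0.
Qed.

Lemma relabel_seg (f : 'I_14 -> 'I_14) i j (x : V) : seg i j x -> seg (f i) (f j) (relabel f x).
Proof.
have [-> xs|ij xs] := eqVneq i j.
  by rewrite (seg_vtx xs) relabel_vtx; exact: vtx_segl.
rewrite (seg_arc ij xs) /arc linearD !linearZ /= !relabel_vtx.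
apply: (@arc_seg R 14 (f i) (f j)).
by rewrite (seg_ge0 _ xs) -(seg_sum ij xs) lerDr; exact: seg_ge0 xs.
Qed.

Hypothesis K4 : 4%:R = 0 :> K.

Section Track.
Variables (q : V -> V) (v : 'I_14 -> 'I_14).
Hypothesis q_cont : cont_on G q.
Hypothesis v_inj : injective v.
Hypothesis v_adj : forall i j, heawood i j -> heawood (v i) (v j).
Hypothesis q_vtx : forall i, q (vtx R i) = vtx R (v i).
Hypothesis q_seg : forall i j (x : V), heawood i j -> seg i j x -> seg (v i) (v j) (q x).

(** An injective map that preserves edges permutes the finite set of edges, hence also reflects
    adjacency. *)
Lemma v_adjE i j : heawood (v i) (v j) = heawood i j.
Proof.
pose S := [set p : 'I_14 * 'I_14 | heawood p.1 p.2]%SET.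
pose vv (p : 'I_14 * 'I_14) := (v p.1, v p.2).
have vv_inj : injective vv by move=> [a b] [c d] [/v_inj -> /v_inj ->].
have sub : (vv @: S \subset S)%SET.
  by apply/fintype.subsetP => _ /imsetP[p pS ->]; move: pS; rewrite !inE; exact: v_adj.
have E : (vv @: S = S)%SET by apply/eqP; rewrite eqEcard sub card_imset // leqnn.
apply/idP/idP => [H|]; last exact: v_adj.
have : (v i, v j) \in S by rewrite inE.
by rewrite -E => /imsetP[[a b]]; rewrite inE /= => ab [/v_inj -> /v_inj ->].
Qed.

Definition slide (p : (V * R^o)%type) : V := (1 - p.2 : R) *: q p.1 + (p.2 : R) *: relabel v p.1.
Definition slide2 (p : (E * R^o)%type) : E := (slide (p.1.1, p.2), slide (p.1.2, p.2)).

Lemma q_seg_vtx i j (x : V) : (i == j) || heawood i j -> seg i j x -> seg (v i) (v j) (q x).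
Proof.
have [<- _ /seg_vtx ->|_ /= ij] := eqVneq i j; last exact: q_seg.
by rewrite q_vtx; exact: vtx_segl.
Qed.

Lemma slide_seg i j p : (i == j) || heawood i j -> cylinder (seg i j) p -> seg (v i) (v j) (slide p).
Proof.
move=> ij [xs /andP[s0 s1]].
have := @cvx_seg R 14 (v i) (v j) 2 (fun k => if k == ord0 then q p.1 else relabel v p.1)
  (\row_k (if k == ord0 then 1 - p.2 else p.2)).
rewrite /comb !big_ord_recl big_ord0 /= addr0 !mxE /=; apply.
  split=> [k|]; first by rewrite mxE; case: ifP => _ //; rewrite subr_ge0.
  by rewrite !big_ord_recl big_ord0 /= !mxE /= addr0 subrK.
by move=> k; case: ifP => _; [exact: q_seg_vtx|exact: relabel_seg].
Qed.

(** Both ends of the homotopy send an edge into the same edge, and [v] keeps disjoint edges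
    disjoint, so the straight line stays in a product of disjoint edges. *)
Lemma slide2_delprod p : cylinder delprod p -> delprod (slide2 p).
Proof.
move=> [[a [b [a' [b' [ab ab' dj [xs ys]]]]]] s01].
exists (v a), (v b), (v a'), (v b'); split.
- by rewrite (inj_eq v_inj) v_adjE.
- by rewrite (inj_eq v_inj) v_adjE.
- move: dj; rewrite /disj.
  have eqE (i j : 'I_14) : (v i == v j :> nat) = (i == j :> nat).
    by rewrite -[LHS]/(v i == v j) (inj_eq v_inj).
  by rewrite !eqE.
- by split; apply: slide_seg.
Qed.

Lemma slide2_cont : cont_on (cylinder delprod) slide2.
Proof.
have slide_cont : cont_on (cylinder G) slide.
  have c1 : cont_on (cylinder G) (fst : V * R^o -> V) by exact: cont_on_fst.
  have c2 : cont_on (cylinder G) (snd : V * R^o -> R^o) by exact: cont_on_snd.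
  apply: cont_onD; apply: cont_onZ => //.
  - by apply: cont_onB => //; exact: cont_on_cst.
  - by apply: (cont_on_comp c1 q_cont) => p [].
  - exact: (cont_on_compT (@comb_continuous R V 14 _) c1).
have d1 : cont_on (cylinder delprod) (fst : E * R^o -> E) by exact: cont_on_fst.
have d2 : cont_on (cylinder delprod) (snd : E * R^o -> R^o) by exact: cont_on_snd.
have d11 : cont_on (cylinder delprod) (fun p : E * R^o => p.1.1).
  exact: (cont_on_comp d1 (cont_on_fst (A := setT))).
have d12 : cont_on (cylinder delprod) (fun p : E * R^o => p.1.2).
  exact: (cont_on_comp d1 (cont_on_snd (A := setT))).
apply: cont_on_pair.
  apply: (cont_on_comp (cont_on_pair d11 d2) slide_cont) => p [/delprod_G[Gx _ _] s01].
  by split.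
apply: (cont_on_comp (cont_on_pair d12 d2) slide_cont) => p [/delprod_G[_ Gy _] s01].
by split.
Qed.

Definition deleted_cycle : SC K E 3 := real (half2 R K - flip (half2 R K)).

Lemma deleted_cycleE : deleted_cycle = real (C2 R K (full false)).
Proof. by rewrite /deleted_cycle half2_flip. Qed.

Lemma fst_deleted_cycle : push fst deleted_cycle = 0.
Proof.
rewrite deleted_cycleE push_real => [|w t _]; last by rewrite comb_pair.
by rewrite fst_C2 linear0.
Qed.

Lemma bd_deleted_cycle : bdS deleted_cycle = 0.
Proof.
rewrite /deleted_cycle bd_real linearB /= bd_flip bd_half2 //.
have -> : flip (half1 R K + flip (half1 R K)) = flip (half1 R K) + flip (flip (half1 R K)).
  exact: linearD.
by rewrite flipK [X in _ - X]addrC subrr linear0.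
Qed.

Lemma cin_deleted_cycle : cin delprod deleted_cycle.
Proof.
rewrite /deleted_cycle linearB /=; apply: supportedB; first exact: cin_half2.
rewrite -push_swap_real; apply: cin_push cin_half2; first exact: swap_cont.
move=> [x y] [a [b [a' [b' [ab ab' dj [xs ys]]]]]].
by exists a', b', a, b; split=> //; rewrite disj_flip.
Qed.

(** The sign is due to the direction of [slide2]: it starts at the image under [q] and ends at the
    relabelled cycle, which is the original one. *)
Definition track_chain : SC K E 4 := - hom slide2 deleted_cycle.

Lemma cin_track_chain : cin delprod track_chain.
Proof.
apply: supportedN; exact: cin_hom slide2_cont slide2_delprod cin_deleted_cycle.
Qed.

Lemma bd_track_chain : bdS track_chain = push (pmap q) deleted_cycle - deleted_cycle.
Proof.
rewrite /track_chain linearN /= bd_hom bd_deleted_cycle hom0 subr0 opprB; congr (_ - _).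
  apply: eq_push cin_deleted_cycle => p _; rewrite /slide2 /slide /pmap /=.
  by rewrite !subr0 !scale1r !scale0r !addr0.
transitivity (push (pmap (@relabel R 14 v)) deleted_cycle).
  apply: eq_push cin_deleted_cycle => p _; rewrite /slide2 /slide /pmap /=.
  by rewrite !subrr !scale1r !scale0r !add0r.
rewrite deleted_cycleE push_real => [|w t _]; last by rewrite !comb_pair /pmap /= !linear_sum; congr pair;
  apply: eq_bigr => i _; rewrite linearZ.
by rewrite relabel_C2 //; exact: v_adjE.
Qed.

(** The homotopy acts on each factor separately, so its projection is the prism over the projected
    cycle, which is 0. *)
Lemma fst_track_chain : push fst track_chain = 0.
Proof.
rewrite /track_chain linearN /= push_hom.
have -> : hom (fst \o slide2) deleted_cycle = hom slide (push fst deleted_cycle) by rewrite hom_push.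
by rewrite fst_deleted_cycle hom0 oppr0.
Qed.

Lemma snd_track_chain : push snd track_chain = 0.
Proof.
rewrite /track_chain linearN /= push_hom.
have -> : hom (snd \o slide2) deleted_cycle = hom slide (push snd deleted_cycle) by rewrite hom_push.
have -> : push snd deleted_cycle = push fst (push (@swap V) deleted_cycle) by rewrite push_comp.
have -> : push (@swap V) deleted_cycle = - deleted_cycle.
  by rewrite /deleted_cycle push_swap_real flipB flipK -linearN opprB.
by rewrite linearN /= fst_deleted_cycle oppr0 hom0 oppr0.
Qed.

End Track.
End Deleted.

(** * The embedded graph *)

Section Main.
Variable R : realType.
Local Notation V := 'rV[R]_14.
Local Notation G := (realization R 14 heawood).
Local Notation S := (S3 R).

Lemma cont_on_val (X : normedModType R) (Y : normedModType R) (A : set X) (B : set Y) (f : A -> B) :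
  continuous f -> cont_on A (extend (fun x : A => set_val (f x))).
Proof.
move=> cf; apply: cont_on_extend => x; apply: continuous_comp; first exact: cf.
exact: initial_continuous.
Qed.

Variables (f : G -> S) (h : continuousType S S).
Hypothesis f_emb : topological_embedding f.
Hypothesis h_homeo : homeomorphism h.
Hypothesis h_rev : orientation_reversing h.
Hypothesis h_img : h @` range f = range f.

Let F : V -> 'rV[R]_4 := extend (fun x : G => set_val (f x)).
Let H : 'rV[R]_4 -> 'rV[R]_4 := extend (fun x : S => set_val (h x)).

Lemma F_val (x : G) : F (set_val x) = set_val (f x).
Proof. exact: extend_val. Qed.

Lemma H_val (x : S) : H (set_val x) = set_val (h x).
Proof. exact: extend_val. Qed.

Lemma set_lift (X : Type) (A : set X) x : A x -> exists y : A, set_val y = x.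
Proof. by move=> Ax; exists (exist _ x (mem_set Ax)). Qed.

Lemma F_S3 x : G x -> S (F x).
Proof. by move=> Gx; have [y <-] := set_lift Gx; rewrite F_val; exact: set_valP. Qed.

Lemma H_S3 x : S x -> S (H x).
Proof. by move=> Sx; have [y <-] := set_lift Sx; rewrite H_val; exact: set_valP. Qed.

Lemma F_inj x y : G x -> G y -> F x = F y -> x = y.
Proof.
move=> Gx Gy; have [x' <-] := set_lift Gx; have [y' <-] := set_lift Gy; rewrite !F_val => /val_inj.
by case: f_emb => _ finj _ /finj ->.
Qed.

Lemma H_inj x y : S x -> S y -> H x = H y -> x = y.
Proof.
move=> Gx Gy; have [x' <-] := set_lift Gx; have [y' <-] := set_lift Gy; rewrite !H_val => /val_inj.
by case: h_homeo => _ [g [_ hK _]] /(can_inj hK) ->.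
Qed.

Lemma F_cont : cont_on G F.
Proof. by apply: cont_on_val; case: f_emb. Qed.

Lemma H_cont : cont_on S H.
Proof. by apply: cont_on_val; case: h_homeo. Qed.

(** The conjugate of [h] by the embedding, as a total function; on the graph the choice is
    determined by injectivity of [f]. *)
Definition q (x : V) : V := xget 0 [set y | G y /\ F y = H (F x)].

Lemma qP x : G x -> G (q x) /\ F (q x) = H (F x).
Proof.
move=> Gx; have [x' <-] := set_lift Gx.
have : (h @` range f) (h (f x')) by exists (f x') => //; exists x'.
rewrite h_img => -[y' _ yE].
apply: (@xgetPex _ 0 [set y | G y /\ F y = H (F (set_val x'))]); exists (set_val y').
by split; [exact: set_valP|rewrite !F_val H_val yE].
Qed.

Lemma q_inj x y : G x -> G y -> q x = q y -> x = y.
Proof.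
move=> Gx Gy qE; have [_ fx] := qP Gx; have [_ fy] := qP Gy.
by apply: F_inj => //; apply: H_inj; rewrite -?fx -?fy ?qE //; exact: F_S3.
Qed.

(** The graph carries the topology induced by [f], so a neighbourhood of [q x] is cut out by one of
    [H (F x)] in the sphere. *)
Lemma q_cont : cont_on G q.
Proof.
move=> x Gx U /nbhs_interior Uq.
have [Gqx Fq] := qP Gx.
have [_ _ /(_ (set_val @^-1` U°))[]] := f_emb.
  by exists (U°) => //; exact: open_interior.
move=> W [B oB <-] BU.
have FB y : G y -> B (F y) -> U y.
  move=> Gy; have [y' <-] := set_lift Gy; rewrite F_val => By; apply: interior_subset.
  by have := congr1 (fun A => A y') BU; rewrite /= => <-.
have nB : nbhs (H (F x)) B.
  apply: open_nbhs_nbhs; split => //; rewrite -Fq.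
  have [y yE] := set_lift Gqx; rewrite -yE F_val.
  have := congr1 (fun A => A y) BU; rewrite /= => ->; rewrite yE.
  exact: nbhs_singleton Uq.
have := cont_on_comp F_cont H_cont F_S3 Gx nB.
apply: filterS => y /= Hy Gy; have [Gq Fqy] := qP Gy.
by apply: FB => //; rewrite Fqy; exact: Hy.
Qed.

Lemma no_reversal : False.
Proof.
pose K : comNzRingType := 'Z_4.
have K4 : 4%:R = 0 :> K by apply/val_inj.
have K2 : 2%:R != 0 :> K by [].
have q_G x : G x -> G (q x) by move=> /qP[].
pose v := vmap (R := R) q.
have v_inj : injective v := vmap_inj heawood_sym heawood_irrefl q_cont q_G q_inj heawood_deg3.
have v_vtx i : q (vtx R i) = vtx R (v i) :=
  vmapE heawood_sym heawood_irrefl q_cont q_G q_inj heawood_deg3 i.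
have v_edge i j (ij : heawood i j) :=
  q_edge heawood_sym heawood_irrefl q_cont q_G q_inj heawood_deg3 ij.
have v_adj i j : heawood i j -> heawood (v i) (v j) by move=> /v_edge[].
have v_seg i j x : heawood i j -> seg i j x -> seg (v i) (v j) (q x).
  by move=> /v_edge[_ Hs] /Hs.
have FF p : delprod p -> Conf (pmap F p).
  move=> /delprod_G[Gx Gy xy]; split; rewrite /=; try exact: F_S3.
  by apply: contraNneq xy => /(F_inj Gx Gy) ->.
have cFF : cont_on (@delprod R) (pmap F).
  apply: cont_on_pair.
    by apply: (cont_on_comp (cont_on_fst (A := @delprod R)) F_cont) => p /delprod_G[].
  by apply: (cont_on_comp (cont_on_snd (A := @delprod R)) F_cont) => p /delprod_G[].
have swF n (c : SC K (V * V)%type n) : push (@swap _) (push (pmap F) c) = push (pmap F) (push (@swap V) c).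
  by rewrite !push_comp.
have zE : push (pmap F) (real (half2 R K)) - push (@swap _) (push (pmap F) (real (half2 R K))) =
    push (pmap F) (deleted_cycle R K).
  rewrite swF push_swap_real -pushB; congr (push _ _); apply: esym; exact: linearB.
apply: (@degree_contradiction R K K4 K2 H H_cont H_S3 H_inj _
  (push (pmap F) (real (half0 R K))) (push (pmap F) (real (half1 R K)))
  (push (pmap F) (real (half2 R K))) 23%:R (push (pmap F) (track_chain K q v))).
- by move=> c; exact: acts_on_homology_bounds h_rev.
- exact: cin_push cFF FF (@cin_half0 R K).
- exact: cin_push cFF FF (@cin_half1 R K).
- exact: cin_push cFF FF (@cin_half2 R K).
- rewrite bd_push bd_real bd_half0 // !linearZ /= realU pushU.
  by congr (_ *: << _ >>); exact: eq_simplex0.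
- by apply/val_inj.
- rewrite bd_push bd_real bd_half1 // swF push_swap_real -pushB; congr (push _ _); exact: linearB.
- rewrite bd_push bd_real bd_half2 // swF push_swap_real -pushD; congr (push _ _); exact: linearD.
(* Projections commute with [F], and the cycle is killed already in the deleted product of the
   graph. *)
- rewrite zE push_comp (_ : fst \o pmap F = F \o fst) // -push_comp fst_deleted_cycle //.
  by rewrite linear0.
- exact: cin_push cFF FF (cin_track_chain q_cont v_inj v_adj v_vtx v_seg).
- by rewrite push_comp (_ : fst \o pmap F = F \o fst) // -push_comp fst_track_chain // linear0.
- by rewrite push_comp (_ : snd \o pmap F = F \o snd) // -push_comp snd_track_chain // linear0.
rewrite zE bd_push bd_track_chain // pushB; congr (_ - _); rewrite !push_comp.
apply: eq_push (@cin_deleted_cycle R K) => p /delprod_G[Gx Gy _]; rewrite /pmap /=.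
by have [_ ->] := qP Gx; have [_ ->] := qP Gy.
Qed.

End Main.

Theorem theorem3p18 (R : realType) : intrinsically_chiral R heawood.
Proof. by move=> f [fe _] [h [hh hr hG]]; exact: no_reversal fe hh hr hG. Qed.
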